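(* For every $f\in C^2(B^2\times[-1,1])$, $\mathcal{B}_{2m}(f)$ converges to $f$ in the uniform norm on $B^2\times[-1,1]$ as $m\to\infty$.
   Context: $B^2$ is the closed unit disk in $\mathbb{R}^2$. For $\theta\in[0,2\pi]$ and $t\in[-1,1]$ let $I(\theta;t)=\{(t\cos\theta+s\sin\theta,\ t\sin\theta-s\cos\theta): |s|\le\sqrt{1-t^2}\}$ (the chord of $B^2$ on the line $x\cos\theta+y\sin\theta=t$). For a function $g$ on $B^2$, the Radon projection $\mathcal{R}_\theta(g;t)$ is the integral of $g$ over $I(\theta;t)$ with respect to arc length; for $f$ on $B^2\times[-1,1]$, $\mathcal{R}_\theta(f(\cdot,\cdot,z);t)$ is the Radon projection of $(x,y)\mapsto f(x,y,z)$ for fixed $z$. $U_k(\cos\alpha)=\sin((k+1)\alpha)/\sin\alpha$ is the Chebyshev polynomial of the second kind; $\widetilde T_0=1$ and $\widetilde T_k(\cos\alpha)=\sqrt2\cos(k\alpha)$ for $k\ge1$. For $m\ge1$ put $\theta_j=\frac{j\pi}{2m+1}$, $z_l=\cos\gamma_l$ with $\gamma_l=\frac{2l+1}{4m}\pi$, $\phi_\nu=\frac{2\pi\nu}{2m+1}$, $\sigma_\nu(x,y)=\arccos(x\cos\phi_\nu+y\sin\phi_\nu)\in[0,\pi]$. Define $$\mathcal{B}_{2m}(f)(x,y,z)=\sum_{\nu=0}^{2m}\sum_{j=1}^{2m}\sum_{l=0}^{2m-1}\mathcal{R}_{\phi_\nu}(f(\cdot,\cdot,z_l);\cos\theta_j)\,T_{\nu,j,l}(x,y,z),$$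 $$T_{\nu,j,l}(x,y,z)=\frac{1}{2m(2m+1)^2}\sum_{n=0}^{2m}\sum_{k=0}^{n}(k+1)\sin((k+1)\theta_j)\,U_k(\cos\sigma_\nu(x,y))\,\widetilde T_{n-k}(z_l)\,\widetilde T_{n-k}(z).$$ *)

(* Defs.v *)
From Stdlib Require Import Reals Lra Lia.
From Coquelicot Require Import Coquelicot.
Open Scope R_scope.

Definition disk (q : R * R) : Prop := fst q ^ 2 + snd q ^ 2 <= 1.

Definition cylinder (p : R * R * R) : Prop :=
  disk (fst p) /\ -1 <= snd p <= 1.

Inductive axis := axis_x | axis_y | axis_z.

Definition shift (i : axis) (h : R) (p : R * R * R) : R * R * R :=
  let '(x, y, z) := p in
  match i with
  | axis_x => (x + h, y, z)
  | axis_y => (x, y + h, z)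
  | axis_z => (x, y, z + h)
  end.

Definition is_partial (i : axis) (f : R * R * R -> R) (p : R * R * R) (l : R)
  : Prop :=
  is_derive (fun h => f (shift i h p)) 0 l.

(* C^k of a closed set K: f is continuous on K, and all partial derivatives of
   order at most k exist in the interior of K and extend continuously to K.
   The hypothesis [locally p K] says that p is an interior point of K.  Values
   of f outside K play no role. *)
Fixpoint Ck_on (k : nat) (K : R * R * R -> Prop) (f : R * R * R -> R) : Prop :=
  continuous_on K f /\
  match k with
  | O => True
  | S k' => forall i : axis, exists g : R * R * R -> R,
      Ck_on k' K g /\ forall p, locally p K -> is_partial i f p (g p)
  end.

Definition converges_uniformly_on (K : R * R * R -> Prop)
  (F : nat -> R * R * R -> R) (f : R * R * R -> R) : Prop :=
  forall eps : R, 0 < eps -> exists N : nat, forall m : nat, (N <= m)%nat ->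
    forall p, K p -> Rabs (F m p - f p) < eps.

(* The parametrization of the chord has unit speed, so ds is arc length. *)
Definition radon (theta : R) (g : R * R -> R) (t : R) : R :=
  RInt (fun s => g (t * cos theta + s * sin theta, t * sin theta - s * cos theta))
    (- sqrt (1 - t ^ 2)) (sqrt (1 - t ^ 2)).

(* The Chebyshev polynomials are given by their recurrences, so that they are
   also defined where sin a = 0; [chebU_cos] and [chebT_cos] give the
   trigonometric formulas. *)
Fixpoint chebU (k : nat) (x : R) : R :=
  match k with
  | O => 1
  | S k' => match k' with
            | O => 2 * x
            | S k'' => 2 * x * chebU k' x - chebU k'' x
            end
  end.

Fixpoint chebT (k : nat) (x : R) : R :=
  match k with
  | O => 1
  | S k' => match k' with
            | O => x
            | S k'' => 2 * x * chebT k' x - chebT k'' x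
            end
  end.

Lemma chebU_cos (k : nat) (a : R) :
  chebU k (cos a) * sin a = sin (INR (k + 1) * a).
Proof.
enough (H : chebU k (cos a) * sin a = sin (INR (k + 1) * a) /\
  chebU (S k) (cos a) * sin a = sin (INR (S k + 1) * a)) by apply H.
induction k as [|k [IH1 IH2]].
- split; simpl.
  + rewrite !Rmult_1_l; reflexivity.
  + replace ((1 + 1) * a) with (2 * a) by ring; rewrite sin_2a; ring.
- split; [exact IH2|].
  change (chebU (S (S k)) (cos a))
    with (2 * cos a * chebU (S k) (cos a) - chebU k (cos a)).
  rewrite Rmult_minus_distr_r, Rmult_assoc, IH1, IH2.
  replace (INR (S (S k) + 1) * a) with (INR (S k + 1) * a + a)
    by (rewrite !plus_INR, !S_INR; ring).
  replace (INR (k + 1) * a) with (INR (S k + 1) * a - a)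
    by (rewrite !plus_INR, !S_INR; ring).
  rewrite sin_plus, sin_minus; ring.
Qed.

Lemma chebT_cos (k : nat) (a : R) : chebT k (cos a) = cos (INR k * a).
Proof.
enough (H : chebT k (cos a) = cos (INR k * a) /\
  chebT (S k) (cos a) = cos (INR (S k) * a)) by apply H.
induction k as [|k [IH1 IH2]].
- split; simpl.
  + rewrite Rmult_0_l, cos_0; reflexivity.
  + rewrite Rmult_1_l; reflexivity.
- split; [exact IH2|].
  change (chebT (S (S k)) (cos a))
    with (2 * cos a * chebT (S k) (cos a) - chebT k (cos a)).
  rewrite IH1, IH2, !S_INR.
  replace ((INR k + 1 + 1) * a) with ((INR k + 1) * a + a) by ring.
  replace (INR k * a) with ((INR k + 1) * a - a) by ring.
  rewrite cos_plus, cos_minus; ring.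
Qed.

Definition chebT_tilde (k : nat) (x : R) : R :=
  match k with
  | O => 1
  | S _ => sqrt 2 * chebT k x
  end.

Definition theta (m j : nat) : R := INR j * PI / INR (2 * m + 1).

Definition gamma (m l : nat) : R := INR (2 * l + 1) / INR (4 * m) * PI.

Definition znode (m l : nat) : R := cos (gamma m l).

Definition phi (m nu : nat) : R := 2 * PI * INR nu / INR (2 * m + 1).

Definition sigma (m nu : nat) (q : R * R) : R :=
  acos (fst q * cos (phi m nu) + snd q * sin (phi m nu)).

Definition T_kernel (m nu j l : nat) (p : R * R * R) : R :=
  / (INR (2 * m) * INR (2 * m + 1) ^ 2) *
  sum_n_m (fun n : nat =>
    sum_n_m (fun k : nat =>
      INR (k + 1) * sin (INR (k + 1) * theta m j)
      * chebU k (cos (sigma m nu (fst p)))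
      * chebT_tilde (n - k) (znode m l) * chebT_tilde (n - k) (snd p))
      0 n)
    0 (2 * m).

(* The operator B_{2m}; it is meaningful for m >= 1. *)
Definition B2m (m : nat) (f : R * R * R -> R) (p : R * R * R) : R :=
  sum_n_m (fun nu : nat =>
    sum_n_m (fun j : nat =>
      sum_n_m (fun l : nat =>
        radon (phi m nu) (fun q => f (q, znode m l)) (cos (theta m j))
        * T_kernel m nu j l p)
        0 (2 * m - 1))
      1 (2 * m))
    0 (2 * m).

(* Main.v *)
Require Import Defs.
From Stdlib Require Import Reals Lra Lia Psatz Arith ZArith List.
From Stdlib Require Import Classical ClassicalEpsilon.
From Coquelicot Require Import Coquelicot.
(* Imported again because [Reals] shadows [sigma]. *)
Import Defs.
Open Scope R_scope.

(** The operator [B2m m] is linear and reproduces polynomials of total degree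
    less than [2 * m]: by Marr's formula the Radon projections of a ridge
    polynomial [U_d (x cos psi + y sin psi)] are explicit, and the sums over the
    three families of nodes are discrete orthogonality relations.  Ridge
    polynomials span all polynomials in [x] and [y].

    Up to a constant, the norm of [B2m m] is at most [m ^ (3/2) * ln m ^ 2]: in
    the sum of the kernels, Cauchy-Schwarz over [j] costs a factor [sqrt m],
    while over [nu] and [l] the factors [U_k] and the Dirichlet kernels are
    bounded by [min (m, 1 / |sin|)].

    Finally, the distance of [f] to the polynomials of total degree less than
    [2 * m] is [O (1 / m ^ 2)].  A reflection in the boundary of the disk extends
    [f] to a function on the cube with Lipschitz gradient; there, the tensor
    product of three discrete Korovkin operators in [x = cos a], [y = cos b],
    [z = cos c] gives the approximation.  Convergence follows since
    [m ^ (3/2) * ln m ^ 2 = o (m ^ 2)]. *)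

(** * Finite sums *)

(** Everything rests on [B2m f - f = B2m (f - P) + (P - f)] for a reproduced polynomial [P]. The
    exponent 3/2 is a loss accepted on purpose: an error of order [1 / m ^ 2] leaves half a power of
    [m] to absorb both the Cauchy-Schwarz factor and the logarithms, so the sum over [j] requires
    nothing finer than orthogonality of the sines. The obstacle is the rate [1 / m ^ 2] on a disk.
    On the cube each variable becomes an angle and the end points cause no trouble, but [f] must
    first be extended, and second derivatives of the extension may jump across the unit circle.
    Smoothness is therefore carried as quadratic Taylor remainders with bounded slopes, which is all
    that a positive operator with small first and second moments uses. Discrete operators sample the
    extension at finitely many points, so it never has to be integrated. Their degree is bounded in
    each variable separately; asking that three times this degree be below [2 * m] costs only a
    constant. *)

Fixpoint bsum (n : nat) (f : nat -> R) : R :=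
  match n with
  | O => 0
  | S n' => bsum n' f + f n'
  end.

Lemma bsum_ext (n : nat) (f g : nat -> R) :
  (forall i, (i < n)%nat -> f i = g i) -> bsum n f = bsum n g.
Proof.
induction n as [|n IH]; intros H; simpl; [reflexivity|].
rewrite IH, (H n); auto.
Qed.

Lemma bsum_plus (n : nat) (f g : nat -> R) :
  bsum n (fun i => f i + g i) = bsum n f + bsum n g.
Proof. induction n as [|n IH]; simpl; [ring|]. rewrite IH; ring. Qed.

Lemma bsum_scal (n : nat) (c : R) (f : nat -> R) :
  bsum n (fun i => c * f i) = c * bsum n f.
Proof. induction n as [|n IH]; simpl; [ring|]. rewrite IH; ring. Qed.

Lemma bsum_scal_r (n : nat) (c : R) (f : nat -> R) :
  bsum n (fun i => f i * c) = bsum n f * c.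
Proof. induction n as [|n IH]; simpl; [ring|]. rewrite IH; ring. Qed.

Lemma bsum_const (n : nat) (c : R) : bsum n (fun _ => c) = INR n * c.
Proof. induction n as [|n IH]; [simpl; ring|]. rewrite S_INR; simpl; rewrite IH; ring. Qed.

Lemma bsum_zero (n : nat) (f : nat -> R) :
  (forall i, (i < n)%nat -> f i = 0) -> bsum n f = 0.
Proof.
intros H; rewrite (bsum_ext n f (fun _ => 0) H), bsum_const; ring.
Qed.

Lemma bsum_swap (n m : nat) (f : nat -> nat -> R) :
  bsum n (fun i => bsum m (fun j => f i j))
  = bsum m (fun j => bsum n (fun i => f i j)).
Proof.
induction n as [|n IH]; simpl.
- symmetry; apply bsum_zero; reflexivity.
- rewrite IH, <- bsum_plus; reflexivity.
Qed.

Lemma bsum_le (n : nat) (f g : nat -> R) :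
  (forall i, (i < n)%nat -> f i <= g i) -> bsum n f <= bsum n g.
Proof.
induction n as [|n IH]; intros H; simpl; [lra|].
apply Rplus_le_compat; auto.
Qed.

Lemma bsum_ge0 (n : nat) (f : nat -> R) :
  (forall i, (i < n)%nat -> 0 <= f i) -> 0 <= bsum n f.
Proof.
intros H; rewrite <- (bsum_zero n (fun _ => 0)); auto; now apply bsum_le.
Qed.

Lemma bsum_abs (n : nat) (f : nat -> R) :
  Rabs (bsum n f) <= bsum n (fun i => Rabs (f i)).
Proof.
induction n as [|n IH]; simpl.
- rewrite Rabs_R0; lra.
- eapply Rle_trans; [apply Rabs_triang|lra].
Qed.

Lemma bsum_single (n k : nat) (f : nat -> R) : (k < n)%nat ->
  (forall i, (i < n)%nat -> i <> k -> f i = 0) -> bsum n f = f k.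
Proof.
induction n as [|n IH]; intros Hk H; [lia|]; simpl.
destruct (Nat.eq_dec k n) as [->|Hn].
- rewrite bsum_zero; [ring|]. intros i Hi; apply H; lia.
- rewrite IH, (H n); [ring|lia|lia|lia|]. intros i Hi; apply H; lia.
Qed.

Lemma bsum_first (n : nat) (f : nat -> R) :
  bsum (S n) f = f 0%nat + bsum n (fun i => f (S i)).
Proof.
induction n as [|n IH]; [simpl; ring|].
change (bsum (S (S n)) f) with (bsum (S n) f + f (S n)); rewrite IH; simpl; ring.
Qed.

(** Both sides run over the pairs with [k + i < n], on the left along the diagonals [s = k + i].
    This separates the two degrees [k] and [n - k] in [T_kernel]. *)
Lemma bsum_triangle (n : nat) (f : nat -> nat -> R) :
  bsum n (fun s => bsum (S s) (fun k => f k (s - k)%nat))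
  = bsum n (fun k => bsum (n - k) (fun i => f k i)).
Proof.
induction n as [|n IH]; [reflexivity|].
change (bsum n (fun s => bsum (S s) (fun k => f k (s - k)%nat))
  + bsum (S n) (fun k => f k (n - k)%nat)
  = bsum (S n) (fun k => bsum (S n - k) (fun i => f k i))).
rewrite IH.
rewrite (bsum_ext (S n) (fun k => bsum (S n - k) _)
  (fun k => bsum (n - k) (fun i => f k i) + f k (n - k)%nat)).
- rewrite bsum_plus; simpl; rewrite Nat.sub_diag; simpl; ring.
- intros k Hk; replace (S n - k)%nat with (S (n - k)) by lia; reflexivity.
Qed.

Lemma bsum_cauchy_schwarz (n : nat) (f g : nat -> R) :
  bsum n (fun i => f i * g i) ^ 2
  <= bsum n (fun i => f i ^ 2) * bsum n (fun i => g i ^ 2).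
Proof.
induction n as [|n IH]; cbn [bsum]; [lra|].
set (A := bsum n (fun i => f i ^ 2)) in *.
set (B := bsum n (fun i => g i ^ 2)) in *.
set (P := bsum n (fun i => f i * g i)) in *.
assert (HA : 0 <= A) by (apply bsum_ge0; intros; apply pow2_ge_0).
assert (HB : 0 <= B) by (apply bsum_ge0; intros; apply pow2_ge_0).
set (a := f n); set (b := g n).
(* Comparing squares avoids roots: the square of the left side is at most [4 A B (a b) ^ 2] by
   induction, hence at most [(A b ^ 2 + B a ^ 2) ^ 2]. *)
assert (H : 2 * P * (a * b) <= A * b ^ 2 + B * a ^ 2).
{ assert (0 <= A * b ^ 2) by (apply Rmult_le_pos; [exact HA|apply pow2_ge_0]).
  assert (0 <= B * a ^ 2) by (apply Rmult_le_pos; [exact HB|apply pow2_ge_0]).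
  apply Rsqr_incr_0_var; [unfold Rsqr|lra].
  assert (0 <= (A * b ^ 2 - B * a ^ 2) ^ 2) by apply pow2_ge_0.
  assert (P ^ 2 * (a * b) ^ 2 <= A * B * (a * b) ^ 2)
    by (apply Rmult_le_compat_r; [apply pow2_ge_0|exact IH]).
  lra. }
replace ((P + a * b) ^ 2) with (P ^ 2 + 2 * P * (a * b) + (a * b) ^ 2) by ring.
replace ((A + a ^ 2) * (B + b ^ 2)) with (A * B + (A * b ^ 2 + B * a ^ 2) + (a * b) ^ 2)
  by ring.
lra.
Qed.

Lemma sum_n_m_bsum (f : nat -> R) (a n : nat) :
  sum_n_m f a (a + n) = bsum (S n) (fun i => f (a + i)%nat).
Proof.
induction n as [|n IH].
- rewrite Nat.add_0_r, sum_n_n; simpl; rewrite Nat.add_0_r; ring.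
- rewrite Nat.add_succ_r, sum_n_Sm by lia; rewrite IH.
  change (plus ?x ?y) with (x + y).
  cbn [bsum]; rewrite Nat.add_succ_r; reflexivity.
Qed.

(** Each term times [2 sin (x / 2)] is a difference of consecutive values of
    [sin (i x + c - x / 2)]. The factor is not divided out, so the identity survives where it
    vanishes. It yields both the orthogonality relations and the decay of the Dirichlet kernel. *)
Lemma bsum_cos_telescope (n : nat) (x c : R) :
  2 * sin (x / 2) * bsum n (fun i => cos (INR i * x + c))
  = sin (INR n * x + c - x / 2) - sin (c - x / 2).
Proof.
induction n as [|n IH].
- simpl; rewrite Rmult_0_l, Rplus_0_l; ring.
- cbn [bsum]; rewrite Rmult_plus_distr_l, IH, S_INR.
  replace ((INR n + 1) * x + c - x / 2) with ((INR n * x + c) + x / 2) by field.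
  replace (INR n * x + c - x / 2) with ((INR n * x + c) - x / 2) by field.
  rewrite (sin_plus _ (x / 2)), (sin_minus (INR n * x + c)); ring.
Qed.

Lemma INR_2 : INR 2 = 2.
Proof. reflexivity. Qed.

Lemma sin_INR_PI (p : nat) : sin (INR p * PI) = 0.
Proof.
induction p as [|p IH]; [simpl; rewrite Rmult_0_l; apply sin_0|].
rewrite S_INR, Rmult_plus_distr_r, Rmult_1_l, neg_sin, IH; ring.
Qed.

Lemma sin_frac_PI_neq0 (a b n : nat) : a <> b -> (a < b + n)%nat -> (b < a + n)%nat ->
  sin ((INR a - INR b) * PI / INR n) <> 0.
Proof.
assert (Hpos : forall p, (0 < p < n)%nat -> sin (INR p * PI / INR n) <> 0).
{ intros p [Hp Hn].
  assert (0 < INR p) by (apply lt_0_INR; lia).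
  assert (INR p < INR n) by (apply lt_INR; lia).
  assert (HPI := PI_RGT_0).
  apply Rgt_not_eq, sin_gt_0.
  - apply Rdiv_lt_0_compat; nra.
  - apply Rmult_lt_reg_r with (INR n); [lra|].
    unfold Rdiv; rewrite Rmult_assoc, Rinv_l by lra; nra. }
intros Hab Ha Hb; destruct (Nat.lt_ge_cases a b) as [H|H].
- replace ((INR a - INR b) * PI / INR n) with (- (INR (b - a) * PI / INR n))
    by (rewrite minus_INR by lia; unfold Rdiv; ring).
  rewrite sin_neg; apply Ropp_neq_0_compat, Hpos; lia.
- rewrite <- minus_INR by lia; apply Hpos; lia.
Qed.

(** By [sin 2u = 2 sin u cos u] the danger is [cos u = 0], which would make [2 (a - b)] an odd
    multiple of [2 m + 1], that is, an odd number. *)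
Lemma sin_double_frac_PI_neq0 (a b m : nat) :
  a <> b -> (a < b + (2 * m + 1))%nat -> (b < a + (2 * m + 1))%nat ->
  sin ((INR (2 * a) - INR (2 * b)) * PI / INR (2 * m + 1)) <> 0.
Proof.
intros Hab Ha Hb.
set (n := (2 * m + 1)%nat) in *.
assert (Hn : INR n <> 0) by (apply not_0_INR; lia).
replace ((INR (2 * a) - INR (2 * b)) * PI / INR n)
  with (2 * ((INR a - INR b) * PI / INR n))
  by (rewrite !mult_INR; rewrite ?INR_2; field; auto).
rewrite sin_2a; apply Rmult_integral_contrapositive_currified.
- apply Rmult_integral_contrapositive_currified; [lra|].
  now apply sin_frac_PI_neq0.
- assert (Hcos : forall c d, (d < c)%nat -> (c < d + n)%nat ->
    cos ((INR c - INR d) * PI / INR n) <> 0).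
  (* The cosine becomes a sine whose two indices have opposite parity, hence differ. *)
  { intros c d Hdc Hc; rewrite <- sin_shift.
    replace (PI / 2 - (INR c - INR d) * PI / INR n)
      with ((INR (n + 2 * d) - INR (2 * c)) * PI / INR (2 * n))
      by (rewrite plus_INR, !mult_INR, INR_2; field; auto).
    apply sin_frac_PI_neq0; lia. }
  destruct (Nat.lt_ge_cases b a) as [H|H]; [now apply Hcos|].
  rewrite <- cos_neg.
  replace (- ((INR a - INR b) * PI / INR n)) with ((INR b - INR a) * PI / INR n)
    by (field; auto).
  apply Hcos; lia.
Qed.

Lemma sin_plus_INR_PI (x : R) (a b : nat) :
  sin (x + 2 * (INR a - INR b) * PI) = sin x.
Proof.
rewrite <- (sin_period (x + _) b).
replace (x + 2 * (INR a - INR b) * PI + 2 * INR b * PI) with (x + 2 * INR a * PI) by ring.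
apply sin_period.
Qed.

(** The frequency is an integer, written as a difference of naturals: after telescoping the two ends
    differ by a multiple of [2 PI] and cancel. *)
Lemma bsum_cos_nodes (n a b : nat) (c : R) : (0 < n)%nat ->
  sin ((INR a - INR b) * PI / INR n) <> 0 ->
  bsum n (fun i => cos ((INR a - INR b) * (2 * PI * INR i / INR n) + c)) = 0.
Proof.
intros Hn0 Hs.
assert (Hn : INR n <> 0) by (apply not_0_INR; lia).
set (x := (INR a - INR b) * (2 * PI) / INR n).
replace ((INR a - INR b) * PI / INR n) with (x / 2) in Hs by (unfold x; field; auto).
apply Rmult_eq_reg_l with (2 * sin (x / 2)); [|intros E; apply Hs; lra].
rewrite Rmult_0_r.
rewrite (bsum_ext _ _ (fun i => cos (INR i * x + c)))
  by (intros; f_equal; unfold x; field; auto).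
rewrite bsum_cos_telescope.
replace (INR n * x + c - x / 2) with (c - x / 2 + 2 * (INR a - INR b) * PI)
  by (unfold x; field; auto).
rewrite sin_plus_INR_PI; ring.
Qed.

Lemma Rabs_mult_le_compat (a b c d : R) : Rabs a <= c -> Rabs b <= d ->
  Rabs (a * b) <= c * d.
Proof.
intros; rewrite Rabs_mult; apply Rmult_le_compat; auto using Rabs_pos.
Qed.

(** * Chebyshev polynomials and Marr's formula *)

Lemma chebU_SS (k : nat) (x : R) :
  chebU (S (S k)) x = 2 * x * chebU (S k) x - chebU k x.
Proof. reflexivity. Qed.

Lemma chebT_SS (k : nat) (x : R) :
  chebT (S (S k)) x = 2 * x * chebT (S k) x - chebT k x.
Proof. reflexivity. Qed.

Lemma two_step_ind (P : nat -> Prop) : P 0%nat -> P 1%nat ->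
  (forall k, P k -> P (S k) -> P (S (S k))) -> forall k, P k.
Proof.
intros H0 H1 HS k; enough (P k /\ P (S k)) by tauto.
induction k as [|k [IH1 IH2]]; auto.
Qed.

Lemma cos_mult_cos (a b : R) : cos a * cos b = (cos (a + b) + cos (a - b)) / 2.
Proof. rewrite cos_plus, cos_minus; field. Qed.

(** The geometric sum behind [sin ((k + 1) b) / sin b], without the quotient. All frequencies have
    the parity of [k], the property on which reproduction in the angle depends. *)
Lemma chebU_sum (k : nat) (b : R) :
  chebU k (cos b) = bsum (S k) (fun j => cos ((INR k - 2 * INR j) * b)).
Proof.
induction k as [| |k IH1 IH2] using two_step_ind.
- simpl. replace ((0 - 2 * 0) * b) with 0 by ring; rewrite cos_0; ring.
- simpl. replace ((1 - 2 * 0) * b) with b by ring.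
  replace ((1 - 2 * 1) * b) with (- b) by ring; rewrite cos_neg; ring.
- rewrite chebU_SS, IH1, IH2.
  rewrite (bsum_ext (S (S (S k))) _
    (fun j => cos ((INR k + 2 - 2 * INR j) * b)))
    by (intros; rewrite !S_INR; do 2 f_equal; ring).
  assert (E : 2 * cos b * bsum (S (S k)) (fun j => cos ((INR (S k) - 2 * INR j) * b))
    = bsum (S (S k)) (fun j => cos ((INR k + 2 - 2 * INR j) * b))
      + bsum (S (S k)) (fun j => cos ((INR k - 2 * INR j) * b))).
  { rewrite <- bsum_scal, <- bsum_plus; apply bsum_ext; intros j _.
    rewrite Rmult_assoc, cos_mult_cos, S_INR, <- (cos_neg (b - _)).
    replace (b + (INR k + 1 - 2 * INR j) * b) with ((INR k + 2 - 2 * INR j) * b) by ring.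
    replace (- (b - (INR k + 1 - 2 * INR j) * b)) with ((INR k - 2 * INR j) * b) by ring.
    field. }
  rewrite E; cbn [bsum]; rewrite !S_INR.
  rewrite <- (cos_neg ((INR k - 2 * (INR k + 1)) * b)).
  replace (- ((INR k - 2 * (INR k + 1)) * b))
    with (- ((INR k + 2 - 2 * (INR k + 1 + 1)) * b)) by ring.
  rewrite cos_neg; ring.
Qed.

Lemma cos_acos_interval (x : R) : -1 <= x <= 1 -> exists a, 0 <= a <= PI /\ x = cos a.
Proof.
intros Hx; exists (acos x); split; [apply acos_bound|now rewrite cos_acos].
Qed.

Lemma Rabs_cos_le1 (a : R) : Rabs (cos a) <= 1.
Proof. apply Rabs_le, COS_bound. Qed.

Lemma chebU_bound (k : nat) (b : R) : Rabs (chebU k (cos b)) <= INR (S k).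
Proof.
rewrite chebU_sum.
eapply Rle_trans; [apply bsum_abs|].
eapply Rle_trans; [apply (bsum_le _ _ (fun _ => 1)); intros; apply Rabs_cos_le1|].
rewrite bsum_const; lra.
Qed.

Lemma chebU_one (k : nat) : chebU k 1 = INR k + 1.
Proof.
assert (H := chebU_sum k 0); rewrite cos_0 in H; rewrite H.
rewrite (bsum_ext _ _ (fun _ => 1)).
- rewrite bsum_const, S_INR; ring.
- intros; rewrite Rmult_0_r; apply cos_0.
Qed.

Lemma chebU_sign (e : R) (k : nat) (x : R) : e ^ 2 = 1 ->
  chebU k (e * x) = e ^ k * chebU k x.
Proof.
intros He; induction k as [| |k IH1 IH2] using two_step_ind; [simpl; ring|simpl; ring|].
rewrite !chebU_SS, IH1, IH2.
replace (e ^ S (S k)) with (e ^ k * e ^ 2) by (simpl; ring).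
transitivity (2 * e * x * (e * e ^ k * chebU (S k) x) - e ^ k * chebU k x);
  [rewrite <- tech_pow_Rmult; ring|].
replace (2 * e * x * (e * e ^ k * chebU (S k) x))
  with (2 * x * (e ^ 2 * e ^ k * chebU (S k) x)) by ring.
rewrite He; ring.
Qed.

(** This closes the induction for the derivative of [chebT], where the product rule leaves a bare
    [chebT] term. *)
Lemma chebT_chebU (k : nat) (x : R) :
  chebT (S k) x = chebU (S k) x - x * chebU k x.
Proof.
induction k as [| |k IH1 IH2] using two_step_ind; [simpl; ring|simpl; ring|].
rewrite chebT_SS, IH1, IH2, !chebU_SS; ring.
Qed.

Lemma is_derive_chebT (k : nat) (x : R) :
  is_derive (chebT (S k)) x (INR (S k) * chebU k x).
Proof.
induction k as [| |k IH1 IH2] using two_step_ind.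
- simpl. rewrite Rmult_1_l; apply (is_derive_id (K := R_AbsRing)).
- apply (is_derive_ext (fun x => 2 * x * x - 1)); [intros; simpl; ring|].
  auto_derive; [exact I|simpl; ring].
- apply (is_derive_ext (fun x => 2 * x * chebT (S (S k)) x - chebT (S k) x));
    [reflexivity|].
  assert (H : is_derive (fun x => 2 * x * chebT (S (S k)) x - chebT (S k) x) x
    ((2 * chebT (S (S k)) x + 2 * x * (INR (S (S k)) * chebU (S k) x))
      - INR (S k) * chebU k x)).
  { apply (is_derive_minus (V := R_NormedModule)
      (fun x => 2 * x * chebT (S (S k)) x) (chebT (S k))); [|exact IH1].
    apply (is_derive_mult (fun x => 2 * x)); [|exact IH2|intros; apply Rmult_comm].
    auto_derive; [exact I|ring]. }
  replace (INR (S (S (S k))) * chebU (S (S k)) x) with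
    ((2 * chebT (S (S k)) x + 2 * x * (INR (S (S k)) * chebU (S k) x))
      - INR (S k) * chebU k x); [exact H|].
  rewrite chebT_chebU, chebU_SS, !S_INR; ring.
Qed.

Lemma continuous_chebU (k : nat) (x : R) : continuous (chebU k) x.
Proof.
induction k as [| |k IH1 IH2] using two_step_ind.
- apply continuous_const.
- apply (continuous_mult (fun _ => 2) (fun x => x)); [apply continuous_const|apply continuous_id].
- apply (continuous_minus (V := R_NormedModule)
    (fun x => 2 * x * chebU (S k) x) (chebU k)); [|exact IH1].
  apply (continuous_mult (fun x => 2 * x)); [|exact IH2].
  apply (continuous_mult (fun _ => 2) (fun x => x)); [apply continuous_const|apply continuous_id].
Qed.

Definition chord (phi t s : R) : R * R :=
  (t * cos phi + s * sin phi, t * sin phi - s * cos phi).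

Definition ridge (psi : R) (q : R * R) : R := fst q * cos psi + snd q * sin psi.

Lemma ridge_chord (psi phi t s : R) :
  ridge psi (chord phi t s) = t * cos (phi - psi) + s * sin (phi - psi).
Proof. unfold ridge, chord; simpl; rewrite cos_minus, sin_minus; ring. Qed.

Lemma sqrt_1_cos2 (a : R) : 0 <= a <= PI -> sqrt (1 - cos a ^ 2) = sin a.
Proof.
intros Ha; assert (H := sin2_cos2 a); unfold Rsqr in H.
replace (1 - cos a ^ 2) with (sin a * sin a) by (simpl; lra).
apply sqrt_square, sin_ge_0; tauto.
Qed.

(* Marr's formula.  The primitive of [U_d] is [T_{d+1} / (d+1)], and
   the end points of the chord are sent by the linear form to [cos (a -+ b)],
   where [b = phi - psi]. *)
Lemma radon_ridge (d : nat) (psi phi a : R) : 0 <= a <= PI ->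
  is_RInt (fun s => chebU d (ridge psi (chord phi (cos a) s)))
    (- sqrt (1 - cos a ^ 2)) (sqrt (1 - cos a ^ 2))
    (2 / INR (S d) * sin (INR (S d) * a) * chebU d (cos (phi - psi))).
Proof.
intros Ha; rewrite sqrt_1_cos2 by exact Ha.
set (b := phi - psi).
assert (Hd : INR (S d) <> 0) by (apply not_0_INR; lia).
assert (Hu : forall x, sin (INR (S d) * x) = chebU d (cos x) * sin x).
{ intros x; rewrite chebU_cos, Nat.add_1_r; reflexivity. }
apply (is_RInt_ext (fun s => chebU d (cos a * cos b + s * sin b))).
{ intros s _; rewrite ridge_chord; reflexivity. }
(* The primitive divides by [sin b]. When [sin b = 0] the linear form is constant on the chord, and
   [cos b] is 1 or -1, so the parity of [chebU d] settles the case. *)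
destruct (Req_dec (sin b) 0) as [Hb|Hb].
- assert (He : cos b ^ 2 = 1)
    by (assert (H := sin2_cos2 b); unfold Rsqr in H; rewrite Hb in H; simpl; lra).
  apply (is_RInt_ext (fun s => cos b ^ d * chebU d (cos a))).
  { intros s _; rewrite Hb, Rmult_0_r, Rplus_0_r, (Rmult_comm (cos a)).
    symmetry; now apply chebU_sign. }
  replace (2 / INR (S d) * sin (INR (S d) * a) * chebU d (cos b))
    with (@scal R_Ring R_NormedModule (sin a - - sin a) (cos b ^ d * chebU d (cos a)));
    [apply (is_RInt_const (V := R_NormedModule))|].
  replace (chebU d (cos b)) with (cos b ^ d * (INR d + 1)).
  + rewrite Hu; change (@scal R_Ring R_NormedModule ?x ?y) with (Rmult x y).
    rewrite S_INR in *; match goal with |- ?x = ?y => change (@eq R x y) end.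
    field; auto.
  + rewrite <- (chebU_one d), <- chebU_sign by exact He; f_equal; ring.
- set (F := fun s =>
    / (INR (S d) * sin b) * chebT (S d) (cos a * cos b + s * sin b)).
  replace (2 / INR (S d) * sin (INR (S d) * a) * chebU d (cos b))
    with (@minus R_NormedModule (F (sin a)) (F (- sin a))).
  + apply (is_RInt_derive (V := R_CompleteNormedModule)).
    * intros s _; unfold F.
      replace (chebU d (cos a * cos b + s * sin b)) with
        (/ (INR (S d) * sin b)
          * (sin b * (INR (S d) * chebU d (cos a * cos b + s * sin b))))
        by (field; auto).
      apply (is_derive_scal (fun s => chebT (S d) (cos a * cos b + s * sin b))).
      apply (is_derive_comp (chebT (S d)) (fun s => cos a * cos b + s * sin b));
        [apply is_derive_chebT|].
      auto_derive; [exact I|ring].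
    * intros s _; apply (continuous_comp (fun s => cos a * cos b + s * sin b) (chebU d)).
      -- apply (ex_derive_continuous (fun s => cos a * cos b + s * sin b)).
         auto_derive; exact I.
      -- apply continuous_chebU.
  + unfold F; change (@minus R_NormedModule ?x ?y) with (Rminus x y).
    replace (cos a * cos b + sin a * sin b) with (cos (a - b)) by apply cos_minus.
    replace (cos a * cos b + - sin a * sin b) with (cos (a + b))
      by (rewrite cos_plus; ring).
    rewrite !chebT_cos, Rmult_minus_distr_l, Rmult_plus_distr_l, cos_plus, cos_minus.
    rewrite (Hu b); match goal with |- ?x = ?y => change (@eq R x y) end.
    field; auto.
Qed.

(** * Discrete orthogonality *)

(** Trigonometric polynomials of degree at most [d] whose frequencies have the parity of [d]; the
    phase [c] covers the sines. The last constructor stands in for functional extensionality. *)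
Inductive parity_trig (d : nat) : (R -> R) -> Prop :=
| parity_trig_cos (k : nat) (c : R) : (k <= d)%nat ->
    parity_trig d (fun t => cos ((INR d - 2 * INR k) * t + c))
| parity_trig_lin (a b : R) (g h : R -> R) : parity_trig d g -> parity_trig d h ->
    parity_trig d (fun t => a * g t + b * h t)
| parity_trig_ext (g h : R -> R) : (forall t, g t = h t) -> parity_trig d g ->
    parity_trig d h.

Lemma parity_trig_SS (d : nat) (h : R -> R) :
  parity_trig d h -> parity_trig (S (S d)) h.
Proof.
induction 1 as [k c Hk|a b g h _ IH1 _ IH2|g h E _ IH].
- apply (parity_trig_ext _ (fun t => cos ((INR (S (S d)) - 2 * INR (S k)) * t + c))).
  + intros t; rewrite !S_INR; do 2 f_equal; ring.
  + apply parity_trig_cos; lia.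
- now apply parity_trig_lin.
- now apply (parity_trig_ext _ g).
Qed.

Lemma parity_trig_mult_cos (d : nat) (c : R) (h : R -> R) :
  parity_trig d h -> parity_trig (S d) (fun t => cos (t + c) * h t).
Proof.
induction 1 as [k e Hk|a b g h _ IH1 _ IH2|g h E _ IH].
- apply (parity_trig_ext _ (fun t =>
    / 2 * cos ((INR (S d) - 2 * INR k) * t + (c + e))
    + / 2 * cos ((INR (S d) - 2 * INR (S k)) * t + (e - c)))).
  + intros t; rewrite cos_mult_cos, !S_INR.
    rewrite <- (cos_neg (t + c - _)).
    replace ((INR d + 1 - 2 * INR k) * t + (c + e))
      with (t + c + ((INR d - 2 * INR k) * t + e)) by ring.
    replace ((INR d + 1 - 2 * (INR k + 1)) * t + (e - c))
      with (- (t + c - ((INR d - 2 * INR k) * t + e))) by ring.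
    field.
  + apply parity_trig_lin; apply parity_trig_cos; lia.
- apply (parity_trig_ext _ (fun t =>
    a * (cos (t + c) * g t) + b * (cos (t + c) * h t))); [intros; ring|].
  now apply parity_trig_lin.
- apply (parity_trig_ext _ (fun t => cos (t + c) * g t)); [|exact IH].
  intros t; now rewrite E.
Qed.

Lemma parity_trig_mult_ridge (d : nat) (q : R * R) (h : R -> R) :
  parity_trig d h -> parity_trig (S d) (fun t => ridge t q * h t).
Proof.
intros H.
apply (parity_trig_ext _ (fun t =>
  fst q * (cos (t + 0) * h t) + snd q * (cos (t + - (PI / 2)) * h t))).
- intros t; unfold ridge.
  rewrite Rplus_0_r, cos_plus, cos_neg, sin_neg, cos_PI2, sin_PI2; ring.
- apply parity_trig_lin; now apply parity_trig_mult_cos.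
Qed.

Lemma parity_trig_chebU (d : nat) (q : R * R) :
  parity_trig d (fun t => chebU d (ridge t q)).
Proof.
assert (H0 : parity_trig 0 (fun _ => 1)).
{ apply (parity_trig_ext _ (fun t => cos ((INR 0 - 2 * INR 0) * t + 0))).
  - intros t; simpl; rewrite <- cos_0; f_equal; ring.
  - apply parity_trig_cos; lia. }
induction d as [| |d IH1 IH2] using two_step_ind.
- exact H0.
- apply (parity_trig_ext _ (fun t => 2 * (ridge t q * 1) + 0 * (ridge t q * 1))).
  + intros; simpl; ring.
  + apply parity_trig_lin; now apply parity_trig_mult_ridge.
- apply (parity_trig_ext _ (fun t =>
    2 * (ridge t q * chebU (S d) (ridge t q)) + (-1) * chebU d (ridge t q))).
  + intros; rewrite chebU_SS; ring.
  + apply parity_trig_lin; [now apply parity_trig_mult_ridge|now apply parity_trig_SS].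
Qed.

(* [U_d (cos t)] is the Dirichlet kernel of [parity_trig d]; there is no
   aliasing at the nodes because [2 m + 1] is odd. *)
Lemma chebU_reproducing (m d : nat) (psi : R) (h : R -> R) : (d < 2 * m + 1)%nat ->
  parity_trig d h ->
  bsum (2 * m + 1) (fun nu => chebU d (cos (phi m nu - psi)) * h (phi m nu))
  = INR (2 * m + 1) * h psi.
Proof.
intros Hd; induction 1 as [k c Hk|a b g h _ IH1 _ IH2|g h E _ IH].
- set (n := (2 * m + 1)%nat) in *.
  (* The product formula splits each term into two even frequencies. In the first family only
     [j = d - k] has frequency zero, in the second only [j = k]; each contributes half of the
     value. *)
  rewrite (bsum_ext _ _ (fun nu => bsum (S d) (fun j =>
    / 2 * cos ((INR (2 * (d - j)) - INR (2 * k)) * phi m nu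
                 + (c - (INR d - 2 * INR j) * psi))
    + / 2 * cos ((INR (2 * k) - INR (2 * j)) * phi m nu
                 + (- c - (INR d - 2 * INR j) * psi))))).
  2:{ intros nu _; rewrite chebU_sum, <- bsum_scal_r; apply bsum_ext; intros j Hj.
      rewrite cos_mult_cos, !mult_INR, minus_INR by lia; rewrite ?INR_2.
      replace ((2 * (INR d - INR j) - 2 * INR k) * phi m nu + (c - (INR d - 2 * INR j) * psi))
        with ((INR d - 2 * INR j) * (phi m nu - psi) + ((INR d - 2 * INR k) * phi m nu + c))
        by ring.
      replace ((2 * INR k - 2 * INR j) * phi m nu + (- c - (INR d - 2 * INR j) * psi))
        with ((INR d - 2 * INR j) * (phi m nu - psi) - ((INR d - 2 * INR k) * phi m nu + c))
        by ring.
      field. }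
  rewrite bsum_swap.
  rewrite (bsum_ext _ _ (fun j => / 2 * bsum n (fun nu =>
      cos ((INR (2 * (d - j)) - INR (2 * k)) * phi m nu + (c - (INR d - 2 * INR j) * psi)))
    + / 2 * bsum n (fun nu => cos ((INR (2 * k) - INR (2 * j)) * phi m nu
                 + (- c - (INR d - 2 * INR j) * psi)))))
    by (intros; rewrite bsum_plus, !bsum_scal; reflexivity).
  rewrite bsum_plus, (bsum_single (S d) (d - k)), (bsum_single (S d) k).
  + assert (Ek : INR (2 * (d - (d - k))) = INR (2 * k)) by (f_equal; lia).
    rewrite Ek.
    rewrite (bsum_ext n _ (fun _ => cos ((INR d - 2 * INR k) * psi + c))).
    2:{ intros nu _; rewrite minus_INR by lia; f_equal; ring. }
    rewrite (bsum_ext n (fun nu => cos ((INR (2 * k) - INR (2 * k)) * _ + _))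
      (fun _ => cos ((INR d - 2 * INR k) * psi + c))).
    2:{ intros nu _; rewrite <- cos_neg; f_equal; ring. }
    rewrite !bsum_const; field.
  + lia.
  + intros j Hj Hjk; rewrite (bsum_cos_nodes n (2 * k) (2 * j)); [ring|lia|].
    apply sin_double_frac_PI_neq0; lia.
  + lia.
  + intros j Hj Hjk; rewrite (bsum_cos_nodes n (2 * (d - j)) (2 * k)); [ring|lia|].
    apply sin_double_frac_PI_neq0; lia.
- rewrite (bsum_ext _ _ (fun nu => a * (chebU d (cos (phi m nu - psi)) * g (phi m nu))
    + b * (chebU d (cos (phi m nu - psi)) * h (phi m nu)))) by (intros; ring).
  rewrite bsum_plus, !bsum_scal, IH1, IH2; ring.
- rewrite <- E, <- IH; apply bsum_ext; intros; now rewrite E.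
Qed.

Lemma bsum_cos_half_period (n p : nat) : (0 < p < 2 * n)%nat ->
  bsum n (fun j => cos (INR p * (INR j * PI / INR n))) = (1 - (-1) ^ p) / 2.
Proof.
intros Hp.
assert (Hn : INR n <> 0) by (apply not_0_INR; lia).
set (x := INR p * PI / INR n).
assert (Hs : sin (x / 2) <> 0).
{ assert (H := sin_frac_PI_neq0 p 0 (2 * n)); simpl (INR 0) in H.
  rewrite Rminus_0_r, mult_INR in H; rewrite INR_2 in H.
  replace (x / 2) with (INR p * PI / (2 * INR n)) by (unfold x; field; auto).
  apply H; lia. }
apply Rmult_eq_reg_l with (2 * sin (x / 2)); [|intros E; apply Hs; lra].
rewrite (bsum_ext _ _ (fun i => cos (INR i * x + 0)))
  by (intros; f_equal; unfold x; field; auto).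
rewrite bsum_cos_telescope.
replace (INR n * x + 0 - x / 2) with (INR p * PI - x / 2) by (unfold x; field; auto).
assert (Hc : cos (INR p * PI) = (-1) ^ p).
{ clear; induction p as [|p IH]; [simpl; rewrite Rmult_0_l; apply cos_0|].
  rewrite S_INR, Rmult_plus_distr_r, Rmult_1_l, neg_cos, IH; simpl; ring. }
rewrite sin_minus, sin_INR_PI, Hc, Rminus_0_l, sin_neg; field.
Qed.

(** The product formula gives the frequencies [a - b] and [a + b], of equal parity. Half-period sums
    of cosines depend only on that parity, so they cancel, except when [a - b = 0]. *)
Lemma sin_orthogonality (n a b : nat) : (0 < a < n)%nat -> (0 < b < n)%nat ->
  bsum n (fun j => sin (INR a * (INR j * PI / INR n)) * sin (INR b * (INR j * PI / INR n)))
  = if Nat.eq_dec a b then INR n / 2 else 0.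
Proof.
assert (Hw : forall a b, (0 < a < n)%nat -> (0 < b <= a)%nat ->
  bsum n (fun j => sin (INR a * (INR j * PI / INR n)) * sin (INR b * (INR j * PI / INR n)))
  = if Nat.eq_dec a b then INR n / 2 else 0).
{ clear a b; intros a b Ha Hb.
  rewrite (bsum_ext _ _ (fun j => / 2 * cos (INR (a - b) * (INR j * PI / INR n))
    + (- / 2) * cos (INR (a + b) * (INR j * PI / INR n)))).
  2:{ intros j _; rewrite minus_INR, plus_INR by lia.
      rewrite Rmult_plus_distr_r, Rmult_minus_distr_r, cos_plus, cos_minus; field. }
  rewrite bsum_plus, !bsum_scal, (bsum_cos_half_period n (a + b)) by lia.
  destruct (Nat.eq_dec a b) as [->|Hab].
  - rewrite Nat.sub_diag, (bsum_ext _ _ (fun _ => 1)), bsum_const.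
    + replace (b + b)%nat with (2 * b)%nat by lia.
      rewrite pow_1_even; field.
    + intros; simpl; rewrite Rmult_0_l; apply cos_0.
  - rewrite bsum_cos_half_period by lia.
    replace (a + b)%nat with ((a - b) + 2 * b)%nat by lia.
    rewrite pow_add, pow_1_even; field. }
intros Ha Hb; destruct (Nat.le_ge_cases b a) as [H|H]; [apply Hw; lia|].
rewrite (bsum_ext _ _ (fun j =>
  sin (INR b * (INR j * PI / INR n)) * sin (INR a * (INR j * PI / INR n))))
  by (intros; ring).
rewrite Hw by lia.
destruct (Nat.eq_dec a b), (Nat.eq_dec b a); congruence.
Qed.

(** At midpoints the telescoped ends are [sin (p PI)] and [sin 0], so odd frequencies vanish too, in
    contrast to [bsum_cos_half_period]. *)
Lemma bsum_cos_midpoints (n p : nat) : (0 < p < 2 * n)%nat ->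
  bsum n (fun l => cos (INR p * (INR (2 * l + 1) / INR (2 * n) * PI))) = 0.
Proof.
intros Hp.
assert (Hn : INR n <> 0) by (apply not_0_INR; lia).
set (x := INR p * PI / INR n).
assert (Hs : sin (x / 2) <> 0).
{ assert (H := sin_frac_PI_neq0 p 0 (2 * n)); simpl (INR 0) in H.
  rewrite Rminus_0_r, mult_INR in H; rewrite INR_2 in H.
  replace (x / 2) with (INR p * PI / (2 * INR n)) by (unfold x; field; auto).
  apply H; lia. }
apply Rmult_eq_reg_l with (2 * sin (x / 2)); [|intros E; apply Hs; lra].
rewrite (bsum_ext _ _ (fun i => cos (INR i * x + x / 2))).
2:{ intros; rewrite plus_INR, !mult_INR; rewrite ?INR_2; simpl (INR 1).
    f_equal; unfold x; field; auto. }
rewrite bsum_cos_telescope.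
replace (INR n * x + x / 2 - x / 2) with (INR p * PI) by (unfold x; field; auto).
rewrite sin_INR_PI; replace (x / 2 - x / 2) with 0 by ring; rewrite sin_0; ring.
Qed.

(** Only the frequencies [c + i] and [c - i] occur, and the two degree conditions keep [c + i] below
    [4 m], the first aliasing frequency. Thus [i] may reach [2 m], the top degree in [T_kernel]. *)
Lemma chebT_orthogonality (m c i : nat) (z : R) : (c < 2 * m)%nat -> (i <= 2 * m)%nat ->
  bsum (2 * m) (fun l =>
    chebT c (znode m l) * chebT_tilde i (znode m l) * chebT_tilde i z)
  = if Nat.eq_dec c i then INR (2 * m) * chebT c z else 0.
Proof.
intros Hc Hi; set (n := (2 * m)%nat) in *.
assert (Hg : forall p, (0 < p < 2 * n)%nat ->
  bsum n (fun l => cos (INR p * gamma m l)) = 0).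
{ intros p Hp; rewrite <- (bsum_cos_midpoints n p Hp); apply bsum_ext; intros l _.
  unfold gamma; replace (4 * m)%nat with (2 * n)%nat by lia; reflexivity. }
destruct i as [|i].
- rewrite (bsum_ext _ _ (fun l => cos (INR c * gamma m l))).
  2:{ intros l _; unfold znode, chebT_tilde; rewrite chebT_cos; ring. }
  destruct (Nat.eq_dec c 0) as [->|Hc0]; [|apply Hg; lia].
  rewrite (bsum_ext _ _ (fun _ => 1)), bsum_const; [simpl; ring|].
  intros; simpl; rewrite Rmult_0_l; apply cos_0.
- set (k := S i) in *.
  assert (E : forall l, chebT c (znode m l) * chebT_tilde k (znode m l) * chebT_tilde k z
    = (cos (INR (c + k) * gamma m l) + cos ((INR c - INR k) * gamma m l)) * chebT k z).
  { intros l; unfold k, chebT_tilde; fold k; unfold znode; rewrite !chebT_cos.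
    assert (H2 := sqrt_sqrt 2 ltac:(lra)).
    transitivity (sqrt 2 * sqrt 2 * (cos (INR c * gamma m l) * cos (INR k * gamma m l))
      * chebT k z); [ring|].
    rewrite H2, cos_mult_cos, plus_INR.
    replace ((INR c + INR k) * gamma m l) with (INR c * gamma m l + INR k * gamma m l) by ring.
    replace ((INR c - INR k) * gamma m l) with (INR c * gamma m l - INR k * gamma m l) by ring.
    field. }
  rewrite (bsum_ext _ _ _ (fun l _ => E l)), bsum_scal_r, bsum_plus, Hg by lia.
  destruct (Nat.eq_dec c k) as [->|Hck].
  + rewrite (bsum_ext _ _ (fun _ => 1)), bsum_const; [ring|].
    intros; rewrite <- cos_0; f_equal; ring.
  + rewrite (bsum_ext _ _ (fun l => cos (INR (max c k - min c k) * gamma m l))).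
    * rewrite Hg by lia; ring.
    * intros l _; destruct (Nat.le_ge_cases c k) as [H|H].
      -- rewrite Nat.max_r, Nat.min_l, minus_INR by lia.
         rewrite <- cos_neg; f_equal; ring.
      -- rewrite Nat.max_l, Nat.min_r, minus_INR by lia; reflexivity.
Qed.

(** * Reproduction of polynomials *)

Lemma T_kernel_bsum (m nu j l : nat) (p : R * R * R) :
  T_kernel m nu j l p =
  / (INR (2 * m) * INR (2 * m + 1) ^ 2) *
  bsum (2 * m + 1) (fun k => bsum (2 * m + 1 - k) (fun i =>
    INR (k + 1) * sin (INR (k + 1) * theta m j) * chebU k (cos (sigma m nu (fst p)))
    * chebT_tilde i (znode m l) * chebT_tilde i (snd p))).
Proof.
unfold T_kernel; f_equal.
rewrite (sum_n_m_bsum _ 0 (2 * m)), <- bsum_triangle.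
replace (2 * m + 1)%nat with (S (2 * m)) by lia.
apply bsum_ext; intros n _.
rewrite (sum_n_m_bsum _ 0 (0 + n)); reflexivity.
Qed.

Lemma B2m_bsum (m : nat) (f : R * R * R -> R) (p : R * R * R) : (1 <= m)%nat ->
  B2m m f p = bsum (2 * m + 1) (fun nu => bsum (2 * m) (fun j => bsum (2 * m) (fun l =>
    radon (phi m nu) (fun q => f (q, znode m l)) (cos (theta m (S j)))
    * T_kernel m nu (S j) l p))).
Proof.
intros Hm; unfold B2m.
rewrite (sum_n_m_bsum _ 0 (2 * m)).
replace (2 * m + 1)%nat with (S (2 * m)) by lia.
apply bsum_ext; intros nu _; simpl (0 + nu)%nat.
replace (sum_n_m _ 1 (2 * m)) with (sum_n_m (fun j => sum_n_m (fun l =>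
   radon (phi m nu) (fun q => f (q, znode m l)) (cos (theta m j)) * T_kernel m nu j l p)
   0 (2 * m - 1)) 1 (1 + (2 * m - 1))) by (f_equal; lia).
rewrite sum_n_m_bsum.
replace (S (2 * m - 1)) with (2 * m)%nat by lia.
apply bsum_ext; intros j _.
rewrite (sum_n_m_bsum _ 0 (2 * m - 1)).
replace (S (2 * m - 1)) with (2 * m)%nat by lia.
reflexivity.
Qed.

(** Linearity of [RInt] is available for integrable functions, so integrability accompanies every
    linear combination. It is asked on chords of the cylinder only, since nothing is known about [f]
    elsewhere. *)
Definition chord_integrable (f : R * R * R -> R) : Prop :=
  forall phi t z, -1 <= t <= 1 -> -1 <= z <= 1 ->
  ex_RInt (fun s => f (chord phi t s, z)) (- sqrt (1 - t ^ 2)) (sqrt (1 - t ^ 2)).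

Lemma chord_integrable_lin (a b : R) (f g : R * R * R -> R) :
  chord_integrable f -> chord_integrable g ->
  chord_integrable (fun p => a * f p + b * g p).
Proof.
intros Hf Hg phi t z Ht Hz.
apply (ex_RInt_plus (V := R_NormedModule) (fun s => a * f (chord phi t s, z))
  (fun s => b * g (chord phi t s, z)));
  apply (ex_RInt_scal (V := R_NormedModule)); auto.
Qed.

Lemma radon_lin (phi t z a b : R) (f g : R * R * R -> R) :
  chord_integrable f -> chord_integrable g -> -1 <= t <= 1 -> -1 <= z <= 1 ->
  radon phi (fun q => a * f (q, z) + b * g (q, z)) t
  = a * radon phi (fun q => f (q, z)) t + b * radon phi (fun q => g (q, z)) t.
Proof.
intros Hf Hg Ht Hz; unfold radon.
specialize (Hf phi t z Ht Hz); specialize (Hg phi t z Ht Hz); unfold chord in Hf, Hg.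
rewrite (RInt_plus (V := R_CompleteNormedModule)
  (fun s => a * f (t * cos phi + s * sin phi, t * sin phi - s * cos phi, z))).
- rewrite (RInt_scal (V := R_CompleteNormedModule)
    (fun s => f (t * cos phi + s * sin phi, t * sin phi - s * cos phi, z))) by assumption.
  rewrite (RInt_scal (V := R_CompleteNormedModule)
    (fun s => g (t * cos phi + s * sin phi, t * sin phi - s * cos phi, z))) by assumption.
  reflexivity.
- apply (ex_RInt_scal (V := R_NormedModule)
    (fun s => f (t * cos phi + s * sin phi, t * sin phi - s * cos phi, z))); assumption.
- apply (ex_RInt_scal (V := R_NormedModule)
    (fun s => g (t * cos phi + s * sin phi, t * sin phi - s * cos phi, z))); assumption.
Qed.

Lemma B2m_lin (m : nat) (a b : R) (f g : R * R * R -> R) (p : R * R * R) :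
  (1 <= m)%nat -> chord_integrable f -> chord_integrable g ->
  B2m m (fun p => a * f p + b * g p) p = a * B2m m f p + b * B2m m g p.
Proof.
intros Hm Hf Hg; rewrite !B2m_bsum by exact Hm.
rewrite <- !bsum_scal, <- bsum_plus; apply bsum_ext; intros nu _.
rewrite <- !bsum_scal, <- bsum_plus; apply bsum_ext; intros j _.
rewrite <- !bsum_scal, <- bsum_plus; apply bsum_ext; intros l _.
rewrite radon_lin; auto using COS_bound; [ring|apply COS_bound].
Qed.

Lemma B2m_ext (m : nat) (f g : R * R * R -> R) (p : R * R * R) : (1 <= m)%nat ->
  (forall q, f q = g q) -> B2m m f p = B2m m g p.
Proof.
intros Hm E; rewrite !B2m_bsum by exact Hm.
apply bsum_ext; intros nu _; apply bsum_ext; intros j _; apply bsum_ext; intros l _.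
f_equal; unfold radon; apply RInt_ext; intros; apply E.
Qed.

(** Integrability is included so that the predicate is closed under linear combinations. The point
    is fixed because reproduction is established for points over the disk. *)
Definition reproduced (m : nat) (p : R * R * R) (f : R * R * R -> R) : Prop :=
  chord_integrable f /\ B2m m f p = f p.

Definition is_subspace (V : (R * R * R -> R) -> Prop) : Prop :=
  (forall a b f g, V f -> V g -> V (fun p => a * f p + b * g p)) /\
  (forall f g, (forall p, f p = g p) -> V f -> V g).

Lemma reproduced_subspace (m : nat) (p : R * R * R) : (1 <= m)%nat ->
  is_subspace (reproduced m p).
Proof.
intros Hm; split.
- intros a b f g [If Hf] [Ig Hg]; split; [now apply chord_integrable_lin|].
  rewrite B2m_lin, Hf, Hg; auto.
- intros f g E [If Hf]; split.
  + intros phi t z Ht Hz.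
    apply (ex_RInt_ext (fun s => f (chord phi t s, z))); auto.
  + rewrite <- E, <- Hf; apply B2m_ext; auto.
Qed.

Lemma theta_bound (m j : nat) : (j <= 2 * m + 1)%nat -> 0 <= theta m j <= PI.
Proof.
intros Hj; unfold theta.
assert (0 < INR (2 * m + 1)) by (apply lt_0_INR; lia).
assert (0 <= INR j <= INR (2 * m + 1)) by (split; [apply pos_INR|apply le_INR; lia]).
assert (HPI := PI_RGT_0).
split; [apply Rdiv_le_0_compat; nra|].
apply Rmult_le_reg_r with (INR (2 * m + 1)); [lra|].
unfold Rdiv; rewrite Rmult_assoc, Rinv_l by lra; nra.
Qed.

Lemma ridge_bound (q : R * R) (psi : R) : disk q -> -1 <= ridge psi q <= 1.
Proof.
unfold disk, ridge; destruct q as [x y]; simpl fst; simpl snd; intros H.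
assert (Hs := sin2_cos2 psi); unfold Rsqr in Hs.
assert ((x * cos psi + y * sin psi) ^ 2 <= 1).
{ assert (0 <= (x * sin psi - y * cos psi) ^ 2) by apply pow2_ge_0.
  replace ((x * cos psi + y * sin psi) ^ 2) with
    ((x ^ 2 + y ^ 2) * (sin psi * sin psi + cos psi * cos psi)
      - (x * sin psi - y * cos psi) ^ 2) by ring.
  rewrite Hs; lra. }
split; nra.
Qed.

Lemma cos_sigma (m nu : nat) (q : R * R) : disk q -> cos (sigma m nu q) = ridge (phi m nu) q.
Proof. intros Hq; unfold sigma; apply cos_acos; now apply (ridge_bound q). Qed.

(** After Marr's formula the sum over [l] selects [i = c], the sum over [j] selects [k = d], and the
    sum over [nu] turns the product of two [U_d] into the value at [psi]. The pair [(d, c)] lies in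
    the triangle [k + i <= 2 m] of the kernel. *)
Lemma reproduced_ridge (m d c : nat) (psi : R) (p : R * R * R) :
  (1 <= m)%nat -> (d + c < 2 * m)%nat -> disk (fst p) ->
  reproduced m p (fun p => chebU d (ridge psi (fst p)) * chebT c (snd p)).
Proof.
intros Hm Hdc Hp.
assert (Hr : forall phi a z, 0 <= a <= PI ->
  is_RInt (fun s => chebU d (ridge psi (chord phi (cos a) s)) * chebT c z)
    (- sqrt (1 - cos a ^ 2)) (sqrt (1 - cos a ^ 2))
    (chebT c z * (2 / INR (S d) * sin (INR (S d) * a) * chebU d (cos (phi - psi))))).
{ intros phi a z Ha.
  apply (is_RInt_ext (fun s => scal (chebT c z) (chebU d (ridge psi (chord phi (cos a) s))))).
  { intros; apply Rmult_comm. }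
  apply (is_RInt_scal (V := R_NormedModule)).
  now apply radon_ridge. }
split.
{ intros phi t z Ht _; destruct (cos_acos_interval t Ht) as [a [Ha ->]].
  cbn [fst snd]; eexists; exact (Hr phi a z Ha). }
rewrite B2m_bsum by exact Hm; simpl fst; simpl snd.
set (K := / (INR (2 * m) * INR (2 * m + 1) ^ 2)).
set (z := snd p).
assert (Hd : INR (S d) <> 0) by (apply not_0_INR; lia).
assert (HM : INR (2 * m + 1) <> 0) by (apply not_0_INR; lia).
assert (H2m : INR (2 * m) <> 0) by (apply not_0_INR; lia).
transitivity (bsum (2 * m + 1) (fun nu =>
  K * INR (2 * m + 1) * INR (2 * m) * chebT c z *
    (chebU d (cos (phi m nu - psi)) * chebU d (ridge (phi m nu) (fst p))))).
2:{ rewrite bsum_scal, (chebU_reproducing m d psi (fun t => chebU d (ridge t (fst p))));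
      [unfold K; field; auto|lia|apply parity_trig_chebU]. }
apply bsum_ext; intros nu _.
transitivity (bsum (2 * m) (fun j => bsum (2 * m) (fun l =>
  bsum (2 * m + 1) (fun k => bsum (2 * m + 1 - k) (fun i =>
    K * (2 / INR (S d)) * chebU d (cos (phi m nu - psi)) * INR (k + 1)
      * chebU k (ridge (phi m nu) (fst p))
      * (sin (INR (S d) * theta m (S j)) * sin (INR (k + 1) * theta m (S j)))
      * (chebT c (znode m l) * chebT_tilde i (znode m l) * chebT_tilde i z)))))).
{ apply bsum_ext; intros j Hj; apply bsum_ext; intros l _.
  replace (radon (phi m nu) _ (cos (theta m (S j)))) with
    (chebT c (znode m l) * (2 / INR (S d) * sin (INR (S d) * theta m (S j))
      * chebU d (cos (phi m nu - psi)))).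
  2:{ symmetry; unfold radon; apply is_RInt_unique.
      apply Hr, theta_bound; lia. }
  rewrite T_kernel_bsum, cos_sigma by exact Hp; fold K z.
  rewrite <- !bsum_scal; apply bsum_ext; intros k _.
  rewrite <- !bsum_scal; apply bsum_ext; intros i _; ring. }
rewrite (bsum_ext (2 * m) _ (fun j => bsum (2 * m + 1) (fun k =>
  bsum (2 * m + 1 - k) (fun i =>
    K * (2 / INR (S d)) * chebU d (cos (phi m nu - psi)) * INR (k + 1)
      * chebU k (ridge (phi m nu) (fst p))
      * (sin (INR (S d) * theta m (S j)) * sin (INR (k + 1) * theta m (S j)))
      * (if Nat.eq_dec c i then INR (2 * m) * chebT c z else 0))))).
2:{ intros j _; rewrite bsum_swap; apply bsum_ext; intros k _.
    rewrite bsum_swap; apply bsum_ext; intros i Hi.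
    rewrite bsum_scal, chebT_orthogonality by lia; reflexivity. }
rewrite bsum_swap.
rewrite (bsum_ext (2 * m + 1) _ (fun k => bsum (2 * m + 1 - k) (fun i =>
    K * (2 / INR (S d)) * chebU d (cos (phi m nu - psi)) * INR (k + 1)
      * chebU k (ridge (phi m nu) (fst p))
      * (if Nat.eq_dec d k then INR (2 * m + 1) / 2 else 0)
      * (if Nat.eq_dec c i then INR (2 * m) * chebT c z else 0)))).
2:{ intros k Hk; rewrite bsum_swap; apply bsum_ext; intros i _.
    rewrite bsum_scal_r; f_equal; rewrite bsum_scal; f_equal.
    (* The nodes start at index 1; adding the vanishing term [j = 0] gives the range of
       [sin_orthogonality]. *)
    assert (E : bsum (2 * m) (fun j =>
        sin (INR (S d) * theta m (S j)) * sin (INR (k + 1) * theta m (S j)))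
      = bsum (2 * m + 1) (fun j => sin (INR (S d) * (INR j * PI / INR (2 * m + 1)))
          * sin (INR (k + 1) * (INR j * PI / INR (2 * m + 1))))).
    { replace (2 * m + 1)%nat with (S (2 * m)) at 1 by lia.
      rewrite bsum_first; unfold theta; simpl (INR 0).
      unfold Rdiv at 3; rewrite !Rmult_0_l, Rmult_0_r, sin_0; ring. }
    (* [k = 2 m] is beyond the range of [sin_orthogonality], but there the sine vanishes at every
       node, which agrees with the right-hand side because [d < 2 m]. *)
    rewrite E; destruct (Nat.eq_dec k (2 * m)) as [->|Hk'].
    - rewrite bsum_zero; [destruct (Nat.eq_dec d (2 * m)); [lia|reflexivity]|].
      intros j _.
      replace (INR (2 * m + 1) * (INR j * PI / INR (2 * m + 1))) with (INR j * PI)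
        by (field; auto).
      rewrite sin_INR_PI; ring.
    - rewrite sin_orthogonality by lia.
      destruct (Nat.eq_dec (S d) (k + 1)), (Nat.eq_dec d k); (lia || reflexivity). }
rewrite (bsum_single _ d).
- rewrite (bsum_single _ c).
  + destruct (Nat.eq_dec d d), (Nat.eq_dec c c); try congruence.
    rewrite Nat.add_1_r; field; auto.
  + lia.
  + intros i _ Hi; destruct (Nat.eq_dec c i); [congruence|ring].
- lia.
- intros k _ Hk; apply bsum_zero; intros i _.
  destruct (Nat.eq_dec d k); [congruence|ring].
Qed.

(** * From ridge polynomials to all polynomials *)

Lemma subspace_bsum (V : (R * R * R -> R) -> Prop) (n : nat) (c : nat -> R)
  (f : nat -> R * R * R -> R) : is_subspace V ->
  (forall i, (i <= n)%nat -> V (f i)) -> V (fun p => bsum (S n) (fun i => c i * f i p)).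
Proof.
intros HV; assert (HV' := HV); destruct HV' as [Hlin Hext]; intros H.
induction n as [|n IH].
- apply (Hext (fun p => c 0%nat * f 0%nat p + 0 * f 0%nat p)).
  + intros p; simpl; ring.
  + apply Hlin; apply H; lia.
- apply (Hext (fun p => 1 * bsum (S n) (fun i => c i * f i p) + c (S n) * f (S n) p)).
  + intros p; cbn [bsum]; ring.
  + apply Hlin; [apply IH; intros; apply H; lia|apply H; lia].
Qed.

Lemma subspace_scal (V : (R * R * R -> R) -> Prop) (c : R) (f g : R * R * R -> R) :
  is_subspace V -> (forall p, c * f p = g p) -> V f -> V g.
Proof.
intros [Hlin Hext] E Hf; apply (Hext (fun p => c * f p + 0 * f p)); [|now apply Hlin].
intros p; rewrite <- E; ring.
Qed.

(* Replacing [tau] by [2 * tau] and subtracting [2 ^ d] times the original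
   expression removes the top coefficient. *)
Lemma subspace_coefficients (V : (R * R * R -> R) -> Prop) (d : nat)
  (v : nat -> R * R * R -> R) : is_subspace V ->
  (forall tau, V (fun p => bsum (S d) (fun a => tau ^ a * v a p))) ->
  forall a, (a <= d)%nat -> V (v a).
Proof.
intros HV; assert (HV' := HV); destruct HV' as [Hlin Hext]; revert v.
induction d as [|d IH]; intros v H.
- intros a Ha; replace a with 0%nat by lia.
  apply (Hext _ _ (fun p => eq_trans (Rplus_0_l _) (Rmult_1_l _)) (H 1)).
- assert (Hlow : forall a, (a <= d)%nat -> V (v a)).
  { intros a Ha.
    assert (Hc : 2 ^ a - 2 ^ S d <> 0).
    { assert (2 ^ a < 2 ^ S d) by (apply Rlt_pow; [lra|lia]); lra. }
    apply (subspace_scal V (/ (2 ^ a - 2 ^ S d)) (fun p => (2 ^ a - 2 ^ S d) * v a p));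
      [exact HV|intros; field; exact Hc|].
    apply (IH (fun a p => (2 ^ a - 2 ^ S d) * v a p)); [|exact Ha].
    intros tau; apply (Hext (fun p =>
      1 * bsum (S (S d)) (fun a => (2 * tau) ^ a * v a p)
      + (- 2 ^ S d) * bsum (S (S d)) (fun a => tau ^ a * v a p))); [|now apply Hlin].
    intros p; rewrite <- !bsum_scal, <- bsum_plus.
    change (bsum (S (S d)) ?f) with (bsum (S d) f + f (S d)); cbv beta.
    replace (1 * ((2 * tau) ^ S d * v (S d) p) + _) with 0
      by (rewrite Rpow_mult_distr; ring).
    rewrite Rplus_0_r.
    apply bsum_ext; intros i _; rewrite Rpow_mult_distr; ring. }
  intros a Ha; destruct (Nat.eq_dec a (S d)) as [->|Hne]; [|apply Hlow; lia].
  apply (Hext (fun p => 1 * bsum (S (S d)) (fun a => 1 ^ a * v a p)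
    + (-1) * bsum (S d) (fun a => 1 ^ a * v a p))).
  + intros p; cbn [bsum]; rewrite !pow1; ring.
  + apply Hlin; [apply H|apply subspace_bsum; auto].
Qed.

Lemma sum_f_R0_bsum (f : nat -> R) (n : nat) : sum_f_R0 f n = bsum (S n) f.
Proof. induction n as [|n IH]; simpl; [ring|]; rewrite IH; reflexivity. Qed.

(** Powers of a linear form come from [2 x U_(k+1) = U_(k+2) + U_k], which trades a factor for a
    change of index without raising the total degree. With [tau = tan psi] the form is proportional
    to [x + tau y], and [x ^ a y ^ b] is, up to a binomial coefficient, the coefficient of [tau ^ b]
    in its power of order [a + b]. *)
Lemma reproduced_monomial (m : nat) (p : R * R * R) (a b c : nat) :
  (1 <= m)%nat -> disk (fst p) -> (a + b + c < 2 * m)%nat ->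
  reproduced m p (fun p => fst (fst p) ^ a * snd (fst p) ^ b * chebT c (snd p)).
Proof.
intros Hm Hp; assert (HV := reproduced_subspace m p Hm); assert (HV' := HV).
destruct HV' as [Hlin Hext].
assert (H1 : forall psi j k, (j + k + c < 2 * m)%nat -> reproduced m p (fun p =>
  ridge psi (fst p) ^ j * chebU k (ridge psi (fst p)) * chebT c (snd p))).
{ intros psi j; induction j as [|j IH]; intros k Hk.
  - apply (Hext (fun p => chebU k (ridge psi (fst p)) * chebT c (snd p)));
      [intros; simpl; ring|apply reproduced_ridge; auto].
  - destruct k as [|k].
    + apply (subspace_scal _ (/ 2) _ _ HV) with (2 := IH 1%nat ltac:(lia)).
      intros; simpl; field.
    + apply (Hext _ _) with (2 := Hlin (/ 2) (/ 2) _ _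
        (IH (S (S k)) ltac:(lia)) (IH k ltac:(lia))).
      intros; rewrite chebU_SS, <- (tech_pow_Rmult _ j); field. }
intros Habc; set (d := (a + b)%nat).
assert (H2 : forall tau, reproduced m p (fun p => bsum (S d) (fun i =>
  tau ^ i * (Binomial.C d i * snd (fst p) ^ i * fst (fst p) ^ (d - i) * chebT c (snd p))))).
{ intros tau; set (psi := atan tau).
  assert (Hc : cos psi <> 0).
  { destruct (atan_bound tau); apply Rgt_not_eq, cos_gt_0; unfold psi; lra. }
  assert (Ht : tau = sin psi / cos psi) by (symmetry; apply tan_atan).
  apply (subspace_scal _ (/ cos psi ^ d) _ _ HV) with (2 := H1 psi d 0%nat ltac:(lia)).
  intros [[x y] z]; unfold ridge; simpl fst; simpl snd; simpl chebU.
  replace (x * cos psi + y * sin psi) with (cos psi * (tau * y + x))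
    by (rewrite Ht; field; exact Hc).
  rewrite Rpow_mult_distr, binomial, sum_f_R0_bsum.
  rewrite (bsum_ext _ (fun i => tau ^ i * _)
    (fun i => Binomial.C d i * (tau * y) ^ i * x ^ (d - i) * chebT c z))
    by (intros; rewrite Rpow_mult_distr; ring).
  rewrite bsum_scal_r; field; now apply pow_nonzero. }
assert (HC : Binomial.C d b <> 0).
{ unfold Binomial.C, Rdiv; apply Rmult_integral_contrapositive_currified; [apply INR_fact_neq_0|].
  apply Rinv_neq_0_compat, Rmult_integral_contrapositive_currified; apply INR_fact_neq_0. }
apply (subspace_scal _ (/ Binomial.C d b) _ _ HV)
  with (2 := subspace_coefficients _ d (fun i p =>
    Binomial.C d i * snd (fst p) ^ i * fst (fst p) ^ (d - i) * chebT c (snd p)) HV H2 b ltac:(lia)).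
intros q; cbv beta; replace (d - b)%nat with a by lia; field; exact HC.
Qed.

Lemma reproduced_chebT (m : nat) (p : R * R * R) (a b c : nat) :
  (1 <= m)%nat -> disk (fst p) -> (a + b + c < 2 * m)%nat ->
  reproduced m p (fun p => chebT a (fst (fst p)) * chebT b (snd (fst p)) * chebT c (snd p)).
Proof.
intros Hm Hp; assert (HV := reproduced_subspace m p Hm); assert (HV' := HV).
destruct HV' as [Hlin Hext].
(* The additional power [e] absorbs the factor [2 x] of the Chebyshev recurrence at the same total
   degree. *)
assert (H1 : forall a e b, (a + e + b + c < 2 * m)%nat -> reproduced m p (fun p =>
  chebT a (fst (fst p)) * fst (fst p) ^ e * snd (fst p) ^ b * chebT c (snd p))).
{ clear a b; intros a; induction a as [| |a IH1 IH2] using two_step_ind; intros e b H.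
  - apply (Hext _ _) with (2 := reproduced_monomial m p e b c Hm Hp ltac:(lia)).
    intros; simpl; ring.
  - apply (Hext _ _) with (2 := reproduced_monomial m p (S e) b c Hm Hp ltac:(lia)).
    intros; simpl; ring.
  - apply (Hext _ _) with (2 := Hlin 2 (-1) _ _ (IH2 (S e) b ltac:(lia))
      (IH1 e b ltac:(lia))).
    intros; rewrite chebT_SS, <- (tech_pow_Rmult _ e); ring. }
assert (H2 : forall b e, (a + b + e + c < 2 * m)%nat -> reproduced m p (fun p =>
  chebT a (fst (fst p)) * (chebT b (snd (fst p)) * snd (fst p) ^ e) * chebT c (snd p))).
{ clear b; intros b; induction b as [| |b IH1 IH2] using two_step_ind; intros e H.
  - apply (Hext _ _) with (2 := H1 a 0%nat e ltac:(lia)).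
    intros; simpl; ring.
  - apply (Hext _ _) with (2 := H1 a 0%nat (S e) ltac:(lia)).
    intros; simpl; ring.
  - apply (Hext _ _) with (2 := Hlin 2 (-1) _ _ (IH2 (S e) ltac:(lia))
      (IH1 e ltac:(lia))).
    intros; rewrite chebT_SS, <- (tech_pow_Rmult _ e); ring. }
intros H; apply (Hext _ _) with (2 := H2 b 0%nat ltac:(lia)); intros; simpl; ring.
Qed.

(** Polynomials of degree at most [n], spanned by the basis in which the Korovkin weights are given
    and which [reproduced_chebT] treats. *)
Inductive cheb_poly (n : nat) : (R -> R) -> Prop :=
| cheb_poly_chebT (k : nat) : (k <= n)%nat -> cheb_poly n (chebT k)
| cheb_poly_lin (a b : R) (u v : R -> R) : cheb_poly n u -> cheb_poly n v ->
    cheb_poly n (fun x => a * u x + b * v x)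
| cheb_poly_ext (u v : R -> R) : (forall x, u x = v x) -> cheb_poly n u ->
    cheb_poly n v.

Lemma reproduced_cheb_poly (m n : nat) (p : R * R * R) (u v w : R -> R) :
  (1 <= m)%nat -> (3 * n < 2 * m)%nat -> disk (fst p) ->
  cheb_poly n u -> cheb_poly n v -> cheb_poly n w ->
  reproduced m p (fun p => u (fst (fst p)) * v (snd (fst p)) * w (snd p)).
Proof.
intros Hm Hn Hp Hu Hv Hw.
destruct (reproduced_subspace m p Hm) as [Hlin Hext].
induction Hu as [a Ha|r s u u' _ IH1 _ IH2|u u' E _ IH].
- induction Hv as [b Hb|r s v v' _ IH1 _ IH2|v v' E _ IH].
  + induction Hw as [c Hc|r s w w' _ IH1 _ IH2|w w' E _ IH].
    * apply reproduced_chebT; auto; lia.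
    * apply (Hext _ _) with (2 := Hlin r s _ _ IH1 IH2); intros; ring.
    * apply (Hext _ _) with (2 := IH); intros; now rewrite E.
  + apply (Hext _ _) with (2 := Hlin r s _ _ IH1 IH2); intros; ring.
  + apply (Hext _ _) with (2 := IH); intros; now rewrite E.
- apply (Hext _ _) with (2 := Hlin r s _ _ IH1 IH2); intros; ring.
- apply (Hext _ _) with (2 := IH); intros; now rewrite E.
Qed.

(** * The norm of the operator *)

Lemma bsum_rev (n : nat) (f : nat -> R) :
  bsum n f = bsum n (fun i => f (n - S i)%nat).
Proof.
induction n as [|n IH]; [reflexivity|].
rewrite (bsum_first n (fun i => f (S n - S i)%nat)); cbn [bsum].
rewrite IH; replace (S n - 1)%nat with n by lia.
rewrite (bsum_ext n (fun i => f (S n - S (S i))%nat) (fun i => f (n - S i)%nat))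
  by (intros; f_equal; lia).
ring.
Qed.

Lemma bsum_add (a b : nat) (f : nat -> R) :
  bsum (a + b) f = bsum a f + bsum b (fun i => f (a + i)%nat).
Proof.
induction b as [|b IH]; [rewrite Nat.add_0_r; simpl; ring|].
rewrite Nat.add_succ_r; cbn [bsum]; rewrite IH; ring.
Qed.

Lemma bsum_even_le (n : nat) (f : nat -> R) : (forall i, 0 <= f i) ->
  bsum n (fun i => f (2 * i)%nat) <= bsum (2 * n) f.
Proof.
intros H; induction n as [|n IH]; [simpl; lra|].
replace (2 * S n)%nat with (S (S (2 * n))) by lia; cbn [bsum].
assert (H1 := H (S (2 * n))); lra.
Qed.

Lemma ln_ge_0 (x : R) : 1 <= x -> 0 <= ln x.
Proof. intros Hx; rewrite <- ln_1; apply ln_le; lra. Qed.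

Lemma ln_le_id (x : R) : 0 < x -> ln x <= x - 1.
Proof.
intros Hx; assert (H := exp_ineq1_le (ln x)); rewrite exp_ln in H by exact Hx; lra.
Qed.

(** The induction step is [ln x <= x - 1] at [x = n / (n + 1)], in place of a comparison with an
    integral. *)
Lemma harmonic_bound (n : nat) : (1 <= n)%nat ->
  bsum n (fun i => / INR (S i)) <= 1 + ln (INR n).
Proof.
intros Hn; induction n as [|n IH]; [lia|].
destruct n as [|n].
- simpl; rewrite ln_1; lra.
- change (bsum (S (S n)) ?f) with (bsum (S n) f + f (S n)); cbv beta.
  specialize (IH ltac:(lia)).
  assert (H1 : 0 < INR (S n)) by (apply lt_0_INR; lia).
  assert (H2 : 0 < INR (S (S n))) by (apply lt_0_INR; lia).
  assert (H := ln_le_id (INR (S n) / INR (S (S n))) ltac:(now apply Rdiv_lt_0_compat)).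
  rewrite ln_div in H by assumption.
  replace (INR (S n) / INR (S (S n)) - 1) with (- / INR (S (S n))) in H
    by (rewrite (S_INR (S n)) in *; field; lra).
  lra.
Qed.

(** A weak form of Jordan's inequality, free of concavity: up to [PI / 3] the derivative is at least
    1/2, and beyond it [sin x >= 1/2] while [x / 4 <= PI / 8 <= 1/2]. *)
Lemma sin_ge_quarter (x : R) : 0 <= x <= PI / 2 -> x / 4 <= sin x.
Proof.
intros [H0 H1]; assert (HPI := PI_RGT_0); assert (H4 := PI_4).
destruct (Rle_lt_dec x (PI / 3)) as [Hx|Hx].
- destruct (MVT_gen sin 0 x cos) as [c [Hc E]].
  + intros; apply is_derive_Reals, derivable_pt_lim_sin.
  + intros; apply continuity_sin.
  + rewrite Rmin_left, Rmax_right in Hc by lra.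
    rewrite sin_0, !Rminus_0_r in E; rewrite E.
    assert (1 / 2 <= cos c) by (rewrite <- cos_PI3; apply cos_decr_1; lra).
    nra.
- assert (sin (PI / 6) <= sin x) by (apply sin_incr_1; lra).
  rewrite sin_PI6 in *; lra.
Qed.

(* Comparable to [min (n, 1 / |sin u|)], without dividing by zero. *)
Definition peak (n : nat) (u : R) : R := / (/ INR n + Rabs (sin u)).

Lemma peak_denominator (n : nat) (u : R) : (0 < n)%nat -> 0 < / INR n + Rabs (sin u).
Proof.
intros Hn; assert (0 < / INR n) by (apply Rinv_0_lt_compat, lt_0_INR; lia).
assert (H1 := Rabs_pos (sin u)); lra.
Qed.

Lemma peak_ge0 (n : nat) (u : R) : (0 < n)%nat -> 0 <= peak n u.
Proof.
intros Hn; apply Rlt_le, Rinv_0_lt_compat; now apply peak_denominator.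
Qed.

(** Dividing the first bound by [n] and adding the second gives [|c| (1 / n + |sin u|) <= b + 1]. *)
Lemma peak_intro (n : nat) (u c b : R) : (0 < n)%nat ->
  Rabs c <= b * INR n -> Rabs (c * sin u) <= 1 -> Rabs c <= (b + 1) * peak n u.
Proof.
intros Hn H1 H2.
assert (Hd := peak_denominator n u Hn).
assert (HN : 0 < INR n) by (apply lt_0_INR; lia).
unfold peak; apply Rmult_le_reg_r with (/ INR n + Rabs (sin u)); [exact Hd|].
rewrite Rmult_assoc, Rinv_l by lra.
rewrite Rabs_mult in H2.
assert (Rabs c * / INR n <= b).
{ apply Rmult_le_reg_r with (INR n); [exact HN|].
  rewrite Rmult_assoc, Rinv_l by lra; lra. }
lra.
Qed.

Lemma peak_plus_PI (n : nat) (u : R) : peak n (u + PI) = peak n u.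
Proof. unfold peak; rewrite neg_sin, Rabs_Ropp; reflexivity. Qed.

(** [peak] has period [PI], so moving all points by one step drops the first term and appends an
    equal one. *)
Lemma peak_sum_shift (n k : nat) (x : R) : (0 < n)%nat ->
  bsum n (fun i => peak n (x + INR k * (PI / INR n) + INR i * (PI / INR n)))
  = bsum n (fun i => peak n (x + INR i * (PI / INR n))).
Proof.
intros Hn; assert (HN : INR n <> 0) by (apply not_0_INR; lia).
induction k as [|k IH].
- apply bsum_ext; intros; f_equal; simpl; ring.
- rewrite <- IH.
  set (f := fun i => peak n (x + INR k * (PI / INR n) + INR i * (PI / INR n))).
  rewrite (bsum_ext _ _ (fun i => f (S i)))
    by (intros; unfold f; rewrite !S_INR; f_equal; ring).
  assert (H := bsum_first n f); cbn [bsum] in H.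
  assert (f n = f 0%nat).
  { symmetry; unfold f; rewrite <- peak_plus_PI; f_equal; simpl; field; exact HN. }
  fold f; lra.
Qed.

(** After a shift the points lie in [[0, PI)] at spacing [PI / n], and each sine is at least a
    quarter of the distance to the nearer end. Two harmonic sums, one from each end, dominate the
    total. *)
Lemma peak_sum_bound (n : nat) (x : R) : (0 < n)%nat ->
  bsum n (fun i => peak n (x + INR i * (PI / INR n))) <= 4 * INR n * (1 + ln (INR n)).
Proof.
intros Hn.
assert (HN : 0 < INR n) by (apply lt_0_INR; lia).
assert (HPI := PI_RGT_0); assert (HPI2 := PI2_1).
set (h := PI / INR n).
assert (Hh : 0 < h) by (now apply Rdiv_lt_0_compat).
assert (HhN : INR n * h = PI) by (unfold h; field; lra).
assert (Hw : forall x, 0 <= x < h ->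
  bsum n (fun i => peak n (x + INR i * h)) <= 4 * INR n * (1 + ln (INR n))).
{ clear x; intros x [Hx0 Hxh].
  (* The term [1 / n] in the denominator of [peak] acts as one further step, whence [S i] in place
     of [i]. Both ends are added, so no case distinction survives in the sum. *)
  apply Rle_trans with (bsum n (fun i =>
    2 * INR n * / INR (S i) + 2 * INR n * / INR (S (n - S i)))).
  - apply bsum_le; intros i Hi.
    set (u := x + INR i * h).
    set (j := (n - S i)%nat).
    assert (Hj : INR j = INR n - INR i - 1)
      by (unfold j; rewrite minus_INR, S_INR by lia; ring).
    assert (Hi0 := pos_INR i); assert (Hj0 := pos_INR j).
    assert (Hu1 : INR i * h <= u) by (unfold u; lra).
    assert (Hu2 : INR j * h <= PI - u) by (unfold u; rewrite Hj, <- HhN; nra).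
    assert (Hk : forall k, INR k * h / 4 <= Rabs (sin u) ->
      peak n u <= 2 * INR n * / INR (S k)).
    { intros k Hk; assert (Hk0 := pos_INR k).
      assert (HSk : 0 < INR (S k)) by (apply lt_0_INR; lia).
      replace (2 * INR n * / INR (S k)) with (/ (INR (S k) / (2 * INR n)))
        by (field; lra).
      unfold peak; apply Rinv_le_contravar.
      - apply Rdiv_lt_0_compat; lra.
      - apply Rle_trans with (/ INR n + INR k * h / 4); [|lra].
        unfold h; rewrite S_INR.
        apply Rmult_le_reg_r with (4 * INR n); [lra|].
        replace ((INR k + 1) / (2 * INR n) * (4 * INR n)) with (2 * (INR k + 1))
          by (field; lra).
        replace ((/ INR n + INR k * (PI / INR n) / 4) * (4 * INR n))
          with (4 + INR k * PI) by (field; lra).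
        nra. }
    assert (Hpos : forall k, 0 <= 2 * INR n * / INR (S k)).
    { intros k; apply Rmult_le_pos; [lra|].
      apply Rlt_le, Rinv_0_lt_compat, lt_0_INR; lia. }
    assert (Hpi := Hpos i); assert (Hpj := Hpos j).
    assert (0 <= INR i * h) by nra; assert (0 <= INR j * h) by nra.
    destruct (Rle_lt_dec u (PI / 2)) as [Hu|Hu].
    + assert (H1 := Hk i); assert (Hs := sin_ge_quarter u ltac:(lra)).
      rewrite Rabs_right in H1 by lra.
      specialize (H1 ltac:(lra)); lra.
    + assert (H1 := Hk j); assert (Hs := sin_ge_quarter (PI - u) ltac:(lra)).
      rewrite sin_PI_x in Hs; rewrite Rabs_right in H1 by lra.
      specialize (H1 ltac:(lra)); lra.
  - rewrite bsum_plus, !bsum_scal.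
    rewrite <- (bsum_rev n (fun i => / INR (S i))).
    assert (H := harmonic_bound n ltac:(lia)); nra. }
(* Reduction to [[0, h)]. The shift lemma counts steps in naturals, so a negative integer part is
   moved to the other side. *)
set (k := Int_part (x / h)).
destruct (base_Int_part (x / h)) as [Hk1 Hk2]; fold k in Hk1, Hk2.
assert (Hx : (x / h) * h = x) by (field; lra).
destruct (Z.le_gt_cases 0 k) as [Hk|Hk].
- assert (E : IZR k = INR (Z.to_nat k)) by (rewrite INR_IZR_INZ, Z2Nat.id by lia; reflexivity).
  rewrite (bsum_ext _ _ (fun i => peak n ((x - IZR k * h) + INR (Z.to_nat k) * h + INR i * h)))
    by (intros; rewrite E; f_equal; ring).
  unfold h; rewrite peak_sum_shift by exact Hn; apply Hw; fold h; split; nra.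
- assert (E : - IZR k = INR (Z.to_nat (- k)))
    by (rewrite INR_IZR_INZ, Z2Nat.id, opp_IZR by lia; reflexivity).
  unfold h; rewrite <- (peak_sum_shift n (Z.to_nat (- k))) by exact Hn.
  rewrite <- E; fold h; apply Hw; split; nra.
Qed.

(** The points are those of even index among [2 n] points of spacing [PI / n], which cover two
    periods of [peak]. *)
Lemma peak_sum_double (n : nat) (x : R) : (0 < n)%nat ->
  bsum n (fun i => peak n (x + 2 * PI * INR i / INR n)) <= 8 * INR n * (1 + ln (INR n)).
Proof.
intros Hn; assert (HN : INR n <> 0) by (apply not_0_INR; lia).
set (f := fun i => peak n (x + INR i * (PI / INR n))).
rewrite (bsum_ext _ _ (fun i => f (2 * i)%nat)).
2:{ intros; unfold f; rewrite mult_INR, INR_2; f_equal; field; exact HN. }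
eapply Rle_trans; [apply bsum_even_le; intros; now apply peak_ge0|].
replace (2 * n)%nat with (n + n)%nat by lia; rewrite bsum_add.
rewrite (bsum_ext n (fun i => f (n + i)%nat) f).
- assert (H := peak_sum_bound n x Hn); fold f in H; lra.
- intros i _; unfold f; rewrite plus_INR, <- (peak_plus_PI n (x + INR i * _)).
  f_equal; field; exact HN.
Qed.

(** * Pointwise bounds for the factors of the kernel *)

Lemma polar_coordinates (x y : R) : exists r psi,
  0 <= r /\ x = r * cos psi /\ y = r * sin psi.
Proof.
set (r := sqrt (x ^ 2 + y ^ 2)).
assert (Hr2 : r * r = x ^ 2 + y ^ 2).
{ apply sqrt_sqrt; assert (H1 := pow2_ge_0 x); assert (H2 := pow2_ge_0 y); lra. }
assert (Hr : 0 <= r) by apply sqrt_pos.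
destruct (Req_dec r 0) as [E|Hr0].
- exists 0, 0; rewrite E in Hr2; split; [lra|split; nra].
- assert (Hrp : 0 < r) by lra.
  assert (Hc : -1 <= x / r <= 1).
  { assert (x <= r /\ - r <= x) by (split; nra).
    split; apply Rmult_le_reg_r with r; try lra;
      unfold Rdiv; rewrite Rmult_assoc, Rinv_l; lra. }
  assert (Hs : r * sin (acos (x / r)) = Rabs y).
  { rewrite sin_acos by exact Hc.
    replace r with (sqrt (r * r)) at 1 by (now apply sqrt_square).
    rewrite <- sqrt_mult_alt by nra.
    replace (r * r * (1 - Rsqr (x / r))) with (Rsqr y).
    - apply sqrt_Rsqr_abs.
    - unfold Rsqr; replace (r * r * (1 - x / r * (x / r))) with (r * r - x * x)
        by (field; lra); rewrite Hr2; ring. }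
  destruct (Rle_lt_dec 0 y) as [Hy|Hy].
  + exists r, (acos (x / r)); rewrite cos_acos, Hs, Rabs_right by lra.
    split; [exact Hr|split; [field; lra|reflexivity]].
  + exists r, (- acos (x / r)); rewrite cos_neg, sin_neg, cos_acos by exact Hc.
    rewrite Ropp_mult_distr_r_reverse, Hs, Rabs_left by lra.
    split; [exact Hr|split; [field; lra|ring]].
Qed.

(** In polar coordinates the linear form is [cos s = r cos u], where [u] is [t] shifted by the polar
    angle. As [r <= 1], [|sin u| <= |sin s|], and [|U_k (cos s) sin s| <= 1]. The shift depends on
    the point alone, so the arguments of [peak] stay equidistant when [t] runs over the nodes. *)
Lemma chebU_ridge_peak (n : nat) (q : R * R) : (0 < n)%nat -> disk q -> exists psi,
  forall k t, (k < n)%nat -> Rabs (chebU k (ridge t q)) <= 2 * peak n (psi + t).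
Proof.
intros Hn Hq; destruct q as [x y]; destruct (polar_coordinates x y) as [r [psi [Hr [Ex Ey]]]].
exists (- psi); intros k t Hk.
assert (Hr1 : r ^ 2 <= 1).
{ unfold disk in Hq; simpl fst in Hq; simpl snd in Hq.
  assert (H := sin2_cos2 psi); unfold Rsqr in H.
  replace (r ^ 2) with (r ^ 2 * (sin psi * sin psi + cos psi * cos psi))
    by (rewrite H; ring).
  rewrite Ex, Ey in Hq; nra. }
assert (E : ridge t (x, y) = r * cos (- psi + t)).
{ unfold ridge; simpl; rewrite cos_plus, cos_neg, sin_neg, Ex, Ey; ring. }
destruct (cos_acos_interval _ (ridge_bound (x, y) t Hq)) as [s [Hs Es]].
rewrite Es.
replace 2 with (1 + 1) by ring; apply peak_intro; [exact Hn| |].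
- eapply Rle_trans; [apply chebU_bound|]; rewrite Rmult_1_l; apply le_INR; lia.
- apply Rle_trans with (Rabs (chebU k (cos s) * sin s)).
  + rewrite !Rabs_mult; apply Rmult_le_compat_l; [apply Rabs_pos|].
    apply Rsqr_le_abs_0; unfold Rsqr.
    assert (H1 := sin2_cos2 s); assert (H2 := sin2_cos2 (- psi + t)).
    unfold Rsqr in H1, H2.
    assert (cos s * cos s = r ^ 2 * (cos (- psi + t) * cos (- psi + t)))
      by (rewrite <- Es, E; ring).
    nra.
  + rewrite chebU_cos; apply Rabs_le, SIN_bound.
Qed.

(** The sum is the mean of two Dirichlet kernels, at [a + b] and [a - b]. The resolution [4 * m]
    matches the halved angles [gamma m l / 2], whose spacing is [PI / (4 m)]. *)
Lemma cheb_dirichlet_peak (m n : nat) (a b : R) :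
  (1 <= m)%nat -> (1 <= n <= 2 * m + 1)%nat ->
  Rabs (bsum n (fun i => chebT_tilde i (cos a) * chebT_tilde i (cos b)))
  <= 3 / 2 * (peak (4 * m) ((a + b) / 2) + peak (4 * m) ((a - b) / 2)).
Proof.
intros Hm Hn.
(* [K s = 1 + 2 cos s + ... + 2 cos ((n - 1) s)]. Its modulus is at most [4 m + 3 <= 8 m], and
   [K s sin (s / 2) = sin ((n - 1/2) s)]. *)
set (K := fun s => 2 * bsum n (fun i => cos (INR i * s + 0)) - 1).
assert (HK : forall s, Rabs (K s) <= 3 * peak (4 * m) (s / 2)).
{ intros s; replace 3 with (2 + 1) by ring; apply peak_intro; [lia| |].
  - assert (H : Rabs (bsum n (fun i => cos (INR i * s + 0))) <= INR n).
    { eapply Rle_trans; [apply bsum_abs|].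
      rewrite <- (Rmult_1_r (INR n)), <- bsum_const; apply bsum_le; intros.
      apply Rabs_cos_le1. }
    assert (INR n <= 2 * INR m + 1)
      by (replace (2 * INR m + 1) with (INR (2 * m + 1));
          [apply le_INR; lia|rewrite plus_INR, mult_INR, INR_2; simpl; ring]).
    assert (1 <= INR m) by (apply (le_INR 1); lia).
    replace (INR (4 * m)) with (4 * INR m) by (rewrite mult_INR; simpl; ring).
    unfold K; apply Rabs_le; apply Rabs_le_between in H; lra.
  - replace (K s * sin (s / 2))
      with (2 * sin (s / 2) * bsum n (fun i => cos (INR i * s + 0)) - sin (s / 2))
      by (unfold K; ring).
    rewrite bsum_cos_telescope.
    replace (sin (0 - s / 2)) with (- sin (s / 2)) by (rewrite <- sin_neg; f_equal; ring).
    replace (sin (INR n * s + 0 - s / 2) - - sin (s / 2) - sin (s / 2))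
      with (sin (INR n * s + 0 - s / 2)) by ring.
    apply Rabs_le, SIN_bound. }
replace (bsum n _) with (/ 2 * (K (a + b) + K (a - b))).
- rewrite Rabs_mult, Rabs_right by lra.
  assert (H1 := HK (a + b)); assert (H2 := HK (a - b)).
  assert (H3 := Rabs_triang (K (a + b)) (K (a - b))); lra.
- unfold K; destruct Hn as [Hn _]; clear HK K.
  induction n as [|n IH]; [lia|]; destruct n as [|n].
  + simpl; rewrite !Rmult_0_l, !Rplus_0_l, cos_0; field.
  + change (bsum (S (S n)) ?f) with (bsum (S n) f + f (S n)); cbv beta.
    rewrite <- IH by lia; unfold chebT_tilde at 1 2; rewrite !chebT_cos, !Rplus_0_r.
    assert (H2 := sqrt_sqrt 2 ltac:(lra)).
    replace (sqrt 2 * cos (INR (S n) * a) * (sqrt 2 * cos (INR (S n) * b)))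
      with (sqrt 2 * sqrt 2 * (cos (INR (S n) * a) * cos (INR (S n) * b))) by ring.
    rewrite H2, cos_mult_cos, <- Rmult_plus_distr_l, <- Rmult_minus_distr_l; field.
Qed.

(** Expanding the square and summing over [j] first leaves the diagonal, by orthogonality of the
    discrete sines. *)
Lemma sin_parseval (n : nat) (b : nat -> R) : (0 < n)%nat ->
  bsum n (fun j => bsum n (fun k => b k * sin (INR (S k) * (INR (S j) * PI / INR (S n)))) ^ 2)
  = INR (S n) / 2 * bsum n (fun k => b k ^ 2).
Proof.
intros Hn.
set (s := fun k j => sin (INR (S k) * (INR j * PI / INR (S n)))).
rewrite (bsum_ext _ _ (fun j => bsum n (fun k => bsum n (fun l =>
  b k * b l * (s k (S j) * s l (S j)))))).
2:{ intros j _; rewrite <- Rsqr_pow2; unfold Rsqr at 1; rewrite <- bsum_scal_r.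
    apply bsum_ext; intros k _; rewrite <- bsum_scal; apply bsum_ext; intros l _.
    unfold s; ring. }
rewrite bsum_swap, <- bsum_scal; apply bsum_ext; intros k Hk.
rewrite bsum_swap.
assert (Ho : forall l, (l < n)%nat -> bsum n (fun j => b k * b l * (s k (S j) * s l (S j)))
  = b k * b l * (if Nat.eq_dec (S k) (S l) then INR (S n) / 2 else 0)).
{ intros l Hl; rewrite bsum_scal; f_equal.
  rewrite <- (sin_orthogonality (S n)) by lia.
  rewrite bsum_first; unfold s; simpl (INR 0); unfold Rdiv at 3.
  rewrite !Rmult_0_l, Rmult_0_r, sin_0; ring. }
rewrite (bsum_ext _ _ _ Ho), (bsum_single _ k).
- destruct (Nat.eq_dec (S k) (S k)); [simpl; ring|congruence].
- exact Hk.
- intros l _ Hl; destruct (Nat.eq_dec (S k) (S l)); [congruence|ring].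
Qed.

(* Cauchy-Schwarz in [j], then Parseval; the terms with [k = 2 * m] vanish. *)
Lemma T_kernel_sum_bound (m nu l : nat) (p : R * R * R) (A D : R) : (1 <= m)%nat ->
  disk (fst p) ->
  (forall k, (k < 2 * m)%nat -> Rabs (chebU k (ridge (phi m nu) (fst p))) <= A) ->
  (forall n, (1 <= n <= 2 * m + 1)%nat ->
    Rabs (bsum n (fun i => chebT_tilde i (znode m l) * chebT_tilde i (snd p))) <= D) ->
  bsum (2 * m) (fun j => Rabs (T_kernel m nu (S j) l p)) <= A * D / sqrt (INR (2 * m + 1)).
Proof.
intros Hm Hp HA HD.
set (n := (2 * m)%nat) in *.
assert (En : (n + 1 = S n)%nat) by lia.
assert (Hn : 0 < INR n) by (apply lt_0_INR; lia).
assert (HSn : INR (S n) = INR n + 1) by apply S_INR.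
set (K := / (INR n * INR (S n) ^ 2)).
assert (HA0 : 0 <= A) by (eapply Rle_trans; [apply Rabs_pos|apply (HA 0%nat); lia]).
assert (HD0 : 0 <= D) by (eapply Rle_trans; [apply Rabs_pos|apply (HD 1%nat); lia]).
(* For fixed [nu] and [l] the kernel is a sine polynomial in [j]; summing over [i] first puts one
   Dirichlet-type sum into each coefficient. *)
set (b := fun k => INR (S k) * chebU k (ridge (phi m nu) (fst p))
  * bsum (S n - k) (fun i => chebT_tilde i (znode m l) * chebT_tilde i (snd p))).
assert (ET : forall j, T_kernel m nu (S j) l p
  = K * bsum n (fun k => b k * sin (INR (S k) * (INR (S j) * PI / INR (S n))))).
{ intros j; rewrite T_kernel_bsum, cos_sigma by exact Hp; fold n; rewrite En; fold K.
  f_equal; cbn [bsum].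
  rewrite (bsum_zero (S n - n)), Rplus_0_r.
  - apply bsum_ext; intros k _; unfold b.
    rewrite <- bsum_scal, <- bsum_scal_r; apply bsum_ext; intros i _.
    rewrite Nat.add_1_r; unfold theta; fold n; rewrite En; ring.
  - intros i _; unfold theta; fold n; rewrite En.
    replace (INR (S n) * (INR (S j) * PI / INR (S n))) with (INR (S j) * PI)
      by (field; lra).
    rewrite sin_INR_PI; ring. }
assert (Hb : forall k, (k < n)%nat -> b k ^ 2 <= (INR n * A * D) ^ 2).
{ intros k Hk; apply pow_maj_Rabs; unfold b.
  apply Rabs_mult_le_compat; [apply Rabs_mult_le_compat|apply HD; lia].
  - rewrite Rabs_right by (apply Rle_ge, pos_INR); apply le_INR; lia.
  - apply HA; exact Hk. }
assert (Hsum : bsum n (fun j => T_kernel m nu (S j) l p ^ 2)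
  <= K ^ 2 * (INR (S n) / 2 * (INR n * (INR n * A * D) ^ 2))).
{ rewrite (bsum_ext _ _ (fun j => K ^ 2
    * bsum n (fun k => b k * sin (INR (S k) * (INR (S j) * PI / INR (S n)))) ^ 2))
    by (intros; rewrite ET; ring).
  rewrite bsum_scal, sin_parseval by lia.
  apply Rmult_le_compat_l; [apply pow2_ge_0|].
  apply Rmult_le_compat_l; [lra|].
  rewrite <- bsum_const; now apply bsum_le. }
assert (HCS := bsum_cauchy_schwarz n (fun _ => 1) (fun j => Rabs (T_kernel m nu (S j) l p))).
rewrite (bsum_ext _ (fun i => 1 * _) (fun j => Rabs (T_kernel m nu (S j) l p))) in HCS
  by (intros; ring).
rewrite (bsum_ext _ (fun i => Rabs _ ^ 2) (fun j => T_kernel m nu (S j) l p ^ 2)) in HCS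
  by (intros; apply pow2_abs).
rewrite (bsum_ext _ (fun i => 1 ^ 2) (fun j => 1)), bsum_const in HCS by (intros; ring).
rewrite En.
assert (Hsq : 0 < sqrt (INR (S n))) by (apply sqrt_lt_R0; lra).
assert (Hsq2 : sqrt (INR (S n)) * sqrt (INR (S n)) = INR (S n)) by (apply sqrt_sqrt; lra).
apply Rsqr_incr_0_var.
2:{ apply Rmult_le_pos; [nra|apply Rlt_le, Rinv_0_lt_compat; exact Hsq]. }
unfold Rsqr.
set (X := bsum n (fun j => Rabs (T_kernel m nu (S j) l p))) in *.
replace (A * D / sqrt (INR (S n)) * (A * D / sqrt (INR (S n))))
  with ((A * D) ^ 2 / INR (S n))
  by (rewrite <- Hsq2 at 1; field; lra).
apply Rle_trans with (INR n * (K ^ 2 * (INR (S n) / 2 * (INR n * (INR n * A * D) ^ 2)))).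
- replace (X * X) with (X ^ 2) by ring; eapply Rle_trans; [exact HCS|].
  rewrite Rmult_1_r; apply Rmult_le_compat_l; lra.
- assert (HAD : 0 <= (A * D) ^ 2) by apply pow2_ge_0.
  replace (INR n * (K ^ 2 * (INR (S n) / 2 * (INR n * (INR n * A * D) ^ 2))))
    with ((A * D) ^ 2 / INR (S n) * (INR n ^ 2 / (2 * INR (S n) ^ 2)))
    by (unfold K; field; lra).
  rewrite <- (Rmult_1_r ((A * D) ^ 2 / INR (S n))) at 2.
  apply Rmult_le_compat_l.
  + apply Rmult_le_pos; [exact HAD|apply Rlt_le, Rinv_0_lt_compat; lra].
  + apply Rmult_le_reg_r with (2 * INR (S n) ^ 2); [nra|].
    unfold Rdiv; rewrite Rmult_assoc, Rinv_l by nra; rewrite HSn; nra.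
Qed.

Lemma one_minus_sqr_sqrt (t : R) : -1 <= t <= 1 ->
  0 <= 1 - t ^ 2 /\ 0 <= sqrt (1 - t ^ 2) <= 1 /\ sqrt (1 - t ^ 2) ^ 2 = 1 - t ^ 2.
Proof.
intros Ht; assert (H : 0 <= 1 - t ^ 2) by nra.
assert (H1 := sqrt_pos (1 - t ^ 2)).
assert (H2 := pow2_sqrt _ H); repeat split; auto; nra.
Qed.

Lemma chord_disk (phi t s : R) : -1 <= t <= 1 ->
  - sqrt (1 - t ^ 2) <= s <= sqrt (1 - t ^ 2) -> disk (chord phi t s).
Proof.
intros Ht Hs; destruct (one_minus_sqr_sqrt t Ht) as [H1 [H2 H3]].
unfold disk, chord; simpl fst; simpl snd.
assert (H := sin2_cos2 phi); unfold Rsqr in H.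
replace ((t * cos phi + s * sin phi) ^ 2 + (t * sin phi - s * cos phi) ^ 2)
  with ((t ^ 2 + s ^ 2) * (sin phi * sin phi + cos phi * cos phi)) by ring.
rewrite H; nra.
Qed.

Lemma radon_bound (phi t z eps : R) (e : R * R * R -> R) : chord_integrable e ->
  (forall p, cylinder p -> Rabs (e p) <= eps) -> -1 <= t <= 1 -> -1 <= z <= 1 ->
  Rabs (radon phi (fun q => e (q, z)) t) <= 2 * eps.
Proof.
intros He Hb Ht Hz.
destruct (one_minus_sqr_sqrt t Ht) as [H1 [H2 H3]].
assert (Heps : 0 <= eps).
{ eapply Rle_trans; [apply Rabs_pos|apply (Hb (0, 0, 0))].
  split; [unfold disk|]; simpl; lra. }
set (r := sqrt (1 - t ^ 2)) in *.
apply Rle_trans with ((r - - r) * eps); [|nra].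
apply abs_RInt_le_const; [lra|apply (He phi t z Ht Hz)|].
intros s Hs; apply Hb; split; [|exact Hz].
apply (chord_disk phi t s Ht Hs).
Qed.

(** The constant is [2 * 16 * 24]: the maximal length of a chord and the peak sums over [nu] and
    [l]. The factor 4 in the logarithm covers both resolutions, [2 * m + 1] and [4 * m]. *)
Lemma B2m_bound (m : nat) (e : R * R * R -> R) (p : R * R * R) (eps : R) :
  (1 <= m)%nat -> chord_integrable e -> cylinder p ->
  (forall q, cylinder q -> Rabs (e q) <= eps) ->
  Rabs (B2m m e p) <= eps * (768 * INR (2 * m + 1) ^ 2 / sqrt (INR (2 * m + 1))
    * (1 + ln (4 * INR (2 * m + 1))) ^ 2).
Proof.
intros Hm He Hp Hb; set (n := (2 * m + 1)%nat).
destruct p as [q z]; destruct Hp as [Hq Hz]; simpl fst in Hq; simpl snd in Hz.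
assert (Heps : 0 <= eps).
{ eapply Rle_trans; [apply Rabs_pos|apply (Hb (0, 0, 0))].
  split; [unfold disk|]; simpl; lra. }
destruct (chebU_ridge_peak n q ltac:(lia) Hq) as [psi Hpsi].
destruct (cos_acos_interval z Hz) as [g [Hg Ez]].
assert (HN : 1 <= INR n) by (apply (le_INR 1); lia).
assert (Hsq : 0 < sqrt (INR n)) by (apply sqrt_lt_R0; lra).
set (A := fun nu => 2 * peak n (psi + phi m nu)).
set (D := fun l => 3 / 2 * (peak (4 * m) ((gamma m l + g) / 2)
  + peak (4 * m) ((gamma m l - g) / 2))).
assert (HA0 : forall nu, 0 <= A nu).
{ intros nu; unfold A; assert (H := peak_ge0 n (psi + phi m nu) ltac:(lia)); lra. }
assert (HD0 : forall l, 0 <= D l).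
{ intros l; unfold D.
  assert (H := peak_ge0 (4 * m) ((gamma m l + g) / 2) ltac:(lia)).
  assert (H' := peak_ge0 (4 * m) ((gamma m l - g) / 2) ltac:(lia)); lra. }
set (L := 1 + ln (4 * INR n)).
assert (HL : 0 <= ln (4 * INR n)) by (apply ln_ge_0; lra).
assert (HSA : bsum n A <= 16 * INR n * L).
{ unfold A; rewrite bsum_scal.
  assert (H := peak_sum_double n psi ltac:(lia)).
  assert (ln (INR n) <= ln (4 * INR n)) by (apply ln_le; lra).
  unfold phi; fold n; unfold L; nra. }
assert (HSD : bsum (2 * m) D <= 24 * INR n * L).
{ unfold D; rewrite bsum_scal, bsum_plus.
  assert (Hm0 : 0 < INR m) by (apply lt_0_INR; lia).
  assert (E4 : INR (4 * m) = 4 * INR m) by (rewrite mult_INR; simpl; ring).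
  assert (En : INR n = 2 * INR m + 1)
    by (unfold n; rewrite plus_INR, mult_INR, INR_2; simpl; ring).
  assert (Hx : forall x, bsum (2 * m) (fun l => peak (4 * m) ((gamma m l + x) / 2))
    <= 8 * INR n * L).
  { intros x.
    set (f := fun l => peak (4 * m) (x / 2 + PI / (8 * INR m) + INR l * (PI / INR (4 * m)))).
    rewrite (bsum_ext _ _ f).
    2:{ intros l _; unfold f, gamma; rewrite E4, plus_INR, mult_INR, INR_2.
        f_equal; simpl (INR 1); field; lra. }
    (* The halved angles fill only half a period of [peak]; nonnegative terms are added to complete
       it. *)
    apply Rle_trans with (bsum (4 * m) f).
    - replace (4 * m)%nat with (2 * m + 2 * m)%nat at 1 by lia; rewrite bsum_add.
      assert (0 <= bsum (2 * m) (fun i => f (2 * m + i)%nat)); [|lra].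
      apply bsum_ge0; intros; apply peak_ge0; lia.
    - eapply Rle_trans; [apply peak_sum_bound; lia|].
      assert (ln (INR (4 * m)) <= ln (4 * INR n)) by (apply ln_le; lra).
      assert (1 <= INR (4 * m)) by (apply (le_INR 1); lia).
      assert (0 <= ln (INR (4 * m))) by (now apply ln_ge_0).
      apply Rmult_le_compat; unfold L; lra. }
  assert (H1 := Hx g); assert (H2 := Hx (- g)).
  rewrite (bsum_ext _ (fun l => peak (4 * m) ((gamma m l - g) / 2))
    (fun l => peak (4 * m) ((gamma m l + - g) / 2))) by reflexivity.
  lra. }
rewrite B2m_bsum by exact Hm.
apply Rle_trans with (bsum n (fun nu => bsum (2 * m) (fun l =>
  2 * eps * (A nu * D l / sqrt (INR n))))).
- eapply Rle_trans; [apply bsum_abs|]; apply bsum_le; intros nu Hnu.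
  rewrite bsum_swap; eapply Rle_trans; [apply bsum_abs|]; apply bsum_le; intros l Hl.
  eapply Rle_trans; [apply bsum_abs|].
  apply Rle_trans with (2 * eps * bsum (2 * m) (fun j => Rabs (T_kernel m nu (S j) l (q, z)))).
  + rewrite <- bsum_scal; apply bsum_le; intros j Hj.
    rewrite Rabs_mult; apply Rmult_le_compat_r; [apply Rabs_pos|].
    apply radon_bound; auto; apply COS_bound.
  + apply Rmult_le_compat_l; [lra|].
    apply T_kernel_sum_bound; auto.
    * intros k Hk; simpl fst; apply Hpsi; lia.
    * intros k Hk; simpl snd; rewrite Ez; apply cheb_dirichlet_peak; auto.
- rewrite (bsum_ext _ _ (fun nu => 2 * eps / sqrt (INR n) * bsum (2 * m) D * A nu)).
  2:{ intros nu _; rewrite <- (Rmult_comm (A nu)), <- !bsum_scal.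
      apply bsum_ext; intros l _; field; lra. }
  rewrite bsum_scal.
  assert (H0A : 0 <= bsum n A) by (apply bsum_ge0; auto).
  assert (H0D : 0 <= bsum (2 * m) D) by (apply bsum_ge0; auto).
  assert (HK : 0 <= 2 * eps / sqrt (INR n))
    by (apply Rmult_le_pos; [lra|apply Rlt_le, Rinv_0_lt_compat; exact Hsq]).
  assert (bsum (2 * m) D * bsum n A <= 24 * INR n * L * (16 * INR n * L))
    by (apply Rmult_le_compat; assumption).
  rewrite Rmult_assoc.
  apply Rle_trans with (2 * eps / sqrt (INR n) * (24 * INR n * L * (16 * INR n * L))).
  + apply Rmult_le_compat_l; assumption.
  + replace (2 * eps / sqrt (INR n) * (24 * INR n * L * (16 * INR n * L)))
      with (eps * (768 * INR n ^ 2 / sqrt (INR n) * L ^ 2)) by (field; lra).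
    apply Rmult_le_compat_l; [exact Heps|].
    apply Rmult_le_compat_r; [apply pow2_ge_0|].
    apply Rmult_le_compat_r; [apply Rlt_le, Rinv_0_lt_compat; exact Hsq|nra].
Qed.

(** * Korovkin operators *)

Lemma cheb_poly_bsum (n r : nat) (c : nat -> R) (u : nat -> R -> R) :
  (forall i, (i <= r)%nat -> cheb_poly n (u i)) ->
  cheb_poly n (fun x => bsum (S r) (fun i => c i * u i x)).
Proof.
intros H; induction r as [|r IH].
- apply (cheb_poly_ext _ (fun x => c 0%nat * u 0%nat x + 0 * u 0%nat x)).
  + intros x; simpl; ring.
  + apply cheb_poly_lin; apply H; lia.
- apply (cheb_poly_ext _ (fun x =>
    1 * bsum (S r) (fun i => c i * u i x) + c (S r) * u (S r) x)).
  + intros x; cbn [bsum]; ring.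
  + apply cheb_poly_lin; [apply IH; intros; apply H; lia|apply H; lia].
Qed.

Definition abs_diff (k l : nat) : nat := (k - l + (l - k))%nat.

Lemma chebT_dist (k l : nat) (a : R) :
  chebT (abs_diff k l) (cos a) = cos ((INR k - INR l) * a).
Proof.
rewrite chebT_cos; unfold abs_diff; destruct (Nat.le_ge_cases k l) as [H|H].
- replace (k - l + (l - k))%nat with (l - k)%nat by lia.
  rewrite minus_INR, <- cos_neg by lia; f_equal; ring.
- replace (k - l + (l - k))%nat with (k - l)%nat by lia.
  rewrite minus_INR by lia; reflexivity.
Qed.

(* The extremal coefficients of Korovkin's kernel [|sum_k a_k exp (i k t)| ^ 2]. *)
Definition korovkin_coef (n k : nat) : R := sin (INR (S k) * (PI / INR (n + 2))).

(** Quadrature at [n + 3] equidistant angles is exact up to degree [n + 2], hence for a kernel of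
    degree [n] times a cosine of degree at most 2: the discrete moments equal the continuous
    ones. *)
Definition korovkin_node (n i : nat) : R := 2 * PI * INR i / INR (n + 3).

(* For [x = cos a] this is the mean of the normalized kernel at [t - a] and [t + a],
   where [t] is the node. *)
Definition korovkin_weight (n i : nat) (x : R) : R :=
  bsum (S n) (fun k => bsum (S n) (fun l =>
    2 / (INR (n + 2) * INR (n + 3)) * korovkin_coef n k * korovkin_coef n l
    * cos ((INR k - INR l) * korovkin_node n i) * chebT (abs_diff k l) x)).

Lemma cheb_poly_korovkin (n i : nat) : cheb_poly n (korovkin_weight n i).
Proof.
apply (cheb_poly_ext _ (fun x => bsum (S n) (fun k => 1 * bsum (S n) (fun l =>
    2 / (INR (n + 2) * INR (n + 3)) * korovkin_coef n k * korovkin_coef n l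
    * cos ((INR k - INR l) * korovkin_node n i) * chebT (abs_diff k l) x)))).
- intros x; apply bsum_ext; intros; ring.
- apply (cheb_poly_bsum n n (fun _ => 1)); intros k Hk.
  apply cheb_poly_bsum; intros l Hl; apply cheb_poly_chebT; unfold abs_diff; lia.
Qed.

(** The double sum is [|sum_k a_k exp (i k s)| ^ 2], the square of the real part plus that of the
    imaginary part. *)
Lemma bsum_square_modulus (n : nat) (a : nat -> R) (s : R) :
  0 <= bsum n (fun k => bsum n (fun l => a k * a l * cos ((INR k - INR l) * s))).
Proof.
replace (bsum n _) with (bsum n (fun k => a k * cos (INR k * s)) ^ 2
  + bsum n (fun k => a k * sin (INR k * s)) ^ 2).
- assert (H1 := pow2_ge_0 (bsum n (fun k => a k * cos (INR k * s)))).
  assert (H2 := pow2_ge_0 (bsum n (fun k => a k * sin (INR k * s)))); lra.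
- rewrite <- !Rsqr_pow2; unfold Rsqr; rewrite <- !bsum_scal_r, <- bsum_plus.
  apply bsum_ext; intros k _; rewrite <- !bsum_scal, <- bsum_plus.
  apply bsum_ext; intros l _.
  rewrite Rmult_minus_distr_r, cos_minus; ring.
Qed.

(** Averaging over [t - a] and [t + a] makes the kernel even in [a], hence a polynomial in [cos a],
    and keeps it nonnegative. *)
Lemma korovkin_weight_ge0 (n i : nat) (x : R) : -1 <= x <= 1 ->
  0 <= korovkin_weight n i x.
Proof.
intros Hx; destruct (cos_acos_interval x Hx) as [a [_ ->]].
set (t := korovkin_node n i); set (c := 2 / (INR (n + 2) * INR (n + 3))).
assert (Hc : 0 <= c).
{ apply Rlt_le, Rdiv_lt_0_compat; [lra|].
  apply Rmult_lt_0_compat; apply lt_0_INR; lia. }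
set (f := fun s => bsum (S n) (fun k => bsum (S n) (fun l =>
  korovkin_coef n k * korovkin_coef n l * cos ((INR k - INR l) * s)))).
replace (korovkin_weight n i (cos a)) with (c / 2 * (f (t + a) + f (t - a))).
- apply Rmult_le_pos; [lra|].
  assert (H1 := bsum_square_modulus (S n) (korovkin_coef n) (t + a)).
  assert (H2 := bsum_square_modulus (S n) (korovkin_coef n) (t - a)).
  unfold f; lra.
- unfold f, korovkin_weight; rewrite <- bsum_plus, <- bsum_scal.
  apply bsum_ext; intros k _; rewrite <- bsum_plus, <- bsum_scal.
  apply bsum_ext; intros l _; fold t c; rewrite chebT_dist.
  rewrite (Rmult_plus_distr_l (INR k - INR l)), (Rmult_minus_distr_l (INR k - INR l)).
  rewrite cos_plus, cos_minus; field.
Qed.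

(** The sines are not cut off at index [n] here. With [a = PI / (n + 2)] the constant part of the
    product formula gives [(n + 1) / 2 * cos (q a)], and the oscillating part telescopes to the
    missing half. The cut-off is accounted for in [korovkin_moments]. *)
Lemma korovkin_correlation (n q : nat) :
  bsum (S n) (fun k => korovkin_coef n k * korovkin_coef n (k + q))
  = INR (n + 2) / 2 * cos (INR q * (PI / INR (n + 2))).
Proof.
assert (Hn : INR (n + 2) <> 0) by (apply not_0_INR; lia).
set (a := PI / INR (n + 2)).
assert (Hs : sin a <> 0).
{ assert (H := sin_frac_PI_neq0 1 0 (n + 2)); simpl (INR 0) in H; simpl (INR 1) in H.
  unfold a; replace (PI / INR (n + 2)) with ((1 - 0) * PI / INR (n + 2))
    by (unfold Rdiv; ring); apply H; lia. }
assert (Hna : (INR n + 2) * a = PI).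
{ unfold a; rewrite plus_INR, INR_2 in *; field; exact Hn. }
assert (HS : bsum (S n) (fun k => cos (INR k * (2 * a) + (2 + INR q) * a))
  = - cos (INR q * a)).
{ apply Rmult_eq_reg_l with (2 * sin a); [|intros E; apply Hs; lra].
  replace (2 * sin a * bsum _ _) with (2 * sin (2 * a / 2)
    * bsum (S n) (fun k => cos (INR k * (2 * a) + (2 + INR q) * a)))
    by (do 3 f_equal; field).
  rewrite bsum_cos_telescope, S_INR.
  replace ((INR n + 1) * (2 * a) + (2 + INR q) * a - 2 * a / 2)
    with (INR q * a - a + 2 * INR 1 * PI) by (simpl (INR 1); rewrite <- Hna; field).
  replace ((2 + INR q) * a - 2 * a / 2) with (INR q * a + a) by field.
  rewrite sin_period, sin_minus, sin_plus; ring. }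
rewrite (bsum_ext _ _ (fun k => cos (INR q * a) / 2
  + (- / 2) * cos (INR k * (2 * a) + (2 + INR q) * a))).
- rewrite bsum_plus, bsum_scal, HS, bsum_const, S_INR, plus_INR, INR_2; field.
- intros k _; unfold korovkin_coef; fold a; rewrite !S_INR, plus_INR.
  replace (INR k * (2 * a) + (2 + INR q) * a)
    with ((INR k + INR q + 1) * a + (INR k + 1) * a) by ring.
  replace (INR q * a) with ((INR k + INR q + 1) * a - (INR k + 1) * a) by ring.
  rewrite cos_plus, cos_minus; field.
Qed.

Lemma korovkin_coef_S (n : nat) : korovkin_coef n (S n) = 0.
Proof.
unfold korovkin_coef; replace (S (S n)) with (n + 2)%nat by lia.
replace (INR (n + 2) * _) with PI; [apply sin_PI|].
field; apply not_0_INR; lia.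
Qed.

(** Exact quadrature leaves the pairs with [l = k + q] or [k = l + q], which contribute equally by
    symmetry. There [chebT (abs_diff k l)] is [chebT q], and the test in the sum records that both
    indices stop at [n]. *)
Lemma korovkin_moment (n q : nat) (x : R) : (q <= 2)%nat ->
  bsum (n + 3) (fun i => korovkin_weight n i x * cos (INR q * korovkin_node n i))
  = 2 / INR (n + 2) * chebT q x * bsum (S n) (fun k => korovkin_coef n k *
      if le_dec (k + q) n then korovkin_coef n (k + q) else 0).
Proof.
intros Hq.
assert (H2 : INR (n + 2) <> 0) by (apply not_0_INR; lia).
assert (H3 : INR (n + 3) <> 0) by (apply not_0_INR; lia).
set (a := korovkin_coef n).
set (e := fun k l => if Nat.eq_dec k l then 1 else 0).
assert (Hsum : forall k l, (k < l + (n + 3))%nat -> (l < k + (n + 3))%nat ->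
  bsum (n + 3) (fun i => cos ((INR k - INR l) * korovkin_node n i)) = INR (n + 3) * e k l).
{ intros k l Hk Hl; unfold e; destruct (Nat.eq_dec k l) as [->|Hkl].
  - rewrite (bsum_ext _ _ (fun _ => 1)), bsum_const; [reflexivity|].
    intros; rewrite <- cos_0; f_equal; ring.
  - rewrite (bsum_ext _ _ (fun i => cos ((INR k - INR l) * korovkin_node n i + 0)))
      by (intros; f_equal; ring).
    unfold korovkin_node; rewrite bsum_cos_nodes; [ring|lia|].
    apply sin_frac_PI_neq0; lia. }
transitivity (bsum (S n) (fun k => bsum (S n) (fun l =>
  / INR (n + 2) * a k * a l * chebT (abs_diff k l) x * (e (k + q)%nat l + e k (l + q)%nat)))).
{ unfold korovkin_weight.
  rewrite (bsum_ext _ _ (fun i => bsum (S n) (fun k => bsum (S n) (fun l =>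
    / (INR (n + 2) * INR (n + 3)) * a k * a l * chebT (abs_diff k l) x *
    (cos ((INR (k + q) - INR l) * korovkin_node n i)
     + cos ((INR k - INR (l + q)) * korovkin_node n i)))))).
  2:{ intros i _; rewrite <- bsum_scal_r; apply bsum_ext; intros k _.
      rewrite <- bsum_scal_r; apply bsum_ext; intros l _; fold a.
      rewrite (plus_INR k), (plus_INR l).
      replace ((INR k + INR q - INR l) * korovkin_node n i)
        with ((INR k - INR l) * korovkin_node n i + INR q * korovkin_node n i) by ring.
      replace ((INR k - (INR l + INR q)) * korovkin_node n i)
        with ((INR k - INR l) * korovkin_node n i - INR q * korovkin_node n i) by ring.
      rewrite cos_plus, cos_minus; field; auto. }
  rewrite bsum_swap; apply bsum_ext; intros k Hk.
  rewrite bsum_swap; apply bsum_ext; intros l Hl.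
  rewrite bsum_scal, bsum_plus, !Hsum by lia; field; auto. }
assert (E : bsum (S n) (fun k => bsum (S n) (fun l =>
    / INR (n + 2) * a k * a l * chebT (abs_diff k l) x * e (k + q)%nat l))
  = / INR (n + 2) * chebT q x * bsum (S n) (fun k => a k *
      if le_dec (k + q) n then a (k + q)%nat else 0)).
{ rewrite <- bsum_scal; apply bsum_ext; intros k Hk.
  destruct (le_dec (k + q) n) as [H|H].
  - rewrite (bsum_single _ (k + q)).
    + unfold e; destruct (Nat.eq_dec (k + q) (k + q)); [|congruence].
      replace (abs_diff k (k + q)) with q by (unfold abs_diff; lia); ring.
    + lia.
    + intros l _ Hl; unfold e; destruct (Nat.eq_dec (k + q) l); [lia|ring].
  - rewrite bsum_zero; [ring|].
    intros l Hl; unfold e; destruct (Nat.eq_dec (k + q) l); [lia|ring]. }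
rewrite (bsum_ext _ _ (fun k => bsum (S n) (fun l =>
    / INR (n + 2) * a k * a l * chebT (abs_diff k l) x * e (k + q)%nat l)
  + bsum (S n) (fun l =>
    / INR (n + 2) * a k * a l * chebT (abs_diff k l) x * e k (l + q)%nat))).
2:{ intros; rewrite <- bsum_plus; apply bsum_ext; intros; ring. }
rewrite bsum_plus, E, (bsum_swap (S n)).
rewrite (bsum_ext _ (fun j => bsum _ _) (fun k => bsum (S n) (fun l =>
    / INR (n + 2) * a k * a l * chebT (abs_diff k l) x * e (k + q)%nat l))).
- rewrite E; field; auto.
- intros l _; apply bsum_ext; intros k _.
  replace (abs_diff k l) with (abs_diff l k) by (unfold abs_diff; lia).
  unfold e; destruct (Nat.eq_dec k (l + q)), (Nat.eq_dec (l + q) k); try congruence; ring.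
Qed.

Lemma korovkin_angle (n : nat) : 0 < PI / INR (n + 2) /\ PI / INR (n + 2) <= 2 /\
  (PI / INR (n + 2)) ^ 2 <= 16 / INR (n + 2) ^ 2.
Proof.
assert (H2 : 2 <= INR (n + 2)) by (rewrite plus_INR, INR_2; assert (H := pos_INR n); lra).
assert (H := PI_RGT_0); assert (H4 := PI_4).
split; [apply Rdiv_lt_0_compat; lra|split].
- apply Rmult_le_reg_r with (INR (n + 2)); [lra|].
  unfold Rdiv; rewrite Rmult_assoc, Rinv_l by lra; lra.
- replace ((PI / INR (n + 2)) ^ 2) with (PI ^ 2 / INR (n + 2) ^ 2) by (field; lra).
  apply Rmult_le_compat_r; [apply Rlt_le, Rinv_0_lt_compat; nra|nra].
Qed.

(** With [a = PI / (n + 2)] the mean of the nodes' cosines is [x cos a]; this is where the choice of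
    coefficients pays, as [1 - cos a] is of order [1 / n ^ 2]. The constants come from [PI <= 4]. *)
Lemma korovkin_moments (n : nat) (x : R) : -1 <= x <= 1 ->
  bsum (n + 3) (fun i => korovkin_weight n i x) = 1 /\
  Rabs (bsum (n + 3) (fun i => korovkin_weight n i x * (cos (korovkin_node n i) - x)))
    <= 16 / INR (n + 2) ^ 2 /\
  bsum (n + 3) (fun i => korovkin_weight n i x * (cos (korovkin_node n i) - x) ^ 2)
    <= 32 / INR (n + 2) ^ 2.
Proof.
intros Hx.
assert (Hn2 : 2 <= INR (n + 2)) by (rewrite plus_INR, INR_2; assert (H := pos_INR n); lra).
set (a := PI / INR (n + 2)).
assert (Hc : forall q, bsum (S n) (fun k => korovkin_coef n k * korovkin_coef n (k + q))
  = INR (n + 2) / 2 * cos (INR q * a)) by (intros; apply korovkin_correlation).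
assert (E0 : bsum (n + 3) (fun i => korovkin_weight n i x) = 1).
{ rewrite (bsum_ext _ _ (fun i => korovkin_weight n i x * cos (INR 0 * korovkin_node n i)))
    by (intros; simpl; rewrite Rmult_0_l, cos_0; ring).
  rewrite korovkin_moment by lia.
  rewrite (bsum_ext _ _ (fun k => korovkin_coef n k * korovkin_coef n (k + 0))).
  - rewrite Hc; simpl; rewrite Rmult_0_l, cos_0; field; lra.
  - intros k Hk; destruct (le_dec (k + 0) n); [reflexivity|lia]. }
assert (E1 : bsum (n + 3) (fun i => korovkin_weight n i x * cos (korovkin_node n i))
  = cos a * x).
{ rewrite (bsum_ext _ _ (fun i => korovkin_weight n i x * cos (INR 1 * korovkin_node n i)))
    by (intros; simpl (INR 1); rewrite Rmult_1_l; ring).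
  rewrite korovkin_moment by lia.
  rewrite (bsum_ext _ _ (fun k => korovkin_coef n k * korovkin_coef n (k + 1))).
  - rewrite Hc; simpl; rewrite Rmult_1_l; field; lra.
  - intros k Hk; destruct (le_dec (k + 1) n); [reflexivity|].
    replace (k + 1)%nat with (S n) by lia; rewrite korovkin_coef_S; ring. }
assert (E2 : bsum (n + 3) (fun i => korovkin_weight n i x * cos (2 * korovkin_node n i))
  = (cos (2 * a) + 2 / INR (n + 2) * sin a ^ 2) * (2 * x ^ 2 - 1)).
{ rewrite (bsum_ext _ _ (fun i => korovkin_weight n i x * cos (INR 2 * korovkin_node n i)))
    by (intros; rewrite INR_2; ring).
  rewrite korovkin_moment by lia.
  (* The cut-off removes two products from the correlation: the one at [k = n - 1] is zero, and the
     one at [k = n] is minus the square of [sin a], which is compensated here. *)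
  rewrite (bsum_ext _ _ (fun k => korovkin_coef n k * korovkin_coef n (k + 2)
    + (if Nat.eq_dec k n then sin a ^ 2 else 0))).
  - assert (Es : bsum (S n) (fun k => if Nat.eq_dec k n then sin a ^ 2 else 0) = sin a ^ 2).
    { rewrite (bsum_single _ n).
      - destruct (Nat.eq_dec n n); [reflexivity|congruence].
      - lia.
      - intros k _ Hk; destruct (Nat.eq_dec k n); [congruence|reflexivity]. }
    rewrite bsum_plus, Hc, Es, INR_2.
    change (chebT 2 x) with (2 * x * x - 1); field; lra.
  - intros k Hk; destruct (le_dec (k + 2) n), (Nat.eq_dec k n) as [Ek|Ek]; try lia.
    + ring.
    + subst k; unfold korovkin_coef; fold a.
      replace (INR (S n) * a) with (PI - a).
      2:{ rewrite S_INR; unfold a; rewrite plus_INR, INR_2 in *; field; lra. }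
      replace (INR (S (n + 2)) * a) with (a + PI).
      2:{ rewrite S_INR; unfold a; field; lra. }
      rewrite sin_PI_x, neg_sin; ring.
    + replace (k + 2)%nat with (S n) by lia; rewrite korovkin_coef_S; ring. }
destruct (korovkin_angle n) as [Ha0 [Ha2 Ha]]; fold a in Ha0, Ha2, Ha.
assert (Hsin : 0 <= sin a <= a).
{ assert (HPI2 := PI2_1); split; [apply sin_ge_0; lra|apply Rlt_le, sin_lt_x; lra]. }
assert (Hcos : 0 <= 1 - cos a <= a ^ 2 / 2).
{ split; [assert (H := COS_bound a); lra|].
  assert (E : cos a = 1 - 2 * sin (a / 2) * sin (a / 2)).
  { rewrite <- cos_2a_sin; f_equal; field. }
  assert (0 <= sin (a / 2) <= a / 2).
  { assert (HPI2 := PI2_1); split; [apply sin_ge_0; lra|apply Rlt_le, sin_lt_x; lra]. }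
  rewrite E; nra. }
split; [exact E0|split].
- rewrite (bsum_ext _ _ (fun i => korovkin_weight n i x * cos (korovkin_node n i)
    + (- x) * korovkin_weight n i x)) by (intros; ring).
  rewrite bsum_plus, bsum_scal, E0, E1; apply Rabs_le; split; nra.
- rewrite (bsum_ext _ _ (fun i => / 2 * (korovkin_weight n i x * cos (2 * korovkin_node n i))
    + ((- 2 * x) * (korovkin_weight n i x * cos (korovkin_node n i))
    + (/ 2 + x ^ 2) * korovkin_weight n i x))).
  2:{ intros; rewrite cos_2a_cos; field. }
  rewrite !bsum_plus, !bsum_scal, E0, E1, E2, cos_2a_sin.
  set (r := 2 / INR (n + 2)).
  assert (Hr : 0 < r <= 1).
  { unfold r; split; [apply Rdiv_lt_0_compat; lra|].
    apply Rmult_le_reg_r with (INR (n + 2)); [lra|].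
    unfold Rdiv; rewrite Rmult_assoc, Rinv_l by lra; lra. }
  assert (Hx2 : 0 <= x ^ 2 <= 1) by nra.
  assert (Hs2 : 0 <= sin a ^ 2 <= a ^ 2) by nra.
  replace (32 / INR (n + 2) ^ 2) with (2 * (16 / INR (n + 2) ^ 2)) by (field; lra).
  apply Rle_trans with (2 * a ^ 2); [|lra].
  replace (/ 2 * ((1 - 2 * sin a * sin a + r * sin a ^ 2) * (2 * x ^ 2 - 1)) + _)
    with ((2 - r) / 2 * sin a ^ 2 * (1 - 2 * x ^ 2) + 2 * x ^ 2 * (1 - cos a)) by field.
  assert (0 <= (2 - r) / 2 * sin a ^ 2 <= a ^ 2) by nra.
  assert (2 * x ^ 2 * (1 - cos a) <= a ^ 2) by nra.
  nra.
Qed.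

Lemma korovkin_mean_bound (n : nat) (x b : R) (h : nat -> R) : -1 <= x <= 1 ->
  (forall i, Rabs (h i) <= b) ->
  Rabs (bsum (n + 3) (fun i => korovkin_weight n i x * h i)) <= b.
Proof.
intros Hx H; destruct (korovkin_moments n x Hx) as [E _].
eapply Rle_trans; [apply bsum_abs|].
rewrite <- (Rmult_1_l b), <- E, <- bsum_scal_r.
apply bsum_le; intros i _; rewrite Rabs_mult.
assert (Hw := korovkin_weight_ge0 n i x Hx).
rewrite (Rabs_right (korovkin_weight n i x)) by lra.
now apply Rmult_le_compat_l.
Qed.

(** The weights have sum 1, so the constant part of the expansion at [x] is exact. The slope meets
    the first centred moment, and the remainder is bounded by the second because the weights are
    nonnegative. *)
Lemma korovkin_error (n : nat) (g : R -> R) (x d K D : R) : -1 <= x <= 1 -> 0 <= K ->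
  Rabs d <= D ->
  (forall y, -1 <= y <= 1 -> Rabs (g y - g x - d * (y - x)) <= K * (y - x) ^ 2) ->
  Rabs (bsum (n + 3) (fun i => korovkin_weight n i x * g (cos (korovkin_node n i))) - g x)
  <= (16 * D + 32 * K) / INR (n + 2) ^ 2.
Proof.
intros Hx HK Hd H.
destruct (korovkin_moments n x Hx) as [E0 [E1 E2]].
set (w := fun i => korovkin_weight n i x) in *.
set (y := fun i => cos (korovkin_node n i)).
set (r := fun i => g (y i) - g x - d * (y i - x)).
replace (bsum _ _ - g x)
  with (d * bsum (n + 3) (fun i => w i * (y i - x)) + bsum (n + 3) (fun i => w i * r i)).
2:{ transitivity (bsum (n + 3) (fun i => w i * g (y i)) - g x * bsum (n + 3) w);
      [|rewrite E0; unfold w, y; ring].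
    replace (bsum (n + 3) (fun i => w i * g (y i)) - g x * bsum (n + 3) w)
      with (bsum (n + 3) (fun i => w i * g (y i)) + (- g x) * bsum (n + 3) w) by ring.
    rewrite <- !bsum_scal, <- !bsum_plus; apply bsum_ext; intros; unfold r; ring. }
assert (H1 : Rabs (d * bsum (n + 3) (fun i => w i * (y i - x)))
  <= D * (16 / INR (n + 2) ^ 2)).
{ rewrite Rabs_mult; apply Rmult_le_compat; auto using Rabs_pos. }
assert (H2 : Rabs (bsum (n + 3) (fun i => w i * r i)) <= K * (32 / INR (n + 2) ^ 2)).
{ eapply Rle_trans; [apply bsum_abs|].
  apply Rle_trans with (K * bsum (n + 3) (fun i => w i * (y i - x) ^ 2));
    [|now apply Rmult_le_compat_l].
  rewrite <- bsum_scal; apply bsum_le; intros i _; rewrite Rabs_mult.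
  assert (Hw := korovkin_weight_ge0 n i x Hx); fold (w i) in Hw.
  rewrite (Rabs_right (w i)) by lra.
  replace (K * (w i * (y i - x) ^ 2)) with (w i * (K * (y i - x) ^ 2)) by ring.
  apply Rmult_le_compat_l; [exact Hw|]; apply H, COS_bound. }
eapply Rle_trans; [apply Rabs_triang|].
replace ((16 * D + 32 * K) / INR (n + 2) ^ 2)
  with (D * (16 / INR (n + 2) ^ 2) + K * (32 / INR (n + 2) ^ 2)) by (unfold Rdiv; ring).
lra.
Qed.

(** * Tensor product approximation on the cube *)

Definition cube (p : R * R * R) : Prop :=
  -1 <= fst (fst p) <= 1 /\ -1 <= snd (fst p) <= 1 /\ -1 <= snd p <= 1.

(** A form of [C^{1,1}] regularity along the axes, up to the boundary of the cube, as
    [korovkin_error] consumes it in each variable. *)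
Definition coordinate_jets (F : R * R * R -> R) (K D : R) : Prop :=
  forall p i, cube p -> exists d, Rabs d <= D /\
  forall h, cube (shift i h p) -> Rabs (F (shift i h p) - F p - d * h) <= K * h ^ 2.

(** The variables are discretized one at a time. Weighted means with nonnegative weights of sum 1 do
    not enlarge an error, so the total is three times the one-variable error with constants 16 and
    32. *)
Lemma polynomial_approximation (F : R * R * R -> R) (K D : R) (n : nat) :
  0 <= K -> coordinate_jets F K D -> exists P : R * R * R -> R,
  (forall m p, (1 <= m)%nat -> (3 * n < 2 * m)%nat -> disk (fst p) -> reproduced m p P) /\
  forall p, cube p -> Rabs (P p - F p) <= (48 * D + 96 * K) / INR (n + 2) ^ 2.
Proof.
intros HK HF.
set (w := korovkin_weight n); set (y := fun i => cos (korovkin_node n i)).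
assert (Hy : forall i, -1 <= y i <= 1) by (intros; apply COS_bound).
exists (fun p => bsum (n + 3) (fun i => bsum (n + 3) (fun j => bsum (n + 3) (fun k =>
  w i (fst (fst p)) * (w j (snd (fst p)) * (w k (snd p) * F (y i, y j, y k))))))).
split.
- intros m p Hm Hn Hp.
  assert (HV := reproduced_subspace m p Hm); assert (HV' := HV); destruct HV' as [_ Hext].
  replace (n + 3)%nat with (S (n + 2)) by lia.
  apply (Hext (fun p => bsum (S (n + 2)) (fun i => 1 * bsum (S (n + 2)) (fun j =>
    1 * bsum (S (n + 2)) (fun k => F (y i, y j, y k)
      * (w i (fst (fst p)) * w j (snd (fst p)) * w k (snd p))))))).
  + intros q; apply bsum_ext; intros i _; rewrite Rmult_1_l.
    apply bsum_ext; intros j _; rewrite Rmult_1_l.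
    apply bsum_ext; intros k _; ring.
  + apply (subspace_bsum _ (n + 2) (fun _ => 1)); [exact HV|]; intros i _.
    apply (subspace_bsum _ (n + 2) (fun _ => 1)); [exact HV|]; intros j _.
    apply (subspace_bsum _ (n + 2) (fun k => F (y i, y j, y k))
      (fun k p => w i (fst (fst p)) * w j (snd (fst p)) * w k (snd p)));
      [exact HV|]; intros k _.
    apply reproduced_cheb_poly with n; auto; apply cheb_poly_korovkin.
- intros [[x1 x2] x3] [H1 [H2 H3]]; cbn [fst snd] in *.
  set (e := (16 * D + 32 * K) / INR (n + 2) ^ 2).
  assert (Hx : forall a b c, -1 <= a <= 1 -> -1 <= b <= 1 -> -1 <= c <= 1 ->
    Rabs (bsum (n + 3) (fun i => w i a * F (y i, b, c)) - F (a, b, c)) <= e).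
  { intros a b c Ha Hb Hc.
    destruct (HF (a, b, c) axis_x) as [d [Hd HFd]]; [now split; [|split]|].
    apply (korovkin_error n (fun t => F (t, b, c)) a d K D); auto.
    intros t Ht; assert (H := HFd (t - a)); cbn in H.
    replace (a + (t - a)) with t in H by ring.
    apply H; now split; [|split]. }
  assert (Hyy : forall a b c, -1 <= a <= 1 -> -1 <= b <= 1 -> -1 <= c <= 1 ->
    Rabs (bsum (n + 3) (fun i => w i b * F (a, y i, c)) - F (a, b, c)) <= e).
  { intros a b c Ha Hb Hc.
    destruct (HF (a, b, c) axis_y) as [d [Hd HFd]]; [now split; [|split]|].
    apply (korovkin_error n (fun t => F (a, t, c)) b d K D); auto.
    intros t Ht; assert (H := HFd (t - b)); cbn in H.
    replace (b + (t - b)) with t in H by ring.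
    apply H; now split; [|split]. }
  assert (Hz : forall a b c, -1 <= a <= 1 -> -1 <= b <= 1 -> -1 <= c <= 1 ->
    Rabs (bsum (n + 3) (fun i => w i c * F (a, b, y i)) - F (a, b, c)) <= e).
  { intros a b c Ha Hb Hc.
    destruct (HF (a, b, c) axis_z) as [d [Hd HFd]]; [now split; [|split]|].
    apply (korovkin_error n (fun t => F (a, b, t)) c d K D); auto.
    intros t Ht; assert (H := HFd (t - c)); cbn in H.
    replace (c + (t - c)) with t in H by ring.
    apply H; now split; [|split]. }
  set (A := fun i j => bsum (n + 3) (fun k => w k x3 * F (y i, y j, y k))).
  set (B := fun i => bsum (n + 3) (fun j => w j x2 * F (y i, y j, x3))).
  set (G := bsum (n + 3) (fun i => w i x1 * F (y i, x2, x3))).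
  replace (bsum (n + 3) _ - F (x1, x2, x3)) with
    (bsum (n + 3) (fun i => w i x1 * bsum (n + 3) (fun j => w j x2
        * (A i j - F (y i, y j, x3))))
     + bsum (n + 3) (fun i => w i x1 * (B i - F (y i, x2, x3)))
     + (G - F (x1, x2, x3))).
  2:{ unfold G; unfold Rminus at 3; rewrite <- Rplus_assoc; unfold Rminus at 3.
      f_equal; rewrite <- !bsum_plus; apply bsum_ext; intros i _.
      rewrite (bsum_ext (n + 3) (fun j => bsum _ _) (fun j => w i x1 * (w j x2 * A i j))).
      2:{ intros j _; unfold A; now rewrite <- !bsum_scal. }
      rewrite bsum_scal.
      rewrite (bsum_ext _ (fun j => w j x2 * (A i j - _))
        (fun j => w j x2 * A i j + (-1) * (w j x2 * F (y i, y j, x3)))) by (intros; ring).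
      rewrite bsum_plus, bsum_scal; unfold B; ring. }
  assert (HA : Rabs (bsum (n + 3) (fun i => w i x1 * bsum (n + 3) (fun j => w j x2
        * (A i j - F (y i, y j, x3))))) <= e).
  { apply korovkin_mean_bound; [exact H1|]; intros i.
    apply korovkin_mean_bound; [exact H2|]; intros j.
    now apply Hz. }
  assert (HB : Rabs (bsum (n + 3) (fun i => w i x1 * (B i - F (y i, x2, x3)))) <= e).
  { apply korovkin_mean_bound; [exact H1|]; intros i; now apply Hyy. }
  assert (HG := Hx x1 x2 x3 H1 H2 H3); fold G in HG.
  eapply Rle_trans; [apply Rabs_triang|].
  eapply Rle_trans; [apply Rplus_le_compat_r, Rabs_triang|].
  replace ((48 * D + 96 * K) / INR (n + 2) ^ 2) with (e + e + e)
    by (unfold e, Rdiv; ring).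
  lra.
Qed.

(** * Taylor estimates on the cylinder *)

Definition inside (p : R * R * R) : Prop :=
  fst (fst p) ^ 2 + snd (fst p) ^ 2 < 1 /\ -1 < snd p < 1.

Definition dist1 (p q : R * R * R) : R :=
  Rabs (fst (fst q) - fst (fst p)) + Rabs (snd (fst q) - snd (fst p))
  + Rabs (snd q - snd p).

Lemma locally_prod3 (x y z : R) (P : R * R * R -> Prop) :
  locally ((x, y, z) : R * R * R) P <->
  exists d : posreal, forall x' y' z' : R,
    Rabs (x' - x) < d -> Rabs (y' - y) < d -> Rabs (z' - z) < d -> P (x', y', z').
Proof.
split; intros [d Hd]; exists d.
- intros x' y' z' Hx Hy Hz; apply Hd; now repeat split.
- intros [[x' y'] z'] [[Hx Hy] Hz]; now apply Hd.
Qed.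

Lemma inside_locally (p : R * R * R) : inside p -> locally p cylinder.
Proof.
destruct p as [[x y] z]; intros [Hs Hz]; cbn [fst snd] in Hs, Hz.
(* As [|x|] and [|y|] are below 1, a move by [d <= 1] raises each square by at most [3 d]; two
   squares account for the 6. *)
set (d := Rmin ((1 - (x ^ 2 + y ^ 2)) / 6) (Rmin (1 - z) (1 + z))).
assert (Hd : 0 < d) by (unfold d; repeat apply Rmin_glb_lt; lra).
assert (Hd1 : d <= (1 - (x ^ 2 + y ^ 2)) / 6) by apply Rmin_l.
assert (Hd2 : d <= 1 - z) by (eapply Rle_trans; [apply Rmin_r|apply Rmin_l]).
assert (Hd3 : d <= 1 + z) by (eapply Rle_trans; [apply Rmin_r|apply Rmin_r]).
apply locally_prod3; exists (mkposreal d Hd); simpl pos; intros x' y' z' Hx Hy Hz'.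
apply Rabs_lt_between in Hx, Hy, Hz'.
assert (-1 < x < 1 /\ -1 < y < 1) by (split; split; nra).
split; [unfold disk; cbn [fst snd]|cbn [fst snd]; lra].
assert (x' ^ 2 <= x ^ 2 + 3 * d) by nra.
assert (y' ^ 2 <= y ^ 2 + 3 * d) by nra.
lra.
Qed.

Lemma inside_cylinder (p : R * R * R) : inside p -> cylinder p.
Proof. intros [H1 H2]; split; [unfold disk|]; lra. Qed.

Lemma list_bound (A : Type) (B : A -> R) (l : list A) :
  exists M, forall t, In t l -> B t <= M.
Proof.
induction l as [|a l [M IH]]; [exists 0; intros t []|].
exists (Rmax (B a) M); intros t [<-|Ht]; [apply Rmax_l|].
eapply Rle_trans; [now apply IH|apply Rmax_r].
Qed.

(** Compactness is taken from the surrounding box. A point of the box outside the cylinder receives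
    a radius so small that no point of the cylinder is near, which makes its bound vacuous. *)
Lemma continuous_on_cylinder_bounded (g : R * R * R -> R) : continuous_on cylinder g ->
  exists M, forall p, cylinder p -> Rabs (g p) <= M.
Proof.
intros Hg.
assert (Hloc : forall t : Tn 3 R, exists dB : posreal * R,
  forall p, cylinder p -> close_n 3 (fst dB) (fst (fst p), (snd (fst p), (snd p, tt))) t ->
    bounded_n 3 (-1, (-1, (-1, tt))) (1, (1, (1, tt))) t -> Rabs (g p) <= snd dB).
{ intros [x [y [z []]]].
  destruct (classic (bounded_n 3 (-1, (-1, (-1, tt))) (1, (1, (1, tt))) (x, (y, (z, tt)))))
    as [Hbd|Hbd]; [|exists (mkposreal 1 Rlt_0_1, 0); intros; contradiction].
  destruct Hbd as [Hx [Hy [Hz _]]].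
  destruct (Rle_lt_dec (x ^ 2 + y ^ 2) 1) as [Hs|Hs].
  - assert (Hp : cylinder (x, y, z)) by (split; [exact Hs|exact Hz]).
    destruct (proj1 (locally_prod3 x y z _)
      (proj1 (filterlim_locally _ _) (Hg _ Hp) (mkposreal 1 Rlt_0_1))) as [d Hd].
    exists (d, Rabs (g (x, y, z)) + 1); intros [[x' y'] z'] Hp' [Hx' [Hy' [Hz' _]]] _.
    cbn [fst snd] in *.
    specialize (Hd x' y' z'); rewrite (Rabs_minus_sym x'), (Rabs_minus_sym y'),
      (Rabs_minus_sym z') in *.
    specialize (Hd Hx' Hy' Hz' Hp'); change (Rabs (g (x', y', z') - g (x, y, z)) < 1) in Hd.
    assert (H3 := Rabs_triang_inv (g (x', y', z')) (g (x, y, z))); lra.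
  (* Each square drops by at most [2 d], so a nearby point still has
     [x' ^ 2 + y' ^ 2 >= 1 + 5 d - 4 d > 1]. *)
  - set (d := (x ^ 2 + y ^ 2 - 1) / 5).
    assert (Hd : 0 < d) by (unfold d; lra).
    exists (mkposreal d Hd, 0); intros [[x' y'] z'] [Hp' _] [Hx' [Hy' _]] _; exfalso.
    unfold disk in Hp'; cbn [fst snd pos] in *.
    apply Rabs_lt_between in Hx', Hy'.
    assert (Hsq : forall a b, -1 <= a <= 1 -> - d < b - a < d -> a ^ 2 - 2 * d <= b ^ 2).
    { intros a b Ha Hb; set (e := b - a) in *; replace b with (a + e) by (unfold e; ring).
      assert (0 <= (1 - a) * (d - e)) by (apply Rmult_le_pos; lra).
      assert (0 <= (1 + a) * (d + e)) by (apply Rmult_le_pos; lra).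
      assert (0 <= e ^ 2) by apply pow2_ge_0; lra. }
    assert (H1 := Hsq x x' Hx Hx'); assert (H2 := Hsq y y' Hy Hy').
    unfold d in *; lra. }
set (dB := fun t => proj1_sig (constructive_indefinite_description _ (Hloc t))).
assert (HdB : forall t p, cylinder p ->
  close_n 3 (fst (dB t)) (fst (fst p), (snd (fst p), (snd p, tt))) t ->
  bounded_n 3 (-1, (-1, (-1, tt))) (1, (1, (1, tt))) t -> Rabs (g p) <= snd (dB t)).
{ intros t; exact (proj2_sig (constructive_indefinite_description _ (Hloc t))). }
destruct (NNPP _ (compactness_list 3 (-1, (-1, (-1, tt))) (1, (1, (1, tt)))
  (fun t => fst (dB t)))) as [l Hl].
destruct (list_bound _ (fun t => snd (dB t)) l) as [M HM].
exists M; intros [[x y] z] Hp.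
destruct (Hl (x, (y, (z, tt)))) as [t [Hin [Ht Hc]]].
- destruct Hp as [Hd Hz]; unfold disk in Hd; cbn [fst snd] in *.
  repeat split; try lra; nra.
- eapply Rle_trans; [apply (HdB t); auto|now apply HM].
Qed.

Lemma shift_shift (i : axis) (h e : R) (p : R * R * R) :
  shift i e (shift i h p) = shift i (h + e) p.
Proof. destruct p as [[x y] z], i; simpl; rewrite Rplus_assoc; reflexivity. Qed.

Lemma shift_0 (i : axis) (p : R * R * R) : shift i 0 p = p.
Proof. destruct p as [[x y] z], i; simpl; rewrite Rplus_0_r; reflexivity. Qed.

Lemma mean_value_axis (i : axis) (f g : R * R * R -> R) (p : R * R * R) (h : R) :
  (forall q, locally q cylinder -> is_partial i f q (g q)) ->
  (forall c, Rmin 0 h <= c <= Rmax 0 h -> inside (shift i c p)) ->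
  exists c, Rmin 0 h <= c <= Rmax 0 h /\
    f (shift i h p) - f p = g (shift i c p) * h.
Proof.
intros Hg Hin.
assert (Hd : forall c, Rmin 0 h <= c <= Rmax 0 h ->
  is_derive (fun t => f (shift i t p)) c (g (shift i c p))).
{ intros c Hc; assert (H := Hg _ (inside_locally _ (Hin c Hc))); unfold is_partial in H.
  (* [is_partial] is a derivative at step 0, so the line is re-based at [shift i c p]. *)
  apply (is_derive_ext (fun t => f (shift i (t - c) (shift i c p)))).
  { intros t; rewrite shift_shift; do 2 f_equal; ring. }
  rewrite <- (Rmult_1_l (g _)).
  apply (is_derive_comp (fun e => f (shift i e (shift i c p))) (fun t => t - c)).
  - replace (c - c) with 0 by ring; exact H.
  - auto_derive; [exact I|ring]. }
destruct (MVT_gen (fun t => f (shift i t p)) 0 h (fun c => g (shift i c p))) as [c [Hc E]].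
- intros c Hc; apply Hd; lra.
- intros c Hc; apply continuity_pt_filterlim.
  apply (ex_derive_continuous (fun t => f (shift i t p))); eexists; now apply Hd.
- exists c; split; [exact Hc|].
  rewrite shift_0, Rminus_0_r in E; exact E.
Qed.

Lemma between_sqr (x x' c : R) : Rmin 0 (x' - x) <= c <= Rmax 0 (x' - x) ->
  (x + c) ^ 2 <= Rmax (x ^ 2) (x' ^ 2) /\ Rabs (x + c - x) <= Rabs (x' - x) /\
  Rmin x x' <= x + c <= Rmax x x'.
Proof.
intros Hc; replace (x + c - x) with c by ring.
destruct (Rle_lt_dec 0 (x' - x)) as [H|H].
- rewrite Rmin_left, Rmax_right in Hc by lra.
  rewrite (Rmin_left x), (Rmax_right x), !Rabs_right by lra.
  split; [|lra].
  destruct (Rle_lt_dec 0 (x + c)) as [H0|H0];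
    [eapply Rle_trans; [|apply Rmax_r]|eapply Rle_trans; [|apply Rmax_l]]; nra.
- rewrite Rmin_right, Rmax_left in Hc by lra.
  rewrite (Rmin_right x), (Rmax_left x) by lra.
  rewrite !Rabs_left1 by lra.
  split; [|lra].
  destruct (Rle_lt_dec 0 (x + c)) as [H0|H0];
    [eapply Rle_trans; [|apply Rmax_l]|eapply Rle_trans; [|apply Rmax_r]]; nra.
Qed.

(* At least one of the two corners of the rectangle spanned by two points of
   the disk lies in the disk, so that the two points are joined inside the
   disk by two segments parallel to the axes. *)
Lemma increment_inside (f gx gy gz : R * R * R -> R) (p q : R * R * R) :
  (forall r, locally r cylinder -> is_partial axis_x f r (gx r)) ->
  (forall r, locally r cylinder -> is_partial axis_y f r (gy r)) ->
  (forall r, locally r cylinder -> is_partial axis_z f r (gz r)) ->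
  inside p -> inside q -> exists rx ry rz,
  (inside rx /\ inside ry /\ inside rz) /\
  (dist1 p rx <= dist1 p q /\ dist1 p ry <= dist1 p q /\ dist1 p rz <= dist1 p q) /\
  f q - f p = gx rx * (fst (fst q) - fst (fst p)) + gy ry * (snd (fst q) - snd (fst p))
    + gz rz * (snd q - snd p).
Proof.
intros Hx Hy Hz; destruct p as [[x y] z], q as [[x' y'] z'].
intros [Hp Hpz] [Hq Hqz]; cbn [fst snd] in *.
assert (Rx := Rabs_pos (x' - x)); assert (Ry := Rabs_pos (y' - y)).
assert (Rz := Rabs_pos (z' - z)).
assert (Hsx : forall c, Rmin 0 (x' - x) <= c <= Rmax 0 (x' - x) -> forall v w,
  x ^ 2 + v ^ 2 < 1 -> x' ^ 2 + v ^ 2 < 1 -> -1 < w < 1 -> inside (x + c, v, w)).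
{ intros c Hc v w H1 H2 Hw; destruct (between_sqr x x' c Hc) as [H _].
  split; cbn [fst snd]; [|exact Hw]; revert H; apply Rmax_case; lra. }
assert (Hsy : forall c, Rmin 0 (y' - y) <= c <= Rmax 0 (y' - y) -> forall u w,
  u ^ 2 + y ^ 2 < 1 -> u ^ 2 + y' ^ 2 < 1 -> -1 < w < 1 -> inside (u, y + c, w)).
{ intros c Hc v w H1 H2 Hw; destruct (between_sqr y y' c Hc) as [H _].
  split; cbn [fst snd]; [|exact Hw]; revert H; apply Rmax_case; lra. }
assert (Hsz : forall c, Rmin 0 (z' - z) <= c <= Rmax 0 (z' - z) -> inside (x, y, z + c)).
{ intros c Hc; destruct (between_sqr z z' c Hc) as [_ [_ [H1 H2]]].
  split; cbn [fst snd]; [exact Hp|].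
  revert H1 H2; apply Rmin_case; apply Rmax_case; lra. }
destruct (mean_value_axis axis_z f gz (x, y, z) (z' - z) Hz) as [c3 [Hc3 E3]].
{ intros c Hc; now apply Hsz. }
cbn [shift] in E3; replace (z + (z' - z)) with z' in E3 by ring.
assert (D3 := proj1 (proj2 (between_sqr z z' c3 Hc3))).
(* The squared norms of the two corners have the same sum as those of the two given points, which is
   below 2. If one corner is not in the open disk, the other is. *)
destruct (Rle_lt_dec 1 (x' ^ 2 + y ^ 2)) as [Hcor|Hcor].
- assert (Hcor' : x ^ 2 + y' ^ 2 < 1) by lra.
  destruct (mean_value_axis axis_y f gy (x, y, z') (y' - y) Hy) as [c2 [Hc2 E2]].
  { intros c Hc; now apply Hsy. }
  destruct (mean_value_axis axis_x f gx (x, y', z') (x' - x) Hx) as [c1 [Hc1 E1]].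
  { intros c Hc; now apply Hsx. }
  cbn [shift] in E1, E2.
  replace (x + (x' - x)) with x' in E1 by ring; replace (y + (y' - y)) with y' in E2 by ring.
  assert (D1 := proj1 (proj2 (between_sqr x x' c1 Hc1))).
  assert (D2 := proj1 (proj2 (between_sqr y y' c2 Hc2))).
  exists (x + c1, y', z'), (x, y + c2, z'), (x, y, z + c3); split; [auto|split].
  + unfold dist1; cbn [fst snd]; rewrite !Rminus_diag, Rabs_R0; lra.
  + rewrite <- E1, <- E2, <- E3; ring.
- destruct (mean_value_axis axis_x f gx (x, y, z') (x' - x) Hx) as [c1 [Hc1 E1]].
  { intros c Hc; now apply Hsx. }
  destruct (mean_value_axis axis_y f gy (x', y, z') (y' - y) Hy) as [c2 [Hc2 E2]].
  { intros c Hc; now apply Hsy. }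
  cbn [shift] in E1, E2.
  replace (x + (x' - x)) with x' in E1 by ring; replace (y + (y' - y)) with y' in E2 by ring.
  assert (D1 := proj1 (proj2 (between_sqr x x' c1 Hc1))).
  assert (D2 := proj1 (proj2 (between_sqr y y' c2 Hc2))).
  exists (x + c1, y, z'), (x', y + c2, z'), (x, y, z + c3); split; [auto|split].
  + unfold dist1; cbn [fst snd]; rewrite !Rminus_diag, Rabs_R0; lra.
  + rewrite <- E1, <- E2, <- E3; ring.
Qed.

(** Partial derivatives live in the interior. Pulling points towards the centre by a ratio below 1
    that tends to 1 transfers interior estimates to the closed cylinder by continuity. *)
Definition contract (n : nat) (p : R * R * R) : R * R * R :=
  let r := 1 - / INR (n + 2) in (r * fst (fst p), r * snd (fst p), r * snd p).

Lemma contract_ratio (n : nat) : 0 < 1 - / INR (n + 2) < 1.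
Proof.
assert (H : 1 < INR (n + 2)) by (rewrite plus_INR, INR_2; assert (H := pos_INR n); lra).
assert (0 < / INR (n + 2)) by (apply Rinv_0_lt_compat; lra).
assert (/ INR (n + 2) < 1) by (rewrite <- Rinv_1; apply Rinv_lt_contravar; lra).
lra.
Qed.

Lemma contract_inside (n : nat) (p : R * R * R) : cylinder p -> inside (contract n p).
Proof.
destruct p as [[x y] z]; intros [Hd Hz]; unfold disk in Hd; cbn [fst snd] in *.
assert (Hr := contract_ratio n); unfold inside, contract; cbn [fst snd].
set (r := 1 - / INR (n + 2)) in *.
split; [|nra].
replace ((r * x) ^ 2 + (r * y) ^ 2) with (r ^ 2 * (x ^ 2 + y ^ 2)) by ring.
assert (0 <= x ^ 2 + y ^ 2) by nra; assert (r ^ 2 < 1) by nra; nra.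
Qed.

Lemma is_lim_seq_contract_ratio : is_lim_seq (fun n => 1 - / INR (n + 2)) 1.
Proof.
replace (Finite 1) with (Finite (1 - 0)) by (f_equal; ring).
apply is_lim_seq_minus'; [apply is_lim_seq_const|].
apply (is_lim_seq_incr_n (fun n => / INR n) 2).
replace (Finite 0) with (Rbar_inv p_infty) by reflexivity.
apply is_lim_seq_inv; [apply is_lim_seq_INR|discriminate].
Qed.

Lemma contract_cvg (f : R * R * R -> R) (p : R * R * R) :
  continuous_on cylinder f -> cylinder p ->
  is_lim_seq (fun n => f (contract n p)) (f p).
Proof.
intros Hf Hp.
apply (filterlim_comp _ _ _ (fun n => contract n p) f _ (within cylinder (locally p))).
- intros P HP; destruct p as [[x y] z].
  destruct (proj1 (locally_prod3 x y z _) HP) as [d Hd].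
  destruct (proj1 (is_lim_seq_Reals _ _) is_lim_seq_contract_ratio d (cond_pos d)) as [N HN].
  exists N; intros n Hn; specialize (HN n Hn).
  assert (Hin := inside_cylinder _ (contract_inside n _ Hp)).
  destruct Hp as [Hq Hz]; unfold disk in Hq; unfold contract in *; cbn [fst snd] in *.
  set (r := 1 - / INR (n + 2)) in *.
  assert (Hm : forall t, -1 <= t <= 1 -> Rabs (r * t - t) < d).
  { intros t Ht; replace (r * t - t) with ((r - 1) * t) by ring.
    rewrite Rabs_mult; apply Rle_lt_trans with (2 := HN); unfold Rdist.
    rewrite <- (Rmult_1_r (Rabs (r - 1))) at 2.
    apply Rmult_le_compat_l; [apply Rabs_pos|now apply Rabs_le]. }
  apply Hd; [| | |exact Hin]; apply Hm; try lra; nra.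
- apply Hf; exact Hp.
Qed.

Lemma dist1_contract (n : nat) (p q : R * R * R) :
  dist1 (contract n p) (contract n q) <= dist1 p q.
Proof.
assert (Hr := contract_ratio n); unfold dist1, contract; cbn [fst snd].
set (r := 1 - / INR (n + 2)) in *.
rewrite <- !Rmult_minus_distr_l, !Rabs_mult, Rabs_right by lra.
assert (H1 := Rabs_pos (fst (fst q) - fst (fst p))).
assert (H2 := Rabs_pos (snd (fst q) - snd (fst p))).
assert (H3 := Rabs_pos (snd q - snd p)); nra.
Qed.

Lemma dist1_pos (p q : R * R * R) : 0 <= dist1 p q.
Proof. unfold dist1; repeat apply Rplus_le_le_0_compat; apply Rabs_pos. Qed.

Lemma Rabs_lin3_bound (a b c x y z M : R) :
  Rabs a <= M -> Rabs b <= M -> Rabs c <= M ->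
  Rabs (a * x + b * y + c * z) <= M * (Rabs x + Rabs y + Rabs z).
Proof.
intros Ha Hb Hc.
eapply Rle_trans; [apply Rabs_triang|].
eapply Rle_trans; [apply Rplus_le_compat_r, Rabs_triang|].
rewrite !Rabs_mult.
assert (H1 := Rabs_pos x); assert (H2 := Rabs_pos y); assert (H3 := Rabs_pos z); nra.
Qed.

Lemma C1_lipschitz (f : R * R * R -> R) : Ck_on 1 cylinder f ->
  exists M, forall p q, cylinder p -> cylinder q -> Rabs (f q - f p) <= M * dist1 p q.
Proof.
intros [Hc Hg].
destruct (Hg axis_x) as [gx [[Cx _] Px]]; destruct (Hg axis_y) as [gy [[Cy _] Py]].
destruct (Hg axis_z) as [gz [[Cz _] Pz]].
destruct (continuous_on_cylinder_bounded gx Cx) as [Mx HMx].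
destruct (continuous_on_cylinder_bounded gy Cy) as [My HMy].
destruct (continuous_on_cylinder_bounded gz Cz) as [Mz HMz].
set (M := Rmax Mx (Rmax My Mz)).
assert (H1 : Mx <= M) by apply Rmax_l.
assert (H2 : My <= M) by (eapply Rle_trans; [apply Rmax_l|apply Rmax_r]).
assert (H3 : Mz <= M) by (eapply Rle_trans; [apply Rmax_r|apply Rmax_r]).
assert (Hin : forall p q, inside p -> inside q -> Rabs (f q - f p) <= M * dist1 p q).
{ intros p q Hp Hq.
  destruct (increment_inside f gx gy gz p q Px Py Pz Hp Hq)
    as [rx [ry [rz [[Ix [Iy Iz]] [_ ->]]]]].
  apply Rabs_lin3_bound.
  - apply Rle_trans with (2 := H1), HMx; now apply inside_cylinder.
  - apply Rle_trans with (2 := H2), HMy; now apply inside_cylinder.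
  - apply Rle_trans with (2 := H3), HMz; now apply inside_cylinder. }
assert (HM0 : 0 <= M).
{ eapply Rle_trans; [apply Rabs_pos|eapply Rle_trans; [apply (HMx (0, 0, 0))|exact H1]].
  split; [unfold disk|]; simpl; lra. }
exists M; intros p q Hp Hq.
apply (is_lim_seq_le (fun n => Rabs (f (contract n q) - f (contract n p)))
  (fun _ => M * dist1 p q)
  (Finite (Rabs (f q - f p))) (Finite (M * dist1 p q))).
- intros n; eapply Rle_trans; [apply Hin; now apply contract_inside|].
  apply Rmult_le_compat_l; [exact HM0|apply dist1_contract].
- apply (is_lim_seq_abs _ (Finite (f q - f p))).
  apply is_lim_seq_minus'; now apply contract_cvg.
- apply is_lim_seq_const.
Qed.

(** A Whitney jet of class [C^{1,1}]. Unlike partial derivatives it makes sense at boundary points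
    of the cylinder, which the reflection reaches. *)
Definition first_order_jet (f gx gy gz : R * R * R -> R) (M : R) : Prop :=
  (forall p, cylinder p -> Rabs (gx p) <= M /\ Rabs (gy p) <= M /\ Rabs (gz p) <= M) /\
  (forall p q, cylinder p -> cylinder q -> Rabs (gx q - gx p) <= M * dist1 p q /\
    Rabs (gy q - gy p) <= M * dist1 p q /\ Rabs (gz q - gz p) <= M * dist1 p q) /\
  forall p q, cylinder p -> cylinder q ->
    Rabs (f q - f p - (gx p * (fst (fst q) - fst (fst p))
      + gy p * (snd (fst q) - snd (fst p)) + gz p * (snd q - snd p)))
    <= M * dist1 p q ^ 2.

(** In the interior an increment of [f] involves the gradient at intermediate points within
    [dist1 p q] of [p]; the Lipschitz bound on the gradient makes the remainder quadratic. *)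
Lemma C2_first_order_jet (f : R * R * R -> R) : Ck_on 2 cylinder f ->
  exists gx gy gz M, first_order_jet f gx gy gz M.
Proof.
intros [Hc Hg].
destruct (Hg axis_x) as [gx [Cx Px]]; destruct (Hg axis_y) as [gy [Cy Py]].
destruct (Hg axis_z) as [gz [Cz Pz]].
destruct (C1_lipschitz gx Cx) as [Lx HLx]; destruct (C1_lipschitz gy Cy) as [Ly HLy].
destruct (C1_lipschitz gz Cz) as [Lz HLz].
destruct Cx as [Cx _]; destruct Cy as [Cy _]; destruct Cz as [Cz _].
destruct (continuous_on_cylinder_bounded gx Cx) as [Mx HMx].
destruct (continuous_on_cylinder_bounded gy Cy) as [My HMy].
destruct (continuous_on_cylinder_bounded gz Cz) as [Mz HMz].
set (M := Rmax (Rmax Lx (Rmax Ly Lz)) (Rmax Mx (Rmax My Mz))).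
assert (HL : Lx <= M /\ Ly <= M /\ Lz <= M /\ Mx <= M /\ My <= M /\ Mz <= M).
{ unfold M; repeat split;
  (apply Rle_refl || eauto 6 using Rle_trans, Rmax_l, Rmax_r). }
destruct HL as [H1 [H2 [H3 [H4 [H5 H6]]]]].
assert (Hlip : forall (g : R * R * R -> R) L, L <= M ->
  (forall p q, cylinder p -> cylinder q -> Rabs (g q - g p) <= L * dist1 p q) ->
  forall p q, cylinder p -> cylinder q -> Rabs (g q - g p) <= M * dist1 p q).
{ intros g L HL H p q Hp Hq; eapply Rle_trans; [now apply H|].
  apply Rmult_le_compat_r; [apply dist1_pos|exact HL]. }
assert (HM0 : 0 <= M).
{ eapply Rle_trans; [apply Rabs_pos|eapply Rle_trans; [apply (HMx (0, 0, 0))|exact H4]].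
  split; [unfold disk|]; simpl; lra. }
assert (Bx := Hlip gx Lx H1 HLx); assert (By := Hlip gy Ly H2 HLy).
assert (Bz := Hlip gz Lz H3 HLz).
exists gx, gy, gz, M; split; [|split; [auto|]].
{ intros p Hp; split; [|split].
  - apply Rle_trans with (2 := H4); now apply HMx.
  - apply Rle_trans with (2 := H5); now apply HMy.
  - apply Rle_trans with (2 := H6); now apply HMz. }
assert (Hin : forall p q, inside p -> inside q ->
  Rabs (f q - f p - (gx p * (fst (fst q) - fst (fst p))
      + gy p * (snd (fst q) - snd (fst p)) + gz p * (snd q - snd p)))
    <= M * dist1 p q ^ 2).
{ intros p q Hp Hq.
  destruct (increment_inside f gx gy gz p q Px Py Pz Hp Hq)
    as [rx [ry [rz [[Ix [Iy Iz]] [[Dx [Dy Dz]] ->]]]]].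
  replace (_ - _) with ((gx rx - gx p) * (fst (fst q) - fst (fst p))
    + (gy ry - gy p) * (snd (fst q) - snd (fst p)) + (gz rz - gz p) * (snd q - snd p))
    by ring.
  replace (M * dist1 p q ^ 2) with (M * dist1 p q * dist1 p q) by ring.
  apply Rabs_lin3_bound.
  - eapply Rle_trans; [apply Bx; now apply inside_cylinder|now apply Rmult_le_compat_l].
  - eapply Rle_trans; [apply By; now apply inside_cylinder|now apply Rmult_le_compat_l].
  - eapply Rle_trans; [apply Bz; now apply inside_cylinder|now apply Rmult_le_compat_l]. }
intros p q Hp Hq.
set (r := fun n => 1 - / INR (n + 2)).
apply (is_lim_seq_le (fun n => Rabs (f (contract n q) - f (contract n p)
    - (gx (contract n p) * (r n * (fst (fst q) - fst (fst p)))
      + gy (contract n p) * (r n * (snd (fst q) - snd (fst p)))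
      + gz (contract n p) * (r n * (snd q - snd p)))))
  (fun _ => M * dist1 p q ^ 2)
  (Finite _) (Finite (M * dist1 p q ^ 2))).
- intros n.
  assert (H := Hin _ _ (contract_inside n p Hp) (contract_inside n q Hq)).
  assert (E1 : fst (fst (contract n q)) - fst (fst (contract n p))
    = r n * (fst (fst q) - fst (fst p))) by (unfold contract, r; cbn [fst snd]; ring).
  assert (E2 : snd (fst (contract n q)) - snd (fst (contract n p))
    = r n * (snd (fst q) - snd (fst p))) by (unfold contract, r; cbn [fst snd]; ring).
  assert (E3 : snd (contract n q) - snd (contract n p)
    = r n * (snd q - snd p)) by (unfold contract, r; cbn [fst snd]; ring).
  rewrite E1, E2, E3 in H.
  eapply Rle_trans; [exact H|].
  apply Rmult_le_compat_l; [exact HM0|].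
  apply pow_incr; split; [apply dist1_pos|apply dist1_contract].
- apply (is_lim_seq_abs _ (Finite _)).
  apply is_lim_seq_minus'; [apply is_lim_seq_minus'; now apply contract_cvg|].
  assert (Hr : forall d, is_lim_seq (fun n => r n * d) (Finite d)).
  { intros d; replace (Finite d) with (Finite (1 * d)) by (f_equal; ring).
    apply is_lim_seq_mult'; [apply is_lim_seq_contract_ratio|apply is_lim_seq_const]. }
  repeat apply is_lim_seq_plus'; apply is_lim_seq_mult'; auto; now apply contract_cvg.
- apply is_lim_seq_const.
Qed.

(** * Extension to the cube *)

Definition excess (x y : R) : R := Rmax 0 (x ^ 2 + y ^ 2 - 1).

(* With [pi q = q * (1 - k / 2)], this is the reflection [2 f (pi q) - f (2 pi q - q)]
   in the boundary of the disk, in which [pi] replaces the nearest-point map.  On the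
   unit circle [pi] has the differential of the nearest-point map, so the first order
   jets of the two sides match there. *)
Definition extend (f : R * R * R -> R) (p : R * R * R) : R :=
  let '(x, y, z) := p in
  let k := excess x y in
  2 * f (x * (1 - k / 2), y * (1 - k / 2), z) - f (x * (1 - k), y * (1 - k), z).

Lemma excess_bound (x y : R) : -1 <= x <= 1 -> -1 <= y <= 1 -> 0 <= excess x y <= 1.
Proof.
intros Hx Hy; unfold excess; split; [apply Rmax_l|].
apply Rmax_lub; [lra|nra].
Qed.

(** On the cube [0 <= k <= 1], and the squared norms are at most [(1 + k) (1 - k / 2) ^ 2 = 1 - 3 k
    ^ 2 / 4 + k ^ 3 / 4] and [(1 + k) (1 - k) ^ 2], both at most 1. *)
Lemma extend_points (x y z : R) : -1 <= x <= 1 -> -1 <= y <= 1 -> -1 <= z <= 1 ->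
  cylinder (x * (1 - excess x y / 2), y * (1 - excess x y / 2), z) /\
  cylinder (x * (1 - excess x y), y * (1 - excess x y), z).
Proof.
intros Hx Hy Hz; assert (Hk := excess_bound x y Hx Hy).
assert (Hs : x ^ 2 + y ^ 2 <= 1 + excess x y)
  by (unfold excess; assert (H := Rmax_r 0 (x ^ 2 + y ^ 2 - 1)); lra).
set (k := excess x y) in *.
split; split; try exact Hz; unfold disk; cbn [fst snd].
- replace ((x * (1 - k / 2)) ^ 2 + (y * (1 - k / 2)) ^ 2)
    with ((x ^ 2 + y ^ 2) * (1 - k / 2) ^ 2) by ring.
  apply Rle_trans with ((1 + k) * (1 - k / 2) ^ 2);
    [apply Rmult_le_compat_r; [apply pow2_ge_0|exact Hs]|].
  assert (0 <= k ^ 2 * (1 - k)) by (apply Rmult_le_pos; [apply pow2_ge_0|lra]); nra.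
- replace ((x * (1 - k)) ^ 2 + (y * (1 - k)) ^ 2)
    with ((x ^ 2 + y ^ 2) * (1 - k) ^ 2) by ring.
  apply Rle_trans with ((1 + k) * (1 - k) ^ 2);
    [apply Rmult_le_compat_r; [apply pow2_ge_0|exact Hs]|].
  assert (0 <= k * (1 - k)) by (apply Rmult_le_pos; lra).
  assert (0 <= k * (k * (1 - k))) by (apply Rmult_le_pos; lra).
  nra.
Qed.

Lemma extend_cylinder (f : R * R * R -> R) (p : R * R * R) : cylinder p ->
  extend f p = f p.
Proof.
destruct p as [[x y] z]; intros [Hd Hz]; unfold disk in Hd; cbn [fst snd] in *.
unfold extend, excess; rewrite Rmax_left by lra.
replace (1 - 0 / 2) with 1 by field; rewrite Rminus_0_r, !Rmult_1_r; ring.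
Qed.

Lemma cylinder_cube (p : R * R * R) : cylinder p -> cube p.
Proof.
destruct p as [[x y] z]; intros [Hd Hz]; unfold disk in Hd; cbn [fst snd] in *.
unfold cube; cbn [fst snd]; repeat split; try lra; nra.
Qed.

(** [excess] has a kink on the unit circle, so its linearization error is not quadratic there. The
    factor [excess x y] repairs this: it is zero in the disk, and for a step from outside into the
    disk it is itself at most [2 l]. *)
Lemma excess_increment (x y a b : R) :
  -1 <= x <= 1 -> -1 <= y <= 1 -> -1 <= x + a <= 1 -> -1 <= y + b <= 1 ->
  let l := Rabs a + Rabs b in
  let e := excess (x + a) (y + b) - excess x y in
  Rabs e <= 2 * l /\ excess x y * Rabs (e - 2 * (x * a + y * b)) <= 8 * l ^ 2.
Proof.
intros Hx Hy Hxa Hyb l e.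
assert (Hk := excess_bound x y Hx Hy).
assert (Ha := Rabs_pos a); assert (Hb := Rabs_pos b).
assert (Hxa' : Rabs (x * a) <= 1 * Rabs a)
  by (apply Rabs_mult_le_compat; [now apply Rabs_le|lra]).
assert (Hyb' : Rabs (y * b) <= 1 * Rabs b)
  by (apply Rabs_mult_le_compat; [now apply Rabs_le|lra]).
assert (Hqa : Rabs ((2 * x + a) * a) <= 2 * Rabs a)
  by (apply Rabs_mult_le_compat; [apply Rabs_le|]; lra).
assert (Hqb : Rabs ((2 * y + b) * b) <= 2 * Rabs b)
  by (apply Rabs_mult_le_compat; [apply Rabs_le|]; lra).
assert (Ha2 : a ^ 2 = Rabs a ^ 2) by (symmetry; apply pow2_abs).
assert (Hb2 : b ^ 2 = Rabs b ^ 2) by (symmetry; apply pow2_abs).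
assert (Hl2 : a ^ 2 + b ^ 2 <= l ^ 2) by (rewrite Ha2, Hb2; unfold l; nra).
apply Rabs_le_between in Hxa', Hyb', Hqa, Hqb.
assert (Hs : (x + a) ^ 2 + (y + b) ^ 2 - 1
  = x ^ 2 + y ^ 2 - 1 + (2 * x + a) * a + (2 * y + b) * b) by ring.
assert (Hl : 0 <= l) by (unfold l; lra).
split.
- unfold e, excess; rewrite Hs; unfold l; apply Rabs_le.
  unfold Rmax; destruct (Rle_dec 0 _), (Rle_dec 0 _); lra.
- destruct (Rle_lt_dec (x ^ 2 + y ^ 2) 1) as [Hp|Hp].
  + replace (excess x y) with 0 by (unfold excess; rewrite Rmax_left; lra).
    rewrite Rmult_0_l; nra.
  + assert (Ek : excess x y = x ^ 2 + y ^ 2 - 1)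
      by (unfold excess; rewrite Rmax_right; lra).
    destruct (Rle_lt_dec 1 ((x + a) ^ 2 + (y + b) ^ 2)) as [Hq|Hq].
    * replace (e - 2 * (x * a + y * b)) with (a ^ 2 + b ^ 2).
      -- rewrite Rabs_right by nra; nra.
      -- unfold e; rewrite Ek; unfold excess; rewrite Rmax_right by lra; ring.
    * replace e with (- excess x y)
        by (unfold e, excess at 2; rewrite Rmax_left by lra; ring).
      assert (excess x y <= 2 * l) by (unfold l; lra).
      assert (Rabs (- excess x y - 2 * (x * a + y * b)) <= 4 * l)
        by (apply Rabs_le; unfold l in *; lra).
      replace (8 * l ^ 2) with (2 * l * (4 * l)) by ring.
      apply Rmult_le_compat; try lra; apply Rabs_pos.
Qed.

Lemma first_order_jet_nonneg (f gx gy gz : R * R * R -> R) (M : R) :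
  first_order_jet f gx gy gz M -> 0 <= M.
Proof.
intros [H _]; destruct (H (0, 0, 0)) as [H1 _].
- split; [unfold disk|]; simpl; lra.
- eapply Rle_trans; [apply Rabs_pos|exact H1].
Qed.

(** Where [excess] is smooth, the differential of the second point is twice that of the first minus
    the identity. With [G] the gradient, the differential of [extend f] is thus [2 (G p1 - G p2)]
    applied to that of the first point, plus [G p2]. The kink meets only [G p1 - G p2], which is of
    order [k], so [excess_increment] applies. The constant is [85 = 18 + 2 * 9 + 49]. *)
Lemma extend_increment (f gx gy gz : R * R * R -> R) (M x y z a b : R) :
  first_order_jet f gx gy gz M ->
  -1 <= x <= 1 -> -1 <= y <= 1 -> -1 <= x + a <= 1 -> -1 <= y + b <= 1 -> -1 <= z <= 1 ->
  let k := excess x y in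
  let p1 := (x * (1 - k / 2), y * (1 - k / 2), z) in
  let p2 := (x * (1 - k), y * (1 - k), z) in
  let l := Rabs a + Rabs b in
  Rabs (extend f (x + a, y + b, z) - extend f (x, y, z)
    - (2 * (gx p1 - gx p2) * (a * (1 - k / 2) - x * (x * a + y * b))
       + 2 * (gy p1 - gy p2) * (b * (1 - k / 2) - y * (x * a + y * b))
       + gx p2 * a + gy p2 * b)) <= 85 * M * l ^ 2.
Proof.
intros Hjet Hx Hy Hxa Hyb Hz k p1 p2 l.
assert (HM := first_order_jet_nonneg _ _ _ _ _ Hjet).
destruct Hjet as [_ [Hlip Hjet]].
destruct (excess_increment x y a b Hx Hy Hxa Hyb) as [He1 He2]; fold k l in He1, He2.
assert (Hk := excess_bound x y Hx Hy); fold k in Hk.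
assert (Hk' := excess_bound (x + a) (y + b) Hxa Hyb).
destruct (extend_points x y z Hx Hy Hz) as [Hp1 Hp2]; fold k p1 p2 in Hp1, Hp2.
destruct (extend_points (x + a) (y + b) z Hxa Hyb Hz) as [Hq1 Hq2].
set (k' := excess (x + a) (y + b)) in *.
set (q1 := ((x + a) * (1 - k' / 2), (y + b) * (1 - k' / 2), z)) in *.
set (q2 := ((x + a) * (1 - k'), (y + b) * (1 - k'), z)) in *.
assert (Ha := Rabs_pos a); assert (Hb := Rabs_pos b).
assert (Hl : 0 <= l) by (unfold l; lra).
set (s := x * a + y * b) in *.
set (r := k' - k - 2 * s) in *.
set (e := k' - k) in *.
set (ux := a * (1 - k / 2) - (x + a) * e / 2).
set (uy := b * (1 - k / 2) - (y + b) * e / 2).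
set (E1 := f q1 - f p1 - (gx p1 * ux + gy p1 * uy)).
set (E2 := f q2 - f p2 - (gx p2 * (2 * ux - a) + gy p2 * (2 * uy - b))).
(* [rx] and [ry] are what the displacement of [p1] leaves after its linear part; [r] is the
   linearization error of [excess]. *)
set (rx := - (x + a) * r / 2 - a * s).
set (ry := - (y + b) * r / 2 - b * s).
assert (Hux : Rabs ux <= Rabs a + Rabs e / 2).
{ assert (H1 : Rabs (a * (1 - k / 2)) <= Rabs a * 1)
    by (apply Rabs_mult_le_compat; [lra|apply Rabs_le; lra]).
  assert (H2 : Rabs ((x + a) * (e / 2)) <= 1 * (Rabs e / 2)).
  { apply Rabs_mult_le_compat; [now apply Rabs_le|].
    unfold Rdiv; rewrite Rabs_mult, (Rabs_right (/ 2)) by lra; lra. }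
  replace ux with (a * (1 - k / 2) + - ((x + a) * (e / 2))) by (unfold ux; field).
  eapply Rle_trans; [apply Rabs_triang|]; rewrite Rabs_Ropp; lra. }
assert (Huy : Rabs uy <= Rabs b + Rabs e / 2).
{ assert (H1 : Rabs (b * (1 - k / 2)) <= Rabs b * 1)
    by (apply Rabs_mult_le_compat; [lra|apply Rabs_le; lra]).
  assert (H2 : Rabs ((y + b) * (e / 2)) <= 1 * (Rabs e / 2)).
  { apply Rabs_mult_le_compat; [now apply Rabs_le|].
    unfold Rdiv; rewrite Rabs_mult, (Rabs_right (/ 2)) by lra; lra. }
  replace uy with (b * (1 - k / 2) + - ((y + b) * (e / 2))) by (unfold uy; field).
  eapply Rle_trans; [apply Rabs_triang|]; rewrite Rabs_Ropp; lra. }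
(* The first point moves by at most [l + |e| <= 3 l], the second by at most [2 * 3 l + l = 7 l]; the
   squares are 9 and 49. *)
assert (HE1 : Rabs E1 <= 9 * M * l ^ 2).
{ assert (H := Hjet p1 q1 Hp1 Hq1); unfold dist1 in H.
  replace (fst (fst q1) - fst (fst p1)) with ux in H
    by (unfold q1, p1, ux, e; cbn [fst snd]; field).
  replace (snd (fst q1) - snd (fst p1)) with uy in H
    by (unfold q1, p1, uy, e; cbn [fst snd]; field).
  replace (snd q1 - snd p1) with 0 in H by (unfold q1, p1; cbn [fst snd]; ring).
  rewrite Rabs_R0, Rmult_0_r, !Rplus_0_r in H; fold E1 in H.
  eapply Rle_trans; [exact H|].
  replace (9 * M * l ^ 2) with (M * (3 * l) ^ 2) by ring.
  apply Rmult_le_compat_l; [exact HM|]; apply pow_incr.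
  assert (H1 := Rabs_pos ux); assert (H2 := Rabs_pos uy); unfold l in *; lra. }
assert (HE2 : Rabs E2 <= 49 * M * l ^ 2).
{ assert (H := Hjet p2 q2 Hp2 Hq2); unfold dist1 in H.
  replace (fst (fst q2) - fst (fst p2)) with (2 * ux - a) in H
    by (unfold q2, p2, ux, e; cbn [fst snd]; field).
  replace (snd (fst q2) - snd (fst p2)) with (2 * uy - b) in H
    by (unfold q2, p2, uy, e; cbn [fst snd]; field).
  replace (snd q2 - snd p2) with 0 in H by (unfold q2, p2; cbn [fst snd]; ring).
  rewrite Rabs_R0, Rmult_0_r, !Rplus_0_r in H; fold E2 in H.
  eapply Rle_trans; [exact H|].
  replace (49 * M * l ^ 2) with (M * (7 * l) ^ 2) by ring.
  apply Rmult_le_compat_l; [exact HM|]; apply pow_incr.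
  assert (H1 := Rabs_pos (2 * ux - a)); assert (H2 := Rabs_pos (2 * uy - b)).
  assert (H3 := Rabs_triang (2 * ux) (- a)); assert (H4 := Rabs_triang (2 * uy) (- b)).
  rewrite Rabs_Ropp, Rabs_mult, (Rabs_right 2) in H3, H4 by lra.
  unfold Rminus, l in *; lra. }
assert (Hs : Rabs s <= l).
{ unfold s; eapply Rle_trans; [apply Rabs_triang|]; unfold l.
  assert (Rabs (x * a) <= 1 * Rabs a)
    by (apply Rabs_mult_le_compat; [now apply Rabs_le|lra]).
  assert (Rabs (y * b) <= 1 * Rabs b)
    by (apply Rabs_mult_le_compat; [now apply Rabs_le|lra]).
  lra. }
assert (Hkr : forall c d, -1 <= c + d <= 1 -> Rabs d <= l ->
  k * Rabs (- (c + d) * r / 2 - d * s) <= 4 * l ^ 2 + Rabs d * l).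
{ intros c d Hcd Hd.
  assert (H1 : Rabs (- (c + d) * (r / 2)) <= 1 * (Rabs r / 2)).
  { apply Rabs_mult_le_compat; [apply Rabs_le; lra|].
    unfold Rdiv; rewrite Rabs_mult, (Rabs_right (/ 2)) by lra; lra. }
  assert (H2 : Rabs (d * s) <= Rabs d * l) by (apply Rabs_mult_le_compat; lra).
  replace (- (c + d) * r / 2 - d * s) with (- (c + d) * (r / 2) + - (d * s)) by field.
  apply Rle_trans with (k * (Rabs r / 2 + Rabs d * l)).
  - apply Rmult_le_compat_l; [lra|].
    eapply Rle_trans; [apply Rabs_triang|]; rewrite Rabs_Ropp; lra.
  - assert (0 <= Rabs d * l) by (apply Rmult_le_pos; [apply Rabs_pos|lra]); nra. }
assert (Hrx := Hkr x a Hxa ltac:(unfold l; lra)); fold rx in Hrx.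
assert (Hry := Hkr y b Hyb ltac:(unfold l; lra)); fold ry in Hry.
destruct (Hlip p2 p1 Hp2 Hp1) as [HGx [HGy _]].
assert (D : dist1 p2 p1 <= k).
{ unfold dist1, p1, p2; cbn [fst snd]; rewrite Rminus_diag, Rabs_R0, Rplus_0_r.
  assert (forall t, -1 <= t <= 1 -> Rabs (t * (1 - k / 2) - t * (1 - k)) <= k / 2).
  { intros t Ht; replace (t * (1 - k / 2) - t * (1 - k)) with (t * (k / 2)) by field.
    rewrite <- (Rmult_1_l (k / 2)).
    apply Rabs_mult_le_compat; [now apply Rabs_le|apply Rabs_le; lra]. }
  assert (H1 := H x Hx); assert (H2 := H y Hy); lra. }
assert (HG : forall g t, Rabs g <= M * dist1 p2 p1 -> Rabs (2 * g * t) <= 2 * M * (k * Rabs t)).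
{ intros g t Hg; rewrite !Rabs_mult, (Rabs_right 2) by lra.
  assert (Rabs g <= M * k) by (eapply Rle_trans; [exact Hg|apply Rmult_le_compat_l; lra]).
  assert (Ht := Rabs_pos t); nra. }
assert (HX := HG _ rx HGx); assert (HY := HG _ ry HGy).
replace (extend f (x + a, y + b, z) - extend f (x, y, z) - _)
  with (2 * (gx p1 - gx p2) * rx + 2 * (gy p1 - gy p2) * ry + (2 * E1 + - E2)).
- eapply Rle_trans; [apply Rabs_triang|].
  eapply Rle_trans; [apply Rplus_le_compat; apply Rabs_triang|].
  rewrite Rabs_Ropp, (Rabs_mult 2 E1), (Rabs_right 2) by lra.
  assert (2 * M * (k * Rabs rx) + 2 * M * (k * Rabs ry) <= 18 * M * l ^ 2).
  { replace (18 * M * l ^ 2) with (2 * M * (9 * l ^ 2)) by ring.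
    rewrite <- Rmult_plus_distr_l; apply Rmult_le_compat_l; [lra|].
    apply Rle_trans with (8 * l ^ 2 + (Rabs a + Rabs b) * l); [lra|fold l; lra]. }
  lra.
- change (extend f (x + a, y + b, z)) with (2 * f q1 - f q2).
  change (extend f (x, y, z)) with (2 * f p1 - f p2).
  unfold E1, E2, ux, uy, rx, ry, r; fold e; field.
Qed.

(** A slope in [x] or [y] consists of two doubled differences of gradients and one gradient, with
    factors at most 1: [4 + 4 + 1 = 9]. In [z] both reflected points move together, because [excess]
    does not involve [z]. *)
Lemma extend_coordinate_jets (f gx gy gz : R * R * R -> R) (M : R) :
  first_order_jet f gx gy gz M -> coordinate_jets (extend f) (85 * M) (9 * M).
Proof.
intros Hjet [[x y] z] i [Hx [Hy Hz]]; cbn [fst snd] in Hx, Hy, Hz.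
assert (HM := first_order_jet_nonneg _ _ _ _ _ Hjet).
destruct (extend_points x y z Hx Hy Hz) as [Hp1 Hp2].
assert (Hk := excess_bound x y Hx Hy).
assert (Hinc := fun a b => extend_increment f gx gy gz M x y z a b Hjet Hx Hy).
set (k := excess x y) in *; cbv zeta in Hinc.
set (p1 := (x * (1 - k / 2), y * (1 - k / 2), z)) in *.
set (p2 := (x * (1 - k), y * (1 - k), z)) in *.
destruct (proj1 Hjet p1 Hp1) as [B1x [B1y B1z]].
destruct (proj1 Hjet p2 Hp2) as [B2x [B2y B2z]].
assert (Hdiff : forall g h, Rabs g <= M -> Rabs h <= M -> Rabs (2 * (g - h)) <= 4 * M).
{ intros g h Hg Hh; apply Rabs_le_between in Hg, Hh; apply Rabs_le; lra. }
assert (Hd : forall u v w t1 t2, Rabs u <= 4 * M -> Rabs v <= 4 * M -> Rabs w <= M ->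
  Rabs t1 <= 1 -> Rabs t2 <= 1 -> Rabs (u * t1 + v * t2 + w) <= 9 * M).
{ intros u v w t1 t2 Hu Hv Hw H1 H2.
  assert (Rabs (u * t1) <= 4 * M * 1) by now apply Rabs_mult_le_compat.
  assert (Rabs (v * t2) <= 4 * M * 1) by now apply Rabs_mult_le_compat.
  eapply Rle_trans; [apply Rabs_triang|].
  eapply Rle_trans; [apply Rplus_le_compat_r, Rabs_triang|]; lra. }
destruct i.
- exists (2 * (gx p1 - gx p2) * (1 - k / 2 - x ^ 2) + 2 * (gy p1 - gy p2) * (- (y * x))
    + gx p2); split.
  + apply Hd; auto; apply Rabs_le; split; nra.
  + intros h [Hxh _]; cbn in Hxh.
    assert (H := Hinc h 0 Hxh ltac:(lra) Hz).
    rewrite Rplus_0_r, Rabs_R0, Rplus_0_r, pow2_abs in H; cbn [shift].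
    replace ((2 * (gx p1 - gx p2) * (1 - k / 2 - x ^ 2) + _ + gx p2) * h)
      with (2 * (gx p1 - gx p2) * (h * (1 - k / 2) - x * (x * h + y * 0))
       + 2 * (gy p1 - gy p2) * (0 * (1 - k / 2) - y * (x * h + y * 0))
       + gx p2 * h + gy p2 * 0) by ring.
    exact H.
- exists (2 * (gx p1 - gx p2) * (- (x * y)) + 2 * (gy p1 - gy p2) * (1 - k / 2 - y ^ 2)
    + gy p2); split.
  + apply Hd; auto; apply Rabs_le; split; nra.
  + intros h [_ [Hyh _]]; cbn in Hyh.
    assert (H := Hinc 0 h ltac:(lra) Hyh Hz).
    rewrite Rplus_0_r, Rabs_R0, Rplus_0_l, pow2_abs in H; cbn [shift].
    replace ((2 * (gx p1 - gx p2) * (- (x * y)) + _ + gy p2) * h)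
      with (2 * (gx p1 - gx p2) * (0 * (1 - k / 2) - x * (x * 0 + y * h))
       + 2 * (gy p1 - gy p2) * (h * (1 - k / 2) - y * (x * 0 + y * h))
       + gx p2 * 0 + gy p2 * h) by ring.
    exact H.
- exists (2 * gz p1 - gz p2); split.
  + apply Rabs_le_between in B1z, B2z; apply Rabs_le; lra.
  + intros h [_ [_ Hzh]]; cbn in Hzh.
    destruct (extend_points x y (z + h) Hx Hy Hzh) as [Hq1 Hq2]; fold k in Hq1, Hq2.
    destruct Hjet as [_ [_ Hjet]].
    assert (H1 := Hjet _ _ Hp1 Hq1); assert (H2 := Hjet _ _ Hp2 Hq2).
    unfold dist1 in H1, H2.
    unfold p1 in H1 at 3 5 7 8 9 10; unfold p2 in H2 at 3 5 7 8 9 10.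
    cbn [fst snd] in H1, H2.
    rewrite !Rminus_diag, Rabs_R0, !Rmult_0_r, !Rplus_0_l in H1, H2.
    replace (z + h - z) with h in H1, H2 by ring; rewrite pow2_abs in H1, H2.
    cbn [shift]; change (extend f (x, y, z)) with (2 * f p1 - f p2).
    match type of H1 with Rabs (f ?q - _ - _) <= _ =>
      match type of H2 with Rabs (f ?q' - _ - _) <= _ =>
        change (extend f (x, y, z + h)) with (2 * f q - f q') end end.
    apply Rabs_le_between in H1, H2; apply Rabs_le.
    assert (0 <= M * h ^ 2) by (apply Rmult_le_pos; [lra|apply pow2_ge_0]); lra.
Qed.

(** * Convergence *)

Lemma clamp_continuous (a b s : R) : continuous (fun s => Rmax a (Rmin b s)) s.
Proof.
apply (continuous_ext (fun s => (a + (b + s - Rabs (b - s)) / 2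
  + Rabs (a - (b + s - Rabs (b - s)) / 2)) / 2)).
{ intros t; unfold Rmax, Rmin, Rabs.
  destruct (Rle_dec b t), (Rcase_abs (b - t)); destruct (Rle_dec a _), (Rcase_abs _); lra. }
assert (H : continuous (fun s => (b + s - Rabs (b - s)) / 2) s).
{ apply (continuous_mult (fun s => b + s - Rabs (b - s)) (fun _ => / 2));
    [|apply continuous_const].
  apply (continuous_minus (V := R_NormedModule) (fun s => b + s) (fun s => Rabs (b - s))).
  - apply (continuous_plus (V := R_NormedModule) (fun _ => b) (fun s => s));
      [apply continuous_const|apply continuous_id].
  - apply (continuous_comp (fun s => b - s) Rabs).
    + apply (continuous_minus (V := R_NormedModule) (fun _ => b) (fun s => s));
        [apply continuous_const|apply continuous_id].
    + apply continuous_Rabs. }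
apply (continuous_mult (fun s => _ + _) (fun _ => / 2)); [|apply continuous_const].
apply (continuous_plus (V := R_NormedModule)).
- apply (continuous_plus (V := R_NormedModule) (fun _ => a)); [apply continuous_const|exact H].
- apply (continuous_comp (fun s => a - (b + s - Rabs (b - s)) / 2) Rabs).
  + apply (continuous_minus (V := R_NormedModule) (fun _ => a)); [apply continuous_const|exact H].
  + apply continuous_Rabs.
Qed.

Lemma continuous_chord (phi t z s : R) :
  continuous (fun s => (chord phi t s, z)) s.
Proof.
intros P HP; unfold chord in HP.
destruct (proj1 (locally_prod3 _ _ _ P) HP) as [d Hd].
exists d; intros u Hu; change (Rabs (u - s) < d) in Hu.
assert (Hle : forall w, Rabs w <= 1 -> Rabs ((u - s) * w) < d).
{ intros w Hw; apply Rle_lt_trans with (2 := Hu).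
  rewrite <- (Rmult_1_r (Rabs (u - s))); apply Rabs_mult_le_compat; [lra|exact Hw]. }
apply Hd.
- replace (_ - _) with ((u - s) * sin phi) by ring; apply Hle, Rabs_le, SIN_bound.
- replace (_ - _) with ((u - s) * - cos phi) by ring.
  apply Hle; rewrite Rabs_Ropp; apply Rabs_cos_le1.
- rewrite Rminus_diag, Rabs_R0; apply cond_pos.
Qed.

(** [f] is continuous only relative to the cylinder and may jump where the line leaves it. Clamping
    the parameter to the chord gives a function that is continuous on the whole line and agrees with
    the integrand on the chord. *)
Lemma chord_integrable_continuous_on (f : R * R * R -> R) :
  continuous_on cylinder f -> chord_integrable f.
Proof.
intros Hf phi t z Ht Hz.
set (r := sqrt (1 - t ^ 2)).
assert (Hr : 0 <= r) by apply sqrt_pos.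
set (c := fun s => Rmax (- r) (Rmin r s)).
assert (Hc : forall s, - r <= c s <= r).
{ intros s; unfold c; split; [apply Rmax_l|apply Rmax_lub; [lra|apply Rmin_l]]. }
apply (ex_RInt_ext (fun s => f (chord phi t (c s), z))).
{ intros s Hs; rewrite Rmin_left, Rmax_right in Hs by lra.
  unfold c; rewrite Rmin_right, Rmax_right by lra; reflexivity. }
apply (ex_RInt_continuous (V := R_CompleteNormedModule)); intros s _.
assert (Hcyl : forall s, cylinder (chord phi t (c s), z)).
{ intros u; split; [now apply chord_disk|exact Hz]. }
apply (filterlim_comp _ _ _ (fun s => (chord phi t (c s), z)) f _
  (within cylinder (locally (chord phi t (c s), z)))); [|apply Hf, Hcyl].
assert (Hcont : continuous (fun s => (chord phi t (c s), z)) s).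
{ apply (continuous_comp c (fun s => (chord phi t s, z)));
    [apply clamp_continuous|apply continuous_chord]. }
intros P HP; destruct (Hcont _ HP) as [d Hd].
exists d; intros u Hu; exact (Hd u Hu (Hcyl u)).
Qed.

(* With [s = M ^ (1 / 8)], where [M = 4 * INR n], the left-hand side is at
   most [162 / s ^ 2], since [ln M = 8 ln s <= 8 (s - 1)]. *)
Lemma log_sqr_over_sqrt_vanishes (c : R) : 0 < c -> exists N, forall n, (N <= n)%nat ->
  (1 + ln (4 * INR n)) ^ 2 / sqrt (INR n) < c.
Proof.
intros Hc; set (t := 162 / c).
assert (Ht : 0 < t) by (unfold t; apply Rdiv_lt_0_compat; lra).
destruct (INR_unbounded (t ^ 4 + 1)) as [N HN].
exists (S N); intros n Hn.
assert (HnN : INR N <= INR n) by (apply le_INR; lia).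
assert (Hn1 : 1 <= INR n) by (apply (le_INR 1); lia).
set (M := 4 * INR n); assert (HM : 1 <= M) by (unfold M; lra).
assert (Hsq : forall x, 1 <= x -> 1 <= sqrt x)
  by (intros x Hx; rewrite <- sqrt_1; now apply sqrt_le_1_alt).
set (s4 := sqrt M); set (s2 := sqrt s4); set (s := sqrt s2).
assert (H4 : 1 <= s4) by now apply Hsq.
assert (H2 : 1 <= s2) by now apply Hsq.
assert (H1 : 1 <= s) by now apply Hsq.
assert (E4 : s4 * s4 = M) by (apply sqrt_sqrt; lra).
assert (E2 : s2 * s2 = s4) by (apply sqrt_sqrt; lra).
assert (E1 : s * s = s2) by (apply sqrt_sqrt; lra).
assert (Esq : sqrt (INR n) = s4 / 2).
{ apply Rsqr_inj; [apply sqrt_pos|lra|].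
  unfold Rsqr; rewrite sqrt_sqrt by lra.
  replace (s4 / 2 * (s4 / 2)) with (s4 * s4 / 4) by field; rewrite E4; unfold M; field. }
assert (Hln : ln M = 8 * ln s).
{ rewrite <- E4, <- E2, <- E1, !ln_mult by nra; ring. }
assert (Hls := ln_le_id s ltac:(lra)).
assert (Hl0 := ln_ge_0 s H1).
rewrite Esq, Hln.
apply Rle_lt_trans with ((9 * s) ^ 2 / (s4 / 2)).
- apply Rmult_le_compat_r; [apply Rlt_le, Rinv_0_lt_compat; lra|].
  apply pow_incr; lra.
- replace ((9 * s) ^ 2 / (s4 / 2)) with (162 / s2).
  2:{ replace ((9 * s) ^ 2) with (81 * (s * s)) by ring.
      rewrite E1, <- E2; field; lra. }
  assert (Hts : t < s2).
  { destruct (Rlt_le_dec t s2) as [H|H]; [exact H|exfalso].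
    assert (s2 ^ 4 <= t ^ 4) by (apply pow_incr; lra).
    replace (s2 ^ 4) with M in * by (rewrite <- E4, <- E2; ring).
    unfold M in *; lra. }
  apply Rmult_lt_reg_r with s2; [lra|].
  unfold Rdiv; rewrite Rmult_assoc, Rinv_l by lra.
  replace (162 * 1) with (c * t) by (unfold t; field; lra).
  apply Rmult_lt_compat_l; lra.
Qed.

Theorem corollary3p9 (f : R * R * R -> R) (hf : Ck_on 2 cylinder f) :
  converges_uniformly_on cylinder (fun m : nat => B2m m f) f.
Proof.
intros eps Heps.
destruct (C2_first_order_jet f hf) as [gx [gy [gz [M Hjet]]]].
assert (HM := first_order_jet_nonneg _ _ _ _ _ Hjet).
assert (HF := extend_coordinate_jets f gx gy gz M Hjet).
(* Below, [n <= 3 (k + 2)] turns [1 / (k + 2) ^ 2] into [9 / n ^ 2]; the added 1 keeps [A] positive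
   when [M = 0]. *)
set (A := (48 * (9 * M) + 96 * (85 * M)) * 9 + 1).
assert (HA : 0 < A) by (unfold A; lra).
(* [769 = 768 + 1]: the image of the approximation error under [B2m], and that error itself. *)
destruct (log_sqr_over_sqrt_vanishes (eps / (769 * A))) as [N HN].
{ apply Rdiv_lt_0_compat; lra. }
exists (S N); intros m Hm p Hp.
set (n := (2 * m + 1)%nat).
assert (Hn3 : 3 <= INR n)
  by (replace 3 with (INR 3) by (simpl; ring); apply le_INR; unfold n; lia).
assert (Hsq : 1 <= sqrt (INR n)) by (rewrite <- sqrt_1; apply sqrt_le_1_alt; lra).
specialize (HN n ltac:(unfold n; lia)).
set (L := (1 + ln (4 * INR n)) ^ 2) in *.
assert (HL : 1 <= L).
{ assert (H := ln_ge_0 (4 * INR n) ltac:(lra)); unfold L; nra. }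
(* The largest degree per variable with [3 k < 2 m]. *)
set (k := ((2 * m - 1) / 3)%nat).
assert (Hk : (3 * k < 2 * m)%nat /\ (n <= 3 * (k + 2))%nat).
{ assert (H := Nat.div_mod_eq (2 * m - 1) 3).
  assert (H' := Nat.mod_upper_bound (2 * m - 1) 3 ltac:(lia)).
  fold k in H; unfold n; lia. }
destruct Hk as [Hk1 Hk2].
destruct (polynomial_approximation (extend f) _ _ k (Rmult_le_pos 85 M ltac:(lra) HM) HF)
  as [P [HP1 HP2]].
set (delta := A / INR n ^ 2).
assert (Hclose : forall q, cylinder q -> Rabs (f q - P q) <= delta).
{ intros q Hq; rewrite Rabs_minus_sym, <- (extend_cylinder f q Hq).
  eapply Rle_trans; [apply HP2; now apply cylinder_cube|].
  assert (Hk3 : INR n <= 3 * INR (k + 2)).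
  { replace 3 with (INR 3) by (simpl; ring); rewrite <- mult_INR; now apply le_INR. }
  unfold delta; apply Rmult_le_reg_r with (INR n ^ 2 * INR (k + 2) ^ 2); [|].
  { apply Rmult_lt_0_compat; apply pow_lt; lra. }
  replace ((48 * (9 * M) + 96 * (85 * M)) / INR (k + 2) ^ 2 * (INR n ^ 2 * INR (k + 2) ^ 2))
    with ((48 * (9 * M) + 96 * (85 * M)) * INR n ^ 2) by (field; lra).
  replace (A / INR n ^ 2 * (INR n ^ 2 * INR (k + 2) ^ 2)) with (A * INR (k + 2) ^ 2)
    by (field; lra).
  assert (INR n ^ 2 <= 9 * INR (k + 2) ^ 2) by nra.
  unfold A; assert (0 <= INR (k + 2) ^ 2) by apply pow2_ge_0; nra. }
assert (HPr := HP1 m p ltac:(lia) Hk1 (proj1 Hp)).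
destruct HPr as [HPint HPeq].
assert (Hfint := chord_integrable_continuous_on f (proj1 hf)).
assert (Heint := chord_integrable_lin 1 (-1) f P Hfint HPint).
assert (Hdif : forall q, 1 * f q + (-1) * P q = f q - P q) by (intros; ring).
(* Since [P] is reproduced, [B2m] acts on the error [f - P] only, written in the form that [B2m_lin]
   expects. *)
replace (B2m m f p - f p)
  with (B2m m (fun q => 1 * f q + (-1) * P q) p + (P p - f p))
  by (rewrite B2m_lin, HPeq by (auto; lia); ring).
assert (HB := B2m_bound m _ p delta ltac:(lia) Heint Hp
  (fun q Hq => eq_ind_r (fun t => Rabs t <= delta) (Hclose q Hq) (Hdif q))).
fold n in HB; fold L in HB.
assert (Hfin : delta * (768 * INR n ^ 2 / sqrt (INR n) * L) + delta < eps).
{ replace (delta * (768 * INR n ^ 2 / sqrt (INR n) * L)) with (768 * A * (L / sqrt (INR n)))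
    by (unfold delta; field; lra).
  (* As [n >= 1] and [L >= 1], [1 / n ^ 2 <= 1 / sqrt n <= L / sqrt n]. *)
  assert (Hd : delta <= A * (L / sqrt (INR n))).
  { unfold delta; apply Rmult_le_compat_l; [lra|].
    assert (Hs2 : sqrt (INR n) * sqrt (INR n) = INR n) by (apply sqrt_sqrt; lra).
    apply Rle_trans with (1 / sqrt (INR n)).
    - unfold Rdiv; rewrite Rmult_1_l; apply Rinv_le_contravar; [lra|nra].
    - apply Rmult_le_compat_r; [apply Rlt_le, Rinv_0_lt_compat; lra|exact HL]. }
  apply Rle_lt_trans with (769 * A * (L / sqrt (INR n))); [lra|].
  replace eps with (769 * A * (eps / (769 * A))) at 1 by (field; lra).
  apply Rmult_lt_compat_l; lra. }
eapply Rle_lt_trans; [apply Rabs_triang|].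
assert (HC := Hclose p Hp); rewrite Rabs_minus_sym in HC; lra.
Qed.
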